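(* There is a constant $C>0$ such that for all non-negative integers $n,r,h$, $$\mathbb{E}\left(L_n(r)-L_n(r+h)\right)^4\le C\,h^2n.$$ Consequently, the sequence of processes $(l_n(t))_{t\ge0}$, $l_n(t)=\frac1{\sqrt n}L_n(t\sqrt n)$, is tight in $C[0,\infty)$.
   Context: For a uniformly random unlabelled rooted tree (rooted tree up to root-preserving isomorphism) with $n$ vertices, $L_n(k)$ ($k$ a non-negative integer) is the number of vertices at distance $k$ from the root, and for non-integer $t\ge0$, $L_n(t)=(\lfloor t\rfloor+1-t)L_n(\lfloor t\rfloor)+(t-\lfloor t\rfloor)L_n(\lfloor t\rfloor+1)$. *)

(* Defs.v *)
From Stdlib Require Import Reals Lra List Permutation ClassicalDescription.
Open Scope R_scope.

(** Plane rooted trees (children in a list); unlabelled rooted trees are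
    their classes modulo [iso] (reordering children recursively). *)
Inductive tree : Type := Node : list tree -> tree.

Inductive iso : tree -> tree -> Prop :=
| iso_Node : forall (cs ds ds' : list tree),
    Forall2 iso cs ds' -> Permutation ds' ds -> iso (Node cs) (Node ds).

Fixpoint tsize (t : tree) : nat :=
  match t with
  | Node cs => S ((fix f (l : list tree) : nat :=
                    match l with nil => O | c :: l' => (tsize c + f l')%nat end) cs)
  end.

Fixpoint level (t : tree) (k : nat) : nat :=
  match t with
  | Node cs =>
    match k with
    | O => 1%nat
    | S k' => (fix f (l : list tree) : nat :=
                 match l with nil => O | c :: l' => (level c k' + f l')%nat end) cs
    end
  end.

Definition Linterp (t : tree) (x : R) : R :=
  let k := Z.to_nat (Int_part x) in
  (INR k + 1 - x) * INR (level t k) + (x - INR k) * INR (level t (S k)).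

Definition lproc (n : nat) (t : tree) (x : R) : R :=
  / sqrt (INR n) * Linterp t (x * sqrt (INR n)).

Definition rep_system (n : nat) (s : list tree) : Prop :=
  (forall t, In t s -> tsize t = n) /\
  (forall t, tsize t = n -> exists u, In u s /\ iso t u) /\
  (forall i j t u, nth_error s i = Some t -> nth_error s j = Some u ->
                   iso t u -> i = j).

(** Expectation under the uniform distribution on a system of representatives
    (i.e. uniform over unlabelled rooted trees). *)
Definition avg (s : list tree) (F : tree -> R) : R :=
  fold_right (fun t acc => F t + acc) 0 s / INR (length s).

Definition prob (s : list tree) (P : tree -> Prop) : R :=
  avg s (fun t => if excluded_middle_informative (P t) then 1 else 0).

(** Elements of C[0,oo) are represented by functions R -> R, only their
    values on [0,oo) matter. *)
Definition cont_on_nonneg (g : R -> R) : Prop :=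
  forall x, 0 <= x -> forall e, 0 < e -> exists d, 0 < d /\
    forall y, 0 <= y -> Rabs (y - x) < d -> Rabs (g y - g x) < e.

Definition cvgC (u : nat -> R -> R) (g : R -> R) : Prop :=
  forall T e, 0 < e -> exists N, forall m, (N <= m)%nat ->
    forall x, 0 <= x <= T -> Rabs (u m x - g x) < e.

(** Compact subsets of C[0,oo) (a metrizable space, so compact =
    sequentially compact). *)
Definition compactC (K : (R -> R) -> Prop) : Prop :=
  (forall g, K g -> cont_on_nonneg g) /\
  (forall u : nat -> R -> R, (forall m, K (u m)) ->
     exists phi : nat -> nat, (forall m, (phi m < phi (S m))%nat) /\
     exists g, K g /\ cvgC (fun m => u (phi m)) g).

(** Tightness in C[0,oo) of the laws of (l_n)_{n>=1}, where the law of l_n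
    is the image of the uniform distribution on [reps n]. *)
Definition tightC (reps : nat -> list tree) : Prop :=
  forall eps, 0 < eps -> exists K, compactC K /\
    forall n, (1 <= n)%nat ->
      prob (reps n) (fun t => ~ exists g, K g /\
                          forall x, 0 <= x -> g x = lproc n t x) <= eps.

(* Main.v *)
(** Let [T(z)] be the generating function of unlabelled rooted trees.  For
    [X_j = L(j) - L(j+h)], which is additive over the subtrees at the root, let
    [m_i(j) = sum_t z^|t| X_j(t)^i].  Splitting a multiset of subtrees by the
    multiplicity of its members gives, with [k_i(z) = sum_(c >= 1) c^(i-1) m_i(z^c)],
    [m_4(j+1) = T (k_4 + 4 k_1 k_3 + 3 k_2^2 + 6 k_1^2 k_2 + k_1^4)] and likewise for
    the lower moments.  The terms with [c >= 2] only involve [z^2, z^3, ...]; they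
    have radius of convergence larger than that of [T] and decay exponentially in [j].
    Up to them all moments are polynomials in [T], and telescoping the factors
    [1 - T] that [k_1] carries shows that [m_4(j)] has coefficients [O(h^2)] as a
    polynomial in [T].  No asymptotics of the number [t_n] of trees is needed:
    coefficientwise [1/(1 - T) <= z T'] away from [z^0], so that
    [[z^n] m_4(j) = O(h^2 n t_n)], which is the moment bound.  Tightness follows by
    chaining over dyadic points (Kolmogorov) and an Arzela-Ascoli argument. *)

Require Import Defs.
From Stdlib Require Import Reals ZArith Lra Lia List Permutation Arith
  FunctionalExtensionality Classical ClassicalEpsilon.
Import ListNotations.
Open Scope R_scope.

(** * Finite sums *)

(** The level [r] is unbounded, yet the bound must not depend on it. Unrolling the recursion of
    [m_4] gives [sum_(j < r) T^(r - j) f_j]. If [f_j] is nearly [T^(a j)] with [a >= 2], the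
    exponents [r - j + a j] are distinct and the coefficients in [T] stay bounded although there are
    [r] terms; for [a = 1] everything piles up on [T^r]. This dictates two norms: a
    submultiplicative one for the factors and a supremum norm for such sums.

    By themselves [k_2] and [k_3] are not nearly geometric uniformly in the level, so they are
    corrected. With [k_1 = (1 - T) u_1 - d_1], adding [k_1 u_1] to [k_2] absorbs its source. The
    corrector of [k_3] is controlled in the supremum norm only, so [k_1 k_3] needs a summation by
    parts that uses the factor [1 - T] of [k_1].

    Coefficients are compared with those of [2 / (1 - T) - 1], which at least double at each step.
    Hence series in [z] are measured at [z = 1/2] and repeated subtrees at [1/4] or below, and all
    that has to be known about the radius of convergence of [T] is that it exceeds [1/4]. *)

Definition lsum {A : Type} (f : A -> R) (l : list A) : R :=
  fold_right (fun x acc => f x + acc) 0 l.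

Lemma lsum_cons {A} (f : A -> R) x l : lsum f (x :: l) = f x + lsum f l.
Proof. reflexivity. Qed.

Lemma lsum_app {A} (f : A -> R) l l' : lsum f (l ++ l') = lsum f l + lsum f l'.
Proof. induction l as [|x l IH]; simpl; [|rewrite IH]; lra. Qed.

Lemma lsum_map {A B} (g : A -> B) (f : B -> R) l :
  lsum f (map g l) = lsum (fun x => f (g x)) l.
Proof. induction l as [|x l IH]; simpl; [|rewrite IH]; reflexivity. Qed.

Lemma lsum_ext {A} (f g : A -> R) l :
  (forall x, In x l -> f x = g x) -> lsum f l = lsum g l.
Proof.
  induction l as [|x l IH]; intros H; [reflexivity|].
  rewrite !lsum_cons, (H x), IH; auto with datatypes.
Qed.

Lemma lsum_le {A} (f g : A -> R) l :
  (forall x, In x l -> f x <= g x) -> lsum f l <= lsum g l.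
Proof.
  induction l as [|x l IH]; intros H; [apply Rle_refl|].
  rewrite !lsum_cons. apply Rplus_le_compat; auto with datatypes.
Qed.

Lemma lsum_0 {A} (f : A -> R) l : (forall x, In x l -> f x = 0) -> lsum f l = 0.
Proof.
  induction l as [|x l IH]; intros H; [reflexivity|].
  rewrite lsum_cons, (H x), IH; auto with datatypes; lra.
Qed.

Lemma lsum_ge0 {A} (f : A -> R) l : (forall x, In x l -> 0 <= f x) -> 0 <= lsum f l.
Proof.
  induction l as [|x l IH]; intros H; [apply Rle_refl|].
  rewrite lsum_cons. apply Rplus_le_le_0_compat; auto with datatypes.
Qed.

Lemma lsum_plus {A} (f g : A -> R) l :
  lsum (fun x => f x + g x) l = lsum f l + lsum g l.
Proof. induction l as [|x l IH]; simpl; [|rewrite IH]; lra. Qed.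

Lemma lsum_minus {A} (f g : A -> R) l :
  lsum (fun x => f x - g x) l = lsum f l - lsum g l.
Proof. induction l as [|x l IH]; simpl; [|rewrite IH]; lra. Qed.

Lemma lsum_scal {A} c (f : A -> R) l : lsum (fun x => c * f x) l = c * lsum f l.
Proof. induction l as [|x l IH]; simpl; [|rewrite IH]; lra. Qed.

Lemma lsum_scal_r {A} c (f : A -> R) l : lsum (fun x => f x * c) l = lsum f l * c.
Proof. induction l as [|x l IH]; simpl; [|rewrite IH]; lra. Qed.

Lemma lsum_exch {A B} (F : A -> B -> R) l l' :
  lsum (fun x => lsum (F x) l') l = lsum (fun y => lsum (fun x => F x y) l) l'.
Proof.
  induction l as [|x l IH]; simpl.
  - symmetry. apply lsum_0; auto.
  - rewrite IH, lsum_plus. reflexivity.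
Qed.

Lemma lsum_abs {A} (f : A -> R) l : Rabs (lsum f l) <= lsum (fun x => Rabs (f x)) l.
Proof.
  induction l as [|x l IH]; simpl; [rewrite Rabs_R0; lra|].
  eapply Rle_trans; [apply Rabs_triang|]. lra.
Qed.

Lemma lsum_perm {A} (f : A -> R) l l' : Permutation l l' -> lsum f l = lsum f l'.
Proof. induction 1; simpl in *; lra. Qed.

Lemma lsum_In_le {A} (f : A -> R) l x :
  (forall y, In y l -> 0 <= f y) -> In x l -> f x <= lsum f l.
Proof.
  induction l as [|y l IH]; intros H []; rewrite lsum_cons.
  - subst. assert (0 <= lsum f l) by (apply lsum_ge0; auto with datatypes). lra.
  - assert (0 <= f y) by auto with datatypes.
    assert (f x <= lsum f l) by auto with datatypes. lra.
Qed.

Lemma lsum_const {A} c (l : list A) : lsum (fun _ => c) l = INR (length l) * c.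
Proof.
  induction l as [|x l IH]; [simpl; lra|].
  rewrite lsum_cons, IH. simpl length. rewrite S_INR. lra.
Qed.

Lemma lsum_seq_shift (f : nat -> R) a n :
  lsum f (seq (S a) n) = lsum (fun i => f (S i)) (seq a n).
Proof. rewrite <- seq_shift, lsum_map. reflexivity. Qed.

Lemma lsum_seq_0 (f : nat -> R) n :
  lsum f (seq 0 (S n)) = f 0%nat + lsum (fun i => f (S i)) (seq 0 n).
Proof. simpl seq. rewrite lsum_cons, lsum_seq_shift. reflexivity. Qed.

Lemma lsum_seq_S (f : nat -> R) a n :
  lsum f (seq a (S n)) = lsum f (seq a n) + f (a + n)%nat.
Proof. rewrite seq_S, lsum_app. simpl. lra. Qed.

Lemma lsum_seq_rev (f : nat -> R) n :
  lsum f (seq 0 (S n)) = lsum (fun i => f (n - i)%nat) (seq 0 (S n)).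
Proof.
  induction n as [|n IH]; [reflexivity|].
  rewrite lsum_seq_S, IH, (lsum_seq_0 _ (S n)), Rplus_comm.
  reflexivity.
Qed.

Lemma lsum_seq_extend (f : nat -> R) a n m :
  (n <= m)%nat -> (forall i, (a + n <= i < a + m)%nat -> f i = 0) ->
  lsum f (seq a m) = lsum f (seq a n).
Proof.
  intros H Hz. replace m with (n + (m - n))%nat by lia.
  rewrite seq_app, lsum_app, (lsum_0 f (seq (a + n) _)); [lra|].
  intros i Hi. apply in_seq in Hi. apply Hz. lia.
Qed.

Lemma lsum_seq_le_extend (f : nat -> R) a n m :
  (n <= m)%nat -> (forall i, 0 <= f i) -> lsum f (seq a n) <= lsum f (seq a m).
Proof.
  intros H Hz. replace m with (n + (m - n))%nat by lia.
  rewrite seq_app, lsum_app.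
  assert (0 <= lsum f (seq (a + n) (m - n))) by (apply lsum_ge0; auto). lra.
Qed.

Lemma lsum_shift_le (f : nat -> R) s n : (forall i, 0 <= f i) ->
  lsum (fun m => if (s <=? m)%nat then f (m - s)%nat else 0) (seq 0 n) <= lsum f (seq 0 n).
Proof.
  intros Hf.
  assert (H : lsum (fun m => if (s <=? m)%nat then f (m - s)%nat else 0) (seq 0 n)
              = lsum f (seq 0 (n - s))).
  { induction n as [|n IH]; [reflexivity|]. rewrite lsum_seq_S, IH, Nat.add_0_l.
    destruct (Nat.leb_spec s n).
    - replace (S n - s)%nat with (S (n - s)) by lia. rewrite lsum_seq_S. reflexivity.
    - replace (S n - s)%nat with 0%nat by lia. replace (n - s)%nat with 0%nat by lia.
      simpl. ring. }
  rewrite H. apply lsum_seq_le_extend; [lia|assumption].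
Qed.

Lemma lsum_indicator (f : nat -> R) k a n :
  lsum (fun m => if Nat.eqb k m then f m else 0) (seq a n)
  = if andb (a <=? k)%nat (k <? a + n)%nat then f k else 0.
Proof.
  induction n as [|n IH].
  - simpl. destruct (Nat.leb_spec a k), (Nat.ltb_spec k (a + 0)); simpl; try reflexivity; lia.
  - rewrite lsum_seq_S, IH.
    destruct (Nat.leb_spec a k), (Nat.ltb_spec k (a + n)), (Nat.ltb_spec k (a + S n)),
      (Nat.eqb_spec k (a + n)); simpl; subst; try lra; lia.
Qed.

(** The reindexing behind associativity of the Cauchy product. *)
Lemma lsum_triangle (F : nat -> nat -> R) n :
  lsum (fun i => lsum (fun j => F j (i - j)%nat) (seq 0 (S i))) (seq 0 n)
  = lsum (fun j => lsum (F j) (seq 0 (n - j))) (seq 0 n).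
Proof.
  induction n as [|n IH]; [reflexivity|].
  rewrite lsum_seq_S, IH, (lsum_seq_S (fun j => lsum (F j) _) 0 n), Nat.add_0_l.
  cbv beta. replace (S n - n)%nat with 1%nat by lia.
  rewrite (lsum_seq_S (fun j => F j (n - j)%nat) 0 n), Nat.add_0_l.
  rewrite Nat.sub_diag, <- Rplus_assoc, <- lsum_plus. f_equal; [|simpl; lra].
  apply lsum_ext. intros j Hj. apply in_seq in Hj.
  replace (S n - j)%nat with (S (n - j)) by lia.
  rewrite lsum_seq_S. reflexivity.
Qed.

Lemma geom_sum_le q n : 0 <= q < 1 -> lsum (pow q) (seq 0 n) <= / (1 - q).
Proof.
  intros Hq.
  assert (E : lsum (pow q) (seq 0 n) * (1 - q) = 1 - q ^ n).
  { induction n as [|n IH]; [simpl; lra|].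
    rewrite lsum_seq_S, Rmult_plus_distr_r, IH. simpl. lra. }
  apply Rmult_le_reg_r with (1 - q); [lra|].
  rewrite E, Rinv_l by lra. assert (0 <= q ^ n) by (apply pow_le; lra). lra.
Qed.

(** * Formal power series *)

Definition series := nat -> R.

Definition s0 : series := fun _ => 0.
Definition s1 : series := fun n => match n with O => 1 | _ => 0 end.
Definition sadd (f g : series) : series := fun n => f n + g n.
Definition sopp (f : series) : series := fun n => - f n.
Definition ssub (f g : series) : series := sadd f (sopp g).
Definition smul (f g : series) : series :=
  fun n => lsum (fun i => f i * g (n - i)%nat) (seq 0 (S n)).

Declare Scope series_scope.
Delimit Scope series_scope with S.
Bind Scope series_scope with series.
Notation "f + g" := (sadd f g) : series_scope.
Notation "f * g" := (smul f g) : series_scope.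
Notation "f - g" := (ssub f g) : series_scope.
Notation "- f" := (sopp f) : series_scope.
Notation "0" := s0 : series_scope.
Notation "1" := s1 : series_scope.

Lemma smul_comm f g : (f * g = g * f)%S.
Proof.
  extensionality n. unfold smul. rewrite lsum_seq_rev.
  apply lsum_ext. intros i Hi. apply in_seq in Hi.
  replace (n - (n - i))%nat with i by lia. ring.
Qed.

Lemma smul_assoc f g h : (f * (g * h) = (f * g) * h)%S.
Proof.
  extensionality n. unfold smul at 1 3.
  transitivity (lsum (fun j => lsum (fun k => f j * g k * h (n - j - k)%nat)
                                    (seq 0 (S n - j))) (seq 0 (S n))).
  - apply lsum_ext. intros j Hj. apply in_seq in Hj.
    unfold smul. rewrite <- lsum_scal. replace (S (n - j)) with (S n - j)%nat by lia.
    apply lsum_ext. intros k _. ring.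
  - rewrite <- (lsum_triangle (fun j k => f j * g k * h (n - j - k)%nat)).
    apply lsum_ext. intros i Hi. apply in_seq in Hi.
    unfold smul. rewrite <- lsum_scal_r. apply lsum_ext. intros j Hj. apply in_seq in Hj.
    replace (n - j - (i - j))%nat with (n - i)%nat by lia. ring.
Qed.

Lemma smul_1_l f : (1 * f = f)%S.
Proof.
  extensionality n. unfold smul. rewrite lsum_seq_0, lsum_0.
  - simpl. rewrite Nat.sub_0_r. ring.
  - intros i _. simpl. ring.
Qed.

Lemma smul_add_l f g h : ((f + g) * h = f * h + g * h)%S.
Proof.
  extensionality n. unfold smul, sadd. rewrite <- lsum_plus.
  apply lsum_ext. intros i _. ring.
Qed.

Lemma series_ring_theory : ring_theory s0 s1 sadd smul ssub sopp eq.
Proof.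
  constructor.
  - intros f. extensionality n. unfold sadd, s0. ring.
  - intros f g. extensionality n. unfold sadd. ring.
  - intros f g h. extensionality n. unfold sadd. ring.
  - apply smul_1_l.
  - apply smul_comm.
  - apply smul_assoc.
  - apply smul_add_l.
  - reflexivity.
  - intros f. extensionality n. unfold sadd, sopp, s0. ring.
Qed.

Add Ring series_ring : series_ring_theory.

Fixpoint spow (f : series) (k : nat) : series :=
  match k with O => s1 | S k' => smul f (spow f k') end.
Notation "f ^ k" := (spow f k) : series_scope.

Lemma spow_add f a b : (f ^ (a + b) = f ^ a * f ^ b)%S.
Proof. induction a as [|a IH]; simpl; [|rewrite IH]; ring. Qed.

(** * Representatives of the isomorphism classes *)

Lemma tree_nested_ind (P : tree -> Prop) :
  (forall cs, (forall c, In c cs -> P c) -> P (Node cs)) -> forall t, P t.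
Proof.
  intros H. fix IH 1. intros [cs]. apply H.
  induction cs as [|c cs IHcs]; [intros _ []|intros d [<-|Hd]].
  - apply IH.
  - apply IHcs. assumption.
Qed.

Lemma tsize_Node cs : tsize (Node cs) = S (list_sum (map tsize cs)).
Proof. simpl. f_equal. induction cs as [|c cs IH]; simpl; [|rewrite IH]; reflexivity. Qed.

Lemma level_Node_S cs k :
  level (Node cs) (S k) = list_sum (map (fun c => level c k) cs).
Proof. simpl. induction cs as [|c cs IH]; simpl; [|rewrite IH]; reflexivity. Qed.

Lemma level_0 t : level t 0 = 1%nat.
Proof. destruct t. reflexivity. Qed.

Lemma tsize_pos t : (1 <= tsize t)%nat.
Proof. destruct t. rewrite tsize_Node. lia. Qed.

Lemma iso_inv cs ds :
  iso (Node cs) (Node ds) -> exists ds', Forall2 iso cs ds' /\ Permutation ds' ds.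
Proof. intros H. inversion H; subst. eauto. Qed.

Lemma Forall2_flip_impl {A B} (P : A -> B -> Prop) (Q : B -> A -> Prop) l l' :
  (forall x y, In x l -> P x y -> Q y x) -> Forall2 P l l' -> Forall2 Q l' l.
Proof.
  intros H F. induction F as [|x y l l' Hxy F IH]; constructor; auto with datatypes.
Qed.

(** The constructor of [iso] matches first and permutes afterwards; [Permutation_Forall2] moves the
    permutation across the matching to restore this order. *)
Lemma iso_sym t u : iso t u -> iso u t.
Proof.
  revert u. induction t as [cs IH] using tree_nested_ind. intros [ds] H.
  apply iso_inv in H. destruct H as (ds' & F & P).
  assert (F' : Forall2 iso ds' cs) by (eapply Forall2_flip_impl; [|exact F]; auto).
  destruct (Permutation_Forall2 P F') as (cs' & Pc & Fc).
  apply iso_Node with cs'; [assumption|]. symmetry. assumption.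
Qed.

Lemma Forall2_trans_impl {A} (P : A -> A -> Prop) l l' l'' :
  (forall x y z, In x l -> P x y -> P y z -> P x z) ->
  Forall2 P l l' -> Forall2 P l' l'' -> Forall2 P l l''.
Proof.
  intros H F. revert l''. induction F as [|x y l l' Hxy F IH]; intros l'' F'.
  - inversion F'. constructor.
  - inversion F'; subst. constructor; [eauto with datatypes|].
    apply IH; [|assumption]. intros; eapply H; eauto with datatypes.
Qed.

Lemma iso_trans t u v : iso t u -> iso u v -> iso t v.
Proof.
  revert u v. induction t as [cs IH] using tree_nested_ind. intros [ds] [es] H H'.
  apply iso_inv in H. destruct H as (ds' & F & P).
  apply iso_inv in H'. destruct H' as (es' & F' & P').
  symmetry in P. destruct (Permutation_Forall2 P F') as (es'' & Pe & Fe).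
  apply iso_Node with es''.
  - eapply Forall2_trans_impl; eauto.
  - transitivity es'; [symmetry|]; assumption.
Qed.

Lemma list_sum_perm l l' : Permutation l l' -> list_sum l = list_sum l'.
Proof. induction 1; simpl; lia. Qed.

Lemma list_sum_map_Forall2 {A} (f : A -> nat) (P : A -> A -> Prop) l l' :
  (forall x y, In x l -> P x y -> f x = f y) -> Forall2 P l l' ->
  list_sum (map f l) = list_sum (map f l').
Proof.
  intros H F. induction F as [|x y l l' Hxy F IH]; [reflexivity|].
  simpl. rewrite (H x y), IH; auto with datatypes.
Qed.

Lemma iso_tsize t u : iso t u -> tsize t = tsize u.
Proof.
  revert u. induction t as [cs IH] using tree_nested_ind. intros [ds] H.
  apply iso_inv in H. destruct H as (ds' & F & P).
  rewrite !tsize_Node. f_equal.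
  rewrite <- (list_sum_perm _ _ (Permutation_map tsize P)).
  eapply list_sum_map_Forall2; eauto.
Qed.

Lemma iso_level t u k : iso t u -> level t k = level u k.
Proof.
  revert u k. induction t as [cs IH] using tree_nested_ind. intros [ds] [|k] H.
  - reflexivity.
  - apply iso_inv in H. destruct H as (ds' & F & P). rewrite !level_Node_S.
    rewrite <- (list_sum_perm _ _ (Permutation_map (fun c => level c k) P)).
    eapply list_sum_map_Forall2; [|exact F]. auto.
Qed.

(* Multisets of total size [m] over the list [l], each listed once, as lists
   sorted by position in [l]; [f] bounds the multiplicity of [t]. *)
Fixpoint ms (l : list tree) : nat -> list (list tree) :=
  match l with
  | [] => fun m => match m with O => [[]] | S _ => [] end
  | t :: l' => fun m =>
      (fix go f m := ms l' m ++
         match f with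
         | O => []
         | S f' => if (tsize t <=? m)%nat then map (cons t) (go f' (m - tsize t)%nat) else []
         end) m m
  end.

(** The recursion of [ms] freed from its fuel: each copy of [t] uses up at least one unit of size,
    so fuel [m] is never exhausted early. *)
Lemma ms_cons t l m :
  ms (t :: l) m = ms l m ++
    (if (tsize t <=? m)%nat then map (cons t) (ms (t :: l) (m - tsize t)) else []).
Proof.
  set (go := fix go f m := ms l m ++
         match f with
         | O => []
         | S f' => if (tsize t <=? m)%nat then map (cons t) (go f' (m - tsize t)%nat) else []
         end).
  assert (E : forall f m, (m <= f)%nat -> go f m = go m m).
  { pose proof (tsize_pos t) as Hp.
    intros f. induction f as [f IH] using lt_wf_ind. intros k Hk.
    destruct f as [|f]; [replace k with 0%nat by lia; reflexivity|].
    destruct k as [|k]; cbn [go].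
    - destruct (Nat.leb_spec (tsize t) 0); [lia|reflexivity].
    - destruct (Nat.leb_spec (tsize t) (S k)); [|reflexivity].
      rewrite (IH f), (IH k) by lia. reflexivity. }
  change (ms (t :: l)) with (fun m => go m m). cbv beta.
  pose proof (tsize_pos t) as Hp.
  destruct m as [|m]; cbn [go].
  - destruct (Nat.leb_spec (tsize t) 0); [lia|reflexivity].
  - destruct (Nat.leb_spec (tsize t) (S m)); [|reflexivity].
    rewrite (E m) by lia. reflexivity.
Qed.

Lemma ms_spec l m M :
  In M (ms l m) -> incl M l /\ list_sum (map tsize M) = m.
Proof.
  revert m M. induction l as [|t l IHl].
  - intros [|m] M []; [subst; split; [apply incl_refl|reflexivity]|contradiction].
  - intros m. induction m as [m IHm] using lt_wf_ind. intros M H.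
    rewrite ms_cons in H. apply in_app_or in H. destruct H as [H|H].
    + apply IHl in H. destruct H as [H ?]. split; [apply incl_tl|]; assumption.
    + destruct (Nat.leb_spec (tsize t) m); [|contradiction].
      apply in_map_iff in H. destruct H as (N & <- & H).
      pose proof (tsize_pos t). apply IHm in H; [|lia]. destruct H as [H E].
      split; [apply incl_cons; [left; reflexivity|assumption]|].
      simpl. rewrite E. lia.
Qed.

Lemma ms_complete l m N :
  incl N l -> list_sum (map tsize N) = m -> exists M, In M (ms l m) /\ Permutation N M.
Proof.
  revert m N. induction l as [|t l IHl].
  - intros m N H E. apply incl_l_nil in H. subst. exists []. split; [left|]; reflexivity.
  - intros m. induction m as [m IHm] using lt_wf_ind. intros N H E.
    destruct (classic (In t N)) as [HN|HN].
    + apply in_split in HN. destruct HN as (N1 & N2 & ->).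
      assert (P : Permutation (N1 ++ t :: N2) (t :: N1 ++ N2))
        by (symmetry; apply Permutation_middle).
      rewrite (list_sum_perm _ _ (Permutation_map tsize P)) in E. simpl in E.
      pose proof (tsize_pos t).
      destruct (IHm (m - tsize t)%nat) with (N := N1 ++ N2) as (M & HM & PM); [lia| |lia|].
      * intros x Hx. apply H. rewrite in_app_iff in *. simpl. tauto.
      * exists (t :: M). split.
        -- rewrite ms_cons. apply in_or_app. right.
           destruct (Nat.leb_spec (tsize t) m); [|lia]. apply in_map. assumption.
        -- rewrite P. constructor. assumption.
    + destruct (IHl m N) as (M & HM & PM); [|assumption|].
      * intros x Hx. destruct (H x Hx); [subst; contradiction|assumption].
      * exists M. split; [|assumption]. rewrite ms_cons. apply in_or_app. left. assumption.
Qed.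

Lemma ms_NoDup l m : NoDup l -> NoDup (ms l m).
Proof.
  intros Hl. revert m. induction Hl as [|t l Ht Hl IHl].
  - intros [|m]; repeat constructor; auto.
  - intros m. induction m as [m IHm] using lt_wf_ind. rewrite ms_cons.
    pose proof (tsize_pos t).
    destruct (Nat.leb_spec (tsize t) m); [|rewrite app_nil_r; apply IHl].
    apply NoDup_app.
    + apply IHl.
    + apply FinFun.Injective_map_NoDup; [|apply IHm; lia].
      intros x y E. injection E. auto.
    + intros M H1 H2. apply ms_spec in H1. apply in_map_iff in H2.
      destruct H2 as (N & <- & _). apply Ht, H1. left. reflexivity.
Qed.

(** Members of [ms] are sorted by position in [l]: two permuted ones either both start with the head
    of [l] or both avoid it. *)
Lemma ms_perm_eq l m M N :
  NoDup l -> In M (ms l m) -> In N (ms l m) -> Permutation M N -> M = N.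
Proof.
  intros Hl. revert m M N. induction Hl as [|t l Ht Hl IHl].
  - intros [|m] M N [] []; subst; auto; contradiction.
  - intros m. induction m as [m IHm] using lt_wf_ind. intros M N HM HN P.
    rewrite ms_cons in HM, HN. pose proof (tsize_pos t).
    apply in_app_or in HM. apply in_app_or in HN.
    assert (Hmix : forall M N, In M (ms l m) ->
      In N (if (tsize t <=? m)%nat then map (cons t) (ms (t :: l) (m - tsize t)) else []) ->
      Permutation M N -> False).
    { intros A B HA HB PAB. destruct (Nat.leb_spec (tsize t) m); [|contradiction].
      apply in_map_iff in HB. destruct HB as (B' & <- & _).
      apply Ht. apply ms_spec in HA. apply HA.
      apply (Permutation_in t (Permutation_sym PAB)). left. reflexivity. }
    destruct HM as [HM|HM], HN as [HN|HN].
    + eapply IHl; eauto.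
    + exfalso. eapply Hmix; eauto.
    + exfalso. eapply Hmix; eauto using Permutation_sym.
    + destruct (Nat.leb_spec (tsize t) m); [|contradiction].
      apply in_map_iff in HM. destruct HM as (M' & <- & HM).
      apply in_map_iff in HN. destruct HN as (N' & <- & HN).
      f_equal. eapply IHm; eauto; [lia|]. eapply Permutation_cons_inv. eassumption.
Qed.

(** One representative for each class of size at most [k]: a tree of size [k + 1] is a root over a
    multiset of total size [k] of smaller trees. *)
Fixpoint pool (k : nat) : list tree :=
  match k with
  | O => []
  | S k' => pool k' ++ map Node (ms (pool k') k')
  end.

Definition U (n : nat) : list tree :=
  match n with O => [] | S k => map Node (ms (pool k) k) end.

Lemma pool_S k : pool (S k) = pool k ++ U (S k).
Proof. reflexivity. Qed.

Lemma U_tsize n t : In t (U n) -> tsize t = n.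
Proof.
  destruct n as [|n]; [contradiction|]. intros H. apply in_map_iff in H.
  destruct H as (M & <- & H). apply ms_spec in H. rewrite tsize_Node. lia.
Qed.

Lemma pool_tsize k t : In t (pool k) -> (1 <= tsize t <= k)%nat.
Proof.
  induction k as [|k IH]; [contradiction|]. rewrite pool_S, in_app_iff.
  intros [H|H]; [apply IH in H; lia|]. apply U_tsize in H. lia.
Qed.

Lemma Forall2_iso_eq l M N :
  (forall t u, In t l -> In u l -> iso t u -> t = u) -> incl M l -> incl N l ->
  Forall2 iso M N -> M = N.
Proof.
  intros H HM HN F. induction F as [|x y M N Hxy F IH]; [reflexivity|].
  apply incl_cons_inv in HM. apply incl_cons_inv in HN. f_equal.
  - apply H; tauto.
  - apply IH; tauto.
Qed.

Lemma ms_iso_eq l m M N :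
  NoDup l -> (forall t u, In t l -> In u l -> iso t u -> t = u) ->
  In M (ms l m) -> In N (ms l m) -> iso (Node M) (Node N) -> M = N.
Proof.
  intros Hl H HM HN E. apply iso_inv in E. destruct E as (N' & F & P).
  assert (M = N'); [|subst; eapply ms_perm_eq; eauto].
  apply ms_spec in HM. apply ms_spec in HN.
  eapply Forall2_iso_eq; [exact H|tauto| |assumption].
  intros x Hx. apply HN. eapply Permutation_in; eauto.
Qed.

Lemma pool_distinct k :
  NoDup (pool k) /\ (forall t u, In t (pool k) -> In u (pool k) -> iso t u -> t = u).
Proof.
  induction k as [|k [IH1 IH2]]; [split; [constructor|contradiction]|].
  rewrite pool_S. split.
  - apply NoDup_app; [assumption| |].
    + apply FinFun.Injective_map_NoDup; [intros x y E; injection E; auto|].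
      apply ms_NoDup. assumption.
    + intros t H1 H2. apply pool_tsize in H1. apply U_tsize in H2. lia.
  - intros t u Ht Hu E. pose proof (iso_tsize _ _ E) as Es.
    rewrite in_app_iff in Ht, Hu. destruct Ht as [Ht|Ht], Hu as [Hu|Hu].
    + auto.
    + apply pool_tsize in Ht. apply U_tsize in Hu. lia.
    + apply pool_tsize in Hu. apply U_tsize in Ht. lia.
    + simpl in Ht, Hu. apply in_map_iff in Ht. destruct Ht as (M & <- & HM).
      apply in_map_iff in Hu. destruct Hu as (N & <- & HN).
      f_equal. eapply ms_iso_eq; eauto.
Qed.

Lemma list_sum_In_le (f : tree -> nat) l t :
  In t l -> (f t <= list_sum (map f l))%nat.
Proof. induction l as [|x l IH]; intros []; simpl; [subst|apply IH in H]; lia. Qed.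

Lemma pool_complete k t : (tsize t <= k)%nat -> exists u, In u (pool k) /\ iso t u.
Proof.
  revert t. induction k as [|k IH]; intros t Ht; [pose proof (tsize_pos t); lia|].
  destruct (Nat.eq_dec (tsize t) (S k)) as [E|E].
  - destruct t as [cs]. rewrite tsize_Node in E. injection E as E.
    assert (Hc : forall c, In c cs -> exists u, In u (pool k) /\ iso c u).
    { intros c Hc. apply IH. apply (list_sum_In_le tsize) in Hc. lia. }
    assert (Hds : exists ds, incl ds (pool k) /\ Forall2 iso cs ds).
    { clear E Ht. induction cs as [|c cs IHcs].
      - exists []. split; [apply incl_nil_l|constructor].
      - destruct (Hc c) as (u & Hu & Eu); [left; reflexivity|].
        destruct IHcs as (ds & Hd & Fd); [auto with datatypes|].
        exists (u :: ds). split; [apply incl_cons|constructor]; assumption. }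
    destruct Hds as (ds & Hd & Fd).
    destruct (ms_complete (pool k) k ds) as (M & HM & PM); [assumption| |].
    + rewrite <- E. symmetry. eapply list_sum_map_Forall2; [|exact Fd].
      intros. apply iso_tsize. assumption.
    + exists (Node M). split; [|apply iso_Node with ds; assumption].
      rewrite pool_S, in_app_iff. right. simpl. apply in_map. assumption.
  - destruct (IH t) as (u & Hu & Eu); [lia|]. exists u. split; [|assumption].
    rewrite pool_S, in_app_iff. left. assumption.
Qed.

Lemma U_rep_system n : rep_system n (U n).
Proof.
  split; [apply U_tsize|]. destruct n as [|k].
  { split; [intros t E; pose proof (tsize_pos t); lia|intros [|i] j t u H; discriminate]. }
  split.
  - intros t E. destruct (pool_complete (S k) t) as (u & Hu & Eu); [lia|].
    exists u. split; [|assumption]. rewrite pool_S, in_app_iff in Hu.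
    destruct Hu as [Hu|Hu]; [|assumption].
    apply pool_tsize in Hu. apply iso_tsize in Eu. lia.
  - intros i j t u Hi Hj E.
    destruct (pool_distinct (S k)) as [HN HE].
    assert (In t (pool (S k))).
    { rewrite pool_S, in_app_iff. right. eapply nth_error_In; eauto. }
    assert (In u (pool (S k))).
    { rewrite pool_S, in_app_iff. right. eapply nth_error_In; eauto. }
    apply HE in E; [|assumption|assumption]. subst u.
    rewrite pool_S in HN. apply NoDup_app_remove_l in HN.
    rewrite NoDup_nth_error in HN. apply HN; [|congruence].
    apply nth_error_Some. congruence.
Qed.

(** Two systems of representatives differ only by isomorphisms and order, so averages of invariant
    functions may be computed on [U n]. The induction deletes the partner of the head of [s] from
    [s']. *)
Lemma rep_systems_matched s s' :
  (forall t, In t s -> exists u, In u s' /\ iso t u) ->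
  (forall u, In u s' -> exists t, In t s /\ iso u t) ->
  (forall i j t u, nth_error s i = Some t -> nth_error s j = Some u -> iso t u -> i = j) ->
  (forall i j t u, nth_error s' i = Some t -> nth_error s' j = Some u -> iso t u -> i = j) ->
  exists s'', Forall2 iso s s'' /\ Permutation s'' s'.
Proof.
  revert s'. induction s as [|t s IH]; intros s' H1 H2 D1 D2.
  - exists []. split; [constructor|]. destruct s' as [|u s']; [constructor|].
    destruct (H2 u) as (t & [] & _). left. reflexivity.
  - destruct (H1 t) as (u & Hu & Eu); [left; reflexivity|].
    apply in_split in Hu. destruct Hu as (l1 & l2 & ->).
    assert (Hlen : nth_error (l1 ++ u :: l2) (length l1) = Some u).
    { rewrite nth_error_app2, Nat.sub_diag by lia. reflexivity. }
    (* Distinctness is stated through positions, so deleting [u] requires tracking how positions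
       shift. *)
    assert (Hsub : forall i v, nth_error (l1 ++ l2) i = Some v ->
              exists j, nth_error (l1 ++ u :: l2) j = Some v /\
                        j = (if (i <? length l1)%nat then i else S i)).
    { intros i v Hv. eexists. split; [|reflexivity].
      destruct (Nat.ltb_spec i (length l1)).
      - rewrite nth_error_app1 in * by lia. assumption.
      - rewrite nth_error_app2 in Hv by lia. rewrite nth_error_app2 by lia.
        replace (S i - length l1)%nat with (S (i - length l1)) by lia. assumption. }
    destruct (IH (l1 ++ l2)) as (s'' & F & P).
    + intros v Hv. destruct (H1 v) as (x & Hx & Ex); [right; assumption|].
      exists x. split; [|assumption]. rewrite in_app_iff in *. simpl in Hx.
      destruct Hx as [|[Hx|]]; auto. subst x. exfalso.
      apply In_nth_error in Hv. destruct Hv as (i & Hi).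
      specialize (D1 0%nat (S i) t v eq_refl Hi).
      assert (0%nat = S i); [|lia]. apply D1.
      eapply iso_trans; [exact Eu|]. apply iso_sym. assumption.
    + intros v Hv. destruct (H2 v) as (x & Hx & Ex).
      { rewrite in_app_iff in *. simpl. tauto. }
      exists x. split; [|assumption]. destruct Hx as [Hx|]; [|assumption].
      subst x. exfalso. apply In_nth_error in Hv. destruct Hv as (i & Hi).
      destruct (Hsub _ _ Hi) as (j & Hj & Ej).
      assert (j = length l1).
      { eapply D2; [exact Hj|exact Hlen|]. eapply iso_trans; eassumption. }
      destruct (Nat.ltb_spec i (length l1)); lia.
    + intros i j v x Hv Hx E. specialize (D1 (S i) (S j) v x Hv Hx E). lia.
    + intros i j v x Hv Hx E.
      destruct (Hsub _ _ Hv) as (i' & Hi & Ei). destruct (Hsub _ _ Hx) as (j' & Hj & Ej).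
      assert (i' = j') by (eapply D2; eauto).
      destruct (Nat.ltb_spec i (length l1)), (Nat.ltb_spec j (length l1)); lia.
    + exists (u :: s''). split; [constructor; assumption|].
      rewrite <- Permutation_middle. constructor. assumption.
Qed.

Lemma rep_system_matches_U n s :
  rep_system n s -> exists s', Forall2 iso s s' /\ Permutation s' (U n).
Proof.
  intros (S1 & S2 & S3). destruct (U_rep_system n) as (U1 & U2 & U3).
  apply rep_systems_matched; auto.
Qed.

Lemma rep_system_length n s : rep_system n s -> length s = length (U n).
Proof.
  intros H. apply rep_system_matches_U in H. destruct H as (s' & F & P).
  rewrite <- (Permutation_length P). eapply Forall2_length. exact F.
Qed.

Lemma rep_system_lsum n s (F : tree -> R) :
  (forall t u, iso t u -> F t = F u) -> rep_system n s -> lsum F s = lsum F (U n).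
Proof.
  intros HF H. apply rep_system_matches_U in H. destruct H as (s' & E & P).
  rewrite <- (lsum_perm F _ _ P). clear P.
  induction E as [|x y l l' Hxy E IH]; [reflexivity|].
  rewrite !lsum_cons, IH. f_equal. auto.
Qed.

(** * Moments of additive functionals of multisets *)

(** An arbitrary [G] instead of a power, because removing copies of [t] replaces [G] by a translate
    of itself. *)
Definition Sg (X : tree -> R) (l : list tree) (m : nat) (G : R -> R) : R :=
  lsum (fun M => G (lsum X M)) (ms l m).

Lemma Sg_cons X t l m G :
  Sg X (t :: l) m G = Sg X l m G +
    (if (tsize t <=? m)%nat then Sg X (t :: l) (m - tsize t) (fun y => G (X t + y)) else 0).
Proof.
  unfold Sg. rewrite ms_cons, lsum_app.
  destruct (tsize t <=? m)%nat; [rewrite lsum_map|]; reflexivity.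
Qed.

Lemma Sg_ext X l m G H : (forall y, G y = H y) -> Sg X l m G = Sg X l m H.
Proof. intros E. apply lsum_ext. auto. Qed.

Lemma Sg_plus X l m G H : Sg X l m (fun y => G y + H y) = Sg X l m G + Sg X l m H.
Proof. apply lsum_plus. Qed.

Lemma Sg_scal X l m c G : Sg X l m (fun y => c * G y) = c * Sg X l m G.
Proof. unfold Sg. rewrite <- lsum_scal. reflexivity. Qed.

(* A multiset with multiplicities [c_t] contributes [X(M) = sum_t c_t X(t)]; writing
   [c_t] as the number of [i >= 1] with [i <= c_t] and removing [i] copies of [t]
   from [M] gives the right-hand side. *)
Lemma Sg_mark X l m N G : (m <= N)%nat ->
  Sg X l m (fun y => y * G y) =
  lsum (fun t => lsum (fun i =>
      if (i * tsize t <=? m)%nat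
      then X t * Sg X l (m - i * tsize t) (fun y => G (INR i * X t + y)) else 0)
    (seq 1 N)) l.
Proof.
  revert m G. induction l as [|t l IHl].
  { intros [|m] G _; unfold Sg; simpl; lra. }
  intros m. induction m as [m IHm] using lt_wf_ind. intros G Hm.
  pose proof (tsize_pos t) as Hp.
  rewrite lsum_cons.
  (* The right-hand side with the terms of each [t'] in [l] split by [Sg_cons]: those free of [t]
     reassemble to the value for [l], the others have one copy of [t] taken out. *)
  transitivity (Sg X l m (fun y => y * G y) +
    (lsum (fun i =>
      if (i * tsize t <=? m)%nat
      then X t * Sg X (t :: l) (m - i * tsize t) (fun y => G (INR i * X t + y)) else 0)
     (seq 1 N) +
     lsum (fun t' => lsum (fun i =>
      if (i * tsize t' + tsize t <=? m)%nat
      then X t' * Sg X (t :: l) (m - i * tsize t' - tsize t)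
                     (fun y => G (INR i * X t' + (X t + y))) else 0)
     (seq 1 N)) l)).
  2:{ rewrite (IHl m G Hm).
      match goal with |- ?a + (?b + ?c) = _ => replace (a + (b + c)) with (b + (a + c)) by ring end.
      f_equal. rewrite <- lsum_plus. apply lsum_ext. intros t' _.
      rewrite <- lsum_plus. apply lsum_ext. intros i _.
      rewrite (Sg_cons X t l (m - i * tsize t')).
      destruct (Nat.leb_spec (i * tsize t') m), (Nat.leb_spec (i * tsize t' + tsize t) m),
        (Nat.leb_spec (tsize t) (m - i * tsize t')); try lia; ring. }
  rewrite Sg_cons. f_equal.
  destruct (Nat.leb_spec (tsize t) m) as [Ht|Ht].
  2:{ rewrite lsum_0, lsum_0; [ring| |].
      - intros t' _. apply lsum_0. intros i _.
        destruct (Nat.leb_spec (i * tsize t' + tsize t) m); [lia|reflexivity].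
      - intros i Hi. apply in_seq in Hi.
        destruct (Nat.leb_spec (i * tsize t) m); [nia|reflexivity]. }
  rewrite (Sg_ext _ _ _ _ (fun y => X t * G (X t + y) + y * G (X t + y))) by (intros; ring).
  rewrite Sg_plus, Sg_scal.
  rewrite (IHm (m - tsize t)%nat ltac:(lia) (fun y => G (X t + y)) ltac:(lia)).
  rewrite lsum_cons, <- Rplus_assoc. f_equal.
  (* Taking out the first copy of [t] gives the term [i = 1]; the marks in what remains give the
     terms [i + 1]. *)
  - set (f := fun i => if (i * tsize t <=? m)%nat
      then X t * Sg X (t :: l) (m - i * tsize t) (fun y => G (INR i * X t + y)) else 0).
    transitivity (f 1%nat + lsum (fun i => f (S i)) (seq 1 N)).
    + f_equal.
      * unfold f. rewrite Nat.mul_1_l. destruct (Nat.leb_spec (tsize t) m); [|lia].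
        f_equal. apply Sg_ext. intros y. f_equal. simpl. ring.
      * apply lsum_ext. intros i _. unfold f.
        destruct (Nat.leb_spec (i * tsize t) (m - tsize t)),
          (Nat.leb_spec (S i * tsize t) m); try (simpl in *; lia); [|reflexivity].
        replace (m - S i * tsize t)%nat with (m - tsize t - i * tsize t)%nat by (simpl; lia).
        f_equal. apply Sg_ext. intros y. f_equal. rewrite S_INR. ring.
    + rewrite <- lsum_seq_shift.
      change (f 1%nat + lsum f (seq 2 N)) with (lsum f (seq 1 (S N))).
      apply lsum_seq_extend; [lia|]. intros i Hi. unfold f.
      destruct (Nat.leb_spec (i * tsize t) m); [nia|reflexivity].
  - apply lsum_ext. intros t' _. apply lsum_ext. intros i _.
    destruct (Nat.leb_spec (i * tsize t') (m - tsize t)),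
      (Nat.leb_spec (i * tsize t' + tsize t) m); try lia; [|reflexivity].
    replace (m - i * tsize t' - tsize t)%nat with (m - tsize t - i * tsize t')%nat by lia.
    f_equal. apply Sg_ext. intros y. f_equal. ring.
Qed.

Lemma ms_large l m : (forall t, In t l -> (m < tsize t)%nat) -> ms l m = ms [] m.
Proof.
  induction l as [|t l IH]; intros H; [reflexivity|].
  rewrite ms_cons, IH by auto with datatypes.
  destruct (Nat.leb_spec (tsize t) m) as [Ht|]; [|apply app_nil_r].
  specialize (H t (or_introl eq_refl)). lia.
Qed.

Lemma ms_app_large l l' m :
  (forall t, In t l' -> (m < tsize t)%nat) -> ms (l ++ l') m = ms l m.
Proof.
  revert m. induction l as [|t l IHl]; intros m; [apply ms_large|].
  induction m as [m IHm] using lt_wf_ind. intros H. pose proof (tsize_pos t).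
  simpl app. rewrite (ms_cons t (l ++ l') m), (ms_cons t l m), IHl by assumption. f_equal.
  destruct (Nat.leb_spec (tsize t) m); [|reflexivity]. f_equal.
  apply (IHm (m - tsize t)%nat); [lia|]. intros u Hu. apply H in Hu. lia.
Qed.

Lemma ms_pool k m : (m <= k)%nat -> ms (pool k) m = ms (pool m) m.
Proof.
  induction k as [|k IH]; intros H; [replace m with 0%nat by lia; reflexivity|].
  destruct (Nat.eq_dec m (S k)) as [->|]; [reflexivity|].
  rewrite pool_S, ms_app_large; [apply IH; lia|].
  intros t Ht. apply U_tsize in Ht. lia.
Qed.

Definition Tmom (X : tree -> R) (j : nat) : series := fun n => lsum (fun t => X t ^ j) (U n).

(** The counterpart of [Tmom] for forests; restricting to [pool n] loses nothing, since no larger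
    tree fits into total size [n]. *)
Definition Fmom (X : tree -> R) (j : nat) : series :=
  fun n => Sg X (pool n) n (fun y => y ^ j).

(* The coefficients of [sum_{k >= 1} k^a Tmom_(a+1)(z^k)]. *)
Definition Cmom (X : tree -> R) (a : nat) : series := fun m =>
  lsum (fun k => lsum (fun d =>
    if (k * d =? m)%nat then INR k ^ a * Tmom X (S a) d else 0) (seq 1 m)) (seq 1 m).

Lemma Sg_pool X n m j :
  (m <= n)%nat -> Sg X (pool n) m (fun y => y ^ j) = Fmom X j m.
Proof. intros H. unfold Fmom, Sg. rewrite (ms_pool n m H). reflexivity. Qed.

Lemma lsum_pool (f : tree -> R) n :
  lsum f (pool n) = lsum (fun d => lsum f (U d)) (seq 1 n).
Proof.
  induction n as [|n IH]; [reflexivity|].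
  rewrite pool_S, lsum_app, lsum_seq_S, IH. reflexivity.
Qed.

(** Grouping the trees by size [d] and then the pairs [(i, d)] by the product [i * d] turns the sum
    over marked copies into a Cauchy product. *)
Lemma pool_conv X a (p : series) n :
  lsum (fun t => lsum (fun i =>
      if (i * tsize t <=? n)%nat
      then INR i ^ a * X t ^ S a * p (n - i * tsize t)%nat else 0) (seq 1 n)) (pool n)
  = (Cmom X a * p)%S n.
Proof.
  transitivity (lsum (fun i => lsum (fun d =>
    if (i * d <=? n)%nat then INR i ^ a * Tmom X (S a) d * p (n - i * d)%nat else 0)
    (seq 1 n)) (seq 1 n)).
  - rewrite lsum_exch. apply lsum_ext. intros i _. rewrite lsum_pool.
    apply lsum_ext. intros d _. unfold Tmom.
    destruct (Nat.leb_spec (i * d) n) as [H|H].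
    + rewrite <- lsum_scal, <- lsum_scal_r. apply lsum_ext. intros t Ht.
      apply U_tsize in Ht. rewrite Ht. destruct (Nat.leb_spec (i * d) n); [reflexivity|lia].
    + apply lsum_0. intros t Ht. apply U_tsize in Ht. rewrite Ht.
      destruct (Nat.leb_spec (i * d) n); [lia|reflexivity].
  - symmetry. unfold smul.
    transitivity (lsum (fun m => lsum (fun k => lsum (fun d =>
      if (k * d =? m)%nat then INR k ^ a * Tmom X (S a) d * p (n - m)%nat else 0)
      (seq 1 n)) (seq 1 n)) (seq 0 (S n))).
    + apply lsum_ext. intros m Hm. apply in_seq in Hm. unfold Cmom.
      rewrite <- lsum_scal_r.
      rewrite (lsum_seq_extend _ 1 m n); [|lia|].
      2:{ intros k Hk. apply lsum_0. intros d Hd. apply in_seq in Hd.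
          destruct (Nat.eqb_spec (k * d) m); [nia|reflexivity]. }
      apply lsum_ext. intros k Hk. apply in_seq in Hk. rewrite <- lsum_scal_r.
      symmetry. rewrite (lsum_seq_extend _ 1 m n); [|lia|].
      2:{ intros d Hd. destruct (Nat.eqb_spec (k * d) m); [nia|reflexivity]. }
      apply lsum_ext. intros d _. destruct (k * d =? m)%nat; ring.
    + rewrite lsum_exch. apply lsum_ext. intros k _.
      rewrite lsum_exch. apply lsum_ext. intros d _.
      rewrite (lsum_indicator (fun m => INR k ^ a * Tmom X (S a) d * p (n - m)%nat)).
      destruct (Nat.leb_spec 0 (k * d)), (Nat.ltb_spec (k * d) (0 + S n)),
        (Nat.leb_spec (k * d) n); try lia; reflexivity.
Qed.

(** Writes [y^(j+1) = y * y^j], marks a copy with [Sg_mark] and reduces the identity to one pair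
    [(t, i)]. What is left is the binomial expansion of [(i X(t) + y)^j], where
    [X(t) (i X(t))^a = i^a X(t)^(a+1)] is the weight of [Cmom X a]. *)
Ltac expand_mark X n :=
  extensionality n; unfold Fmom at 1;
  match goal with |- Sg _ _ _ (fun y => y ^ S ?j) = _ =>
    rewrite (Sg_ext _ _ _ _ (fun y => y * y ^ j)) by (intros; simpl; ring) end;
  rewrite (Sg_mark X (pool n) n n _ (Nat.le_refl n));
  unfold sadd; rewrite <- !pool_conv, <- ?lsum_plus;
  apply lsum_ext; intros t _; rewrite <- ?lsum_plus; apply lsum_ext; intros i _;
  destruct (Nat.leb_spec (i * tsize t) n); [|ring];
  rewrite <- !(Sg_pool X n) by lia.

Lemma Fmom1_rec X : Fmom X 1 = (Cmom X 0 * Fmom X 0)%S.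
Proof.
  expand_mark X n. simpl. ring.
Qed.

Lemma Fmom2_rec X : Fmom X 2 = (Cmom X 1 * Fmom X 0 + Cmom X 0 * Fmom X 1)%S.
Proof.
  expand_mark X n.
  rewrite (Sg_ext _ _ _ _ (fun y => INR i * X t * y ^ 0 + y ^ 1)) by (intros; simpl; ring).
  rewrite Sg_plus, Sg_scal. ring.
Qed.

Lemma Fmom3_rec X :
  Fmom X 3 = (Cmom X 2 * Fmom X 0 + (Cmom X 1 * Fmom X 1 + Cmom X 1 * Fmom X 1) + Cmom X 0 * Fmom X 2)%S.
Proof.
  expand_mark X n.
  rewrite (Sg_ext _ _ _ _ (fun y => (INR i * X t) ^ 2 * y ^ 0 + (2 * (INR i * X t) * y ^ 1 + y ^ 2)))
    by (intros; simpl; ring).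
  rewrite !Sg_plus, !Sg_scal. ring.
Qed.

Lemma Fmom4_rec X :
  Fmom X 4 = (Cmom X 3 * Fmom X 0 + (Cmom X 2 * Fmom X 1 + Cmom X 2 * Fmom X 1 + Cmom X 2 * Fmom X 1)
           + (Cmom X 1 * Fmom X 2 + Cmom X 1 * Fmom X 2 + Cmom X 1 * Fmom X 2) + Cmom X 0 * Fmom X 3)%S.
Proof.
  expand_mark X n.
  rewrite (Sg_ext _ _ _ _ (fun y => (INR i * X t) ^ 3 * y ^ 0 +
     (3 * (INR i * X t) ^ 2 * y ^ 1 + (3 * (INR i * X t) * y ^ 2 + y ^ 3))))
    by (intros; simpl; ring).
  rewrite !Sg_plus, !Sg_scal. ring.
Qed.

(** Multiplication by [z], which accounts for the root above a forest. *)
Definition zshift (f : series) : series := fun n => match n with O => 0 | S k => f k end.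

Lemma zshift_add f g : zshift (f + g)%S = (zshift f + zshift g)%S.
Proof. extensionality n. unfold sadd, zshift. destruct n; lra. Qed.

Lemma zshift_mul f g : zshift (f * g)%S = (f * zshift g)%S.
Proof.
  extensionality n. destruct n as [|n]; unfold smul.
  - simpl. ring.
  - rewrite (lsum_seq_S _ 0 (S n)), Nat.add_0_l, Nat.sub_diag.
    change (zshift g 0%nat) with 0. rewrite Rmult_0_r, Rplus_0_r. apply lsum_ext. intros i Hi. apply in_seq in Hi.
    replace (S n - i)%nat with (S (n - i)) by lia. reflexivity.
Qed.

(* The generating function [T(z)] of unlabelled rooted trees. *)
Definition w : series := fun n => INR (length (U n)).

Lemma Tmom_0 X : Tmom X 0 = w.
Proof. extensionality n. unfold Tmom, w. simpl. rewrite lsum_const. ring. Qed.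

Definition lifts (X Y : tree -> R) : Prop := forall M, Y (Node M) = lsum X M.

Lemma Tmom_lifts X Y j : lifts X Y -> Tmom Y j = zshift (Fmom X j).
Proof.
  intros H. extensionality n. destruct n as [|n]; [reflexivity|].
  unfold Tmom, Fmom, Sg, U, zshift. rewrite lsum_map. apply lsum_ext.
  intros M _. rewrite H. reflexivity.
Qed.

Lemma w_zshift X Y : lifts X Y -> w = zshift (Fmom X 0).
Proof. intros H. rewrite <- (Tmom_0 Y). apply Tmom_lifts. assumption. Qed.

Lemma Tmom1_lifts X Y : lifts X Y -> Tmom Y 1 = (w * Cmom X 0)%S.
Proof.
  intros H. rewrite (Tmom_lifts X Y 1 H), Fmom1_rec, zshift_mul, <- (w_zshift X Y H). ring.
Qed.

(** In every product the factor [z] is given to the forest moment, which thereby becomes a tree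
    moment of lower order and so a known multiple of [w]. *)
Lemma Tmom2_lifts X Y : lifts X Y -> Tmom Y 2 = (w * (Cmom X 1 + Cmom X 0 * Cmom X 0))%S.
Proof.
  intros H. rewrite (Tmom_lifts X Y 2 H), Fmom2_rec, zshift_add, !zshift_mul,
    <- (w_zshift X Y H), <- (Tmom_lifts X Y 1 H), (Tmom1_lifts X Y H). ring.
Qed.

Lemma Tmom3_lifts X Y : lifts X Y ->
  Tmom Y 3 = (w * (Cmom X 2 + (1 + 1 + 1) * (Cmom X 0 * Cmom X 1) + Cmom X 0 * Cmom X 0 * Cmom X 0))%S.
Proof.
  intros H. rewrite (Tmom_lifts X Y 3 H), Fmom3_rec, !zshift_add, !zshift_mul,
    <- (w_zshift X Y H), <- (Tmom_lifts X Y 1 H), <- (Tmom_lifts X Y 2 H),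
    (Tmom1_lifts X Y H), (Tmom2_lifts X Y H). ring.
Qed.

Lemma Tmom4_lifts X Y : lifts X Y ->
  Tmom Y 4 = (w * (Cmom X 3 + (1 + 1 + 1 + 1) * (Cmom X 0 * Cmom X 2) + (1 + 1 + 1) * (Cmom X 1 * Cmom X 1)
    + (1 + 1 + 1 + 1 + 1 + 1) * (Cmom X 0 * Cmom X 0 * Cmom X 1) + Cmom X 0 * Cmom X 0 * Cmom X 0 * Cmom X 0))%S.
Proof.
  intros H. rewrite (Tmom_lifts X Y 4 H), Fmom4_rec, !zshift_add, !zshift_mul,
    <- (w_zshift X Y H), <- (Tmom_lifts X Y 1 H), <- (Tmom_lifts X Y 2 H), <- (Tmom_lifts X Y 3 H),
    (Tmom1_lifts X Y H), (Tmom2_lifts X Y H), (Tmom3_lifts X Y H). ring.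
Qed.

(** * Growth of the number of unlabelled trees *)

Lemma w_0 : w 0%nat = 0.
Proof. reflexivity. Qed.

Lemma w_1 : w 1%nat = 1.
Proof. reflexivity. Qed.

Lemma w_ge0 n : 0 <= w n.
Proof. apply pos_INR. Qed.

Lemma Fmom_0 X n : Fmom X 0 n = w (S n).
Proof.
  unfold Fmom, Sg, w, U. simpl pow. rewrite lsum_const, length_map. ring.
Qed.

Lemma lsum_INR_tsize M : lsum (fun t => INR (tsize t)) M = INR (list_sum (map tsize M)).
Proof. induction M as [|t M IH]; [reflexivity|]. simpl. rewrite plus_INR, <- IH. reflexivity. Qed.

(* The coefficientwise form of [zT' >= T + T zT']. *)
Lemma w_rec n :
  w (S n) + lsum (fun j => INR j * w j * w (S n - j)%nat) (seq 1 n) <= INR (S n) * w (S n).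
Proof.
  set (X := fun t => INR (tsize t)).
  assert (E : Fmom X 1 n = INR n * w (S n)).
  { unfold Fmom, Sg. rewrite (lsum_ext _ (fun _ => INR n)).
    - rewrite lsum_const, Rmult_comm. unfold w, U. rewrite length_map. reflexivity.
    - intros M HM. apply ms_spec in HM. unfold X. rewrite lsum_INR_tsize, (proj2 HM). ring. }
  rewrite Fmom1_rec in E. rewrite S_INR, Rmult_plus_distr_r, <- E. unfold smul.
  rewrite lsum_seq_0, <- (lsum_seq_shift (fun i => Cmom X 0 i * Fmom X 0 (n - i)%nat)).
  assert (H0 : Cmom X 0 0%nat * Fmom X 0 (n - 0)%nat = 0) by (unfold Cmom; simpl; ring).
  rewrite H0.
  assert (lsum (fun j => INR j * w j * w (S n - j)%nat) (seq 1 n)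
          <= lsum (fun i => Cmom X 0 i * Fmom X 0 (n - i)%nat) (seq 1 n)); [|lra].
  apply lsum_le. intros j Hj. apply in_seq in Hj.
  rewrite Fmom_0. replace (S (n - j)) with (S n - j)%nat by lia.
  apply Rmult_le_compat_r; [apply w_ge0|].
  assert (EA : Tmom X 1 j = INR j * w j).
  { unfold Tmom. rewrite (lsum_ext _ (fun _ => INR j)).
    - rewrite lsum_const. unfold w. ring.
    - intros t Ht. apply U_tsize in Ht. unfold X. rewrite Ht. ring. }
  assert (HA : forall d, 0 <= Tmom X 1 d).
  { intros d. apply lsum_ge0. intros t _. apply pow_le, pos_INR. }
  rewrite <- EA. unfold Cmom.
  (* Only the pair [k = 1], [d = j] of the nonnegative double sum is kept. *)
  eapply Rle_trans; [|apply (lsum_In_le _ _ 1%nat)]; [|intros k _|apply in_seq; lia].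
  - eapply Rle_trans; [|apply (lsum_In_le _ _ j)]; [|intros d _|apply in_seq; lia].
    + cbv beta. rewrite Nat.mul_1_l, Nat.eqb_refl. simpl. lra.
    + destruct (1 * d =? j)%nat; [|lra]. rewrite pow_O, Rmult_1_l. apply HA.
  - apply lsum_ge0. intros d _. destruct (k * d =? j)%nat; [|lra].
    rewrite pow_O, Rmult_1_l. apply HA.
Qed.

(** Since [w 1 = 1], the last term of the sum in [w_rec] suffices. *)
Lemma w_incr n : w n <= w (S n).
Proof.
  destruct n as [|n]; [rewrite w_0; apply w_ge0|].
  pose proof (w_rec (S n)) as H.
  assert (INR (S n) * w (S n) <= lsum (fun j => INR j * w j * w (S (S n) - j)%nat) (seq 1 (S n))).
  { eapply Rle_trans; [|apply (lsum_In_le _ _ (S n))]; [|intros j _|apply in_seq; lia].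
    - cbv beta. replace (S (S n) - S n)%nat with 1%nat by lia. rewrite w_1. lra.
    - repeat apply Rmult_le_pos; apply w_ge0 || apply pos_INR. }
  rewrite (S_INR (S n)) in H. assert (0 < INR (S n)) by (apply lt_0_INR; lia).
  apply Rmult_le_reg_l with (INR (S n)); [assumption|]. lra.
Qed.

Lemma w_pos n : (1 <= n)%nat -> 1 <= w n.
Proof.
  induction n as [|n IH]; [lia|]. intros _. destruct n as [|n]; [rewrite w_1; lra|].
  eapply Rle_trans; [apply IH; lia|apply w_incr].
Qed.

(** * Coefficientwise comparison and the series [1 / (1 - T)] *)

Definition sle (f g : series) : Prop := forall n, f n <= g n.

Lemma smul_le f g g' : sle s0 f -> sle g g' -> sle (f * g) (f * g').
Proof.
  intros Hf Hg n. apply lsum_le. intros i _. apply Rmult_le_compat_l; [apply Hf|apply Hg].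
Qed.

Lemma smul_ge0 f g : sle s0 f -> sle s0 g -> sle s0 (f * g).
Proof.
  intros Hf Hg n. apply lsum_ge0. intros i _.
  apply Rmult_le_pos; [apply (Hf i)|apply (Hg (n - i)%nat)].
Qed.

Lemma spow_ge0 f k : sle s0 f -> sle s0 (f ^ k).
Proof.
  intros Hf. induction k as [|k IH]; [intros [|n]; unfold s0; simpl; lra|].
  apply smul_ge0; assumption.
Qed.

Lemma w_sge0 : sle s0 w.
Proof. intros n. apply w_ge0. Qed.

(** Fixed-point iteration for [V = 1 + T V]; coefficient [n] is final after [n + 1] steps because
    [T] has no constant term. *)
Fixpoint Viter (N : nat) : series :=
  match N with O => s0 | S N' => (1 + w * Viter N')%S end.

(* [V = 1 / (1 - T)]. *)
Definition V : series := fun n => Viter (S n) n.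

Lemma Viter_stable n N : (n < N)%nat -> Viter N n = V n.
Proof.
  unfold V. revert N. induction n as [n IH] using lt_wf_ind.
  intros [|N] HN; [lia|]. simpl Viter. unfold sadd, smul. f_equal.
  rewrite !lsum_seq_0, w_0, !Rmult_0_l. f_equal.
  apply lsum_ext. intros i Hi. apply in_seq in Hi.
  rewrite (IH (n - S i)%nat) with (N := N) by lia.
  rewrite (IH (n - S i)%nat) with (N := n) by lia. reflexivity.
Qed.

Lemma V_eq : V = (1 + w * V)%S.
Proof.
  extensionality n. unfold V at 1. simpl Viter. unfold sadd, smul. f_equal.
  rewrite !lsum_seq_0, w_0, !Rmult_0_l. f_equal.
  apply lsum_ext. intros i Hi. apply in_seq in Hi.
  rewrite Viter_stable by lia. reflexivity.
Qed.

Lemma V_0 : V 0%nat = 1.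
Proof. unfold V. simpl. unfold sadd, smul, s0. simpl. rewrite w_0. ring. Qed.

Lemma V_S n : V (S n) = lsum (fun i => w (S i) * V (n - i)%nat) (seq 0 (S n)).
Proof.
  transitivity ((1 + w * V)%S (S n)); [rewrite <- V_eq; reflexivity|]. unfold sadd, smul.
  rewrite (lsum_seq_0 _ (S n)), w_0. unfold s1. simpl Nat.sub. ring.
Qed.

Lemma V_ge0 : sle s0 V.
Proof.
  intros n. unfold s0. induction n as [n IH] using lt_wf_ind.
  destruct n as [|n]; [rewrite V_0; lra|]. rewrite V_S. apply lsum_ge0.
  intros i Hi. apply in_seq in Hi. apply Rmult_le_pos; [apply w_ge0|]. apply IH. lia.
Qed.

(** In [V_(n+1) = sum_i w_(i+1) V_(n-i)] the term [i = 0] equals [V_n], and since [w] increases the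
    other terms dominate the expansion of [V_n]. *)
Lemma V_double n : (1 <= n)%nat -> 2 * V n <= V (S n).
Proof.
  intros Hn. destruct n as [|n]; [lia|].
  rewrite (V_S (S n)), lsum_seq_0, w_1, Nat.sub_0_r.
  assert (V (S n) <= lsum (fun i => w (S (S i)) * V (S n - S i)%nat) (seq 0 (S n))); [|lra].
  rewrite (V_S n). apply lsum_le. intros i _. simpl Nat.sub.
  apply Rmult_le_compat_r; [apply V_ge0|apply w_incr].
Qed.

(** [V - 1 = T + T (V - 1)], while by [w_rec] the series [z T'] satisfies the same relation with
    [>=]; induction compares the two. *)
Lemma V_le n : (1 <= n)%nat -> V n <= INR n * w n.
Proof.
  induction n as [n IH] using lt_wf_ind. intros Hn. destruct n as [|n]; [lia|].
  eapply Rle_trans; [|apply w_rec].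
  rewrite V_S, lsum_seq_S, Nat.add_0_l, Nat.sub_diag, V_0, Rmult_1_r, Rplus_comm.
  apply Rplus_le_compat_l. rewrite lsum_seq_shift.
  destruct n as [|n]; [apply Rle_refl|].
  rewrite (lsum_seq_rev (fun i => INR (S i) * w (S i) * w (S (S n) - S i)%nat)).
  apply lsum_le. intros i Hi. apply in_seq in Hi.
  replace (S (n - i)) with (S n - i)%nat by lia.
  replace (S (S n) - (S n - i))%nat with (S i) by lia.
  rewrite Rmult_comm. apply Rmult_le_compat_r; [apply w_ge0|]. apply IH; lia.
Qed.

(* Unlike [V], it satisfies [2 W_n <= W_(n+1)] also for [n = 0]. *)
Definition W : series := (V + V - 1)%S.

Lemma W_double n : 2 * W n <= W (S n).
Proof.
  unfold W, ssub, sadd, sopp, s1. destruct n as [|n].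
  - rewrite V_0, V_S. simpl. rewrite w_1, V_0. lra.
  - pose proof (V_double (S n) ltac:(lia)). lra.
Qed.

Lemma W_ge0 : sle s0 W.
Proof.
  intros n. unfold s0. induction n as [|n IH]; [|pose proof (W_double n); lra].
  unfold W, ssub, sadd, sopp, s1. rewrite V_0. lra.
Qed.

Lemma W_shift n i : (i <= n)%nat -> W (n - i)%nat <= (/ 2) ^ i * W n.
Proof.
  revert n. induction i as [|i IH]; intros n Hi; [rewrite Nat.sub_0_r; simpl; lra|].
  destruct n as [|n]; [lia|]. simpl Nat.sub.
  eapply Rle_trans; [apply IH; lia|]. simpl pow. rewrite Rmult_assoc, (Rmult_comm (/ 2)), Rmult_assoc.
  apply Rmult_le_compat_l; [apply pow_le; lra|]. pose proof (W_double n). lra.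
Qed.

(** From [T V = V - 1] one gets [T W = W - 1 - T]. *)
Lemma wW_le : sle (w * W) W.
Proof.
  assert (E : (w * W = W - 1 - w)%S).
  { unfold W. transitivity ((1 + w * V - 1) + (1 + w * V - 1) - w)%S; [ring|].
    rewrite <- V_eq. ring. }
  intros n. rewrite E. unfold ssub, sadd, sopp. pose proof (w_ge0 n).
  unfold s1. destruct n; lra.
Qed.

Lemma V_le_W : sle V W.
Proof.
  intros n. unfold W, ssub, sadd, sopp, s1. pose proof (V_ge0 n) as H. unfold s0 in H.
  destruct n; [rewrite V_0|]; lra.
Qed.

Lemma W_le n : (1 <= n)%nat -> W n <= 2 * (INR n * w n).
Proof.
  intros Hn. pose proof (V_le n Hn). unfold W, ssub, sadd, sopp, s1.
  destruct n; [lia|]. lra.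
Qed.

(** * Norms of series in [z] and [T(z)] *)

Definition Binf (c : R) (f : series) : Prop := forall n, Rabs (f n) <= c * W n.

(* For a polynomial in [T] with coefficients in [z], [Binf] controls the supremum
   over the powers of [T], and the multiplier norm [Bmul] is at most the sum of the
   absolute values of the coefficients, taken at [z = 1/2]. *)
Definition Bmul (c : R) (f : series) : Prop :=
  0 <= c /\ forall d g, Binf d g -> Binf (c * d) (f * g).

Lemma W_gt0 : 0 < W 0%nat.
Proof. unfold W, ssub, sadd, sopp, s1. rewrite V_0. lra. Qed.

Lemma Binf_ge0 c f : Binf c f -> 0 <= c.
Proof.
  intros H. pose proof (H 0%nat). pose proof (Rabs_pos (f 0%nat)). pose proof W_gt0.
  apply Rmult_le_reg_r with (W 0%nat); lra.
Qed.

Lemma Binf_le c d f : c <= d -> Binf c f -> Binf d f.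
Proof.
  intros Hcd H n. eapply Rle_trans; [apply H|].
  apply Rmult_le_compat_r; [apply W_ge0|assumption].
Qed.

Lemma Binf_add c d f g : Binf c f -> Binf d g -> Binf (c + d) (f + g).
Proof.
  intros Hf Hg n. unfold sadd. eapply Rle_trans; [apply Rabs_triang|].
  specialize (Hf n). specialize (Hg n). lra.
Qed.

Lemma Binf_opp c f : Binf c f -> Binf c (- f).
Proof. intros Hf n. unfold sopp. rewrite Rabs_Ropp. apply Hf. Qed.

Lemma Binf_0 c : 0 <= c -> Binf c 0.
Proof.
  intros Hc n. unfold s0. rewrite Rabs_R0. apply Rmult_le_pos; [assumption|apply W_ge0].
Qed.

Lemma Binf_sle f : sle s0 f -> sle f W -> Binf 1 f.
Proof. intros H0 H n. rewrite Rabs_pos_eq, Rmult_1_l; [apply H|apply H0]. Qed.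

Lemma Binf_1 : Binf 1 1.
Proof.
  apply Binf_sle; intros n; pose proof (W_ge0 n) as H; unfold s0, s1 in *.
  - destruct n; lra.
  - destruct n; [unfold W, ssub, sadd, sopp, s1; rewrite V_0|]; lra.
Qed.

Lemma smul_abs f g n :
  Rabs ((f * g)%S n) <= ((fun i => Rabs (f i)) * (fun i => Rabs (g i)))%S n.
Proof.
  unfold smul. eapply Rle_trans; [apply lsum_abs|].
  apply lsum_le. intros i _. rewrite Rabs_mult. lra.
Qed.

Lemma Bmul_ge0 c f : Bmul c f -> 0 <= c.
Proof. intros [H _]. assumption. Qed.

Lemma Bmul_Binf c f : Bmul c f -> Binf c f.
Proof.
  intros [_ H]. specialize (H 1 s1 Binf_1). rewrite Rmult_1_r in H.
  replace f with (f * 1)%S by ring. assumption.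
Qed.

Lemma Bmul_le c d f : c <= d -> Bmul c f -> Bmul d f.
Proof.
  intros Hcd [H0 H]. split; [lra|]. intros e g Hg.
  eapply Binf_le; [|apply H; eassumption].
  apply Rmult_le_compat_r; [eapply Binf_ge0; eassumption|assumption].
Qed.

Lemma Bmul_add c d f g : Bmul c f -> Bmul d g -> Bmul (c + d) (f + g).
Proof.
  intros [Hc Hf] [Hd Hg]. split; [lra|]. intros e x Hx.
  replace ((f + g) * x)%S with (f * x + g * x)%S by ring.
  rewrite Rmult_plus_distr_r. apply Binf_add; auto.
Qed.

Lemma Bmul_opp c f : Bmul c f -> Bmul c (- f).
Proof.
  intros [Hc Hf]. split; [assumption|]. intros e x Hx.
  replace (- f * x)%S with (- (f * x))%S by ring. apply Binf_opp. auto.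
Qed.

Lemma Bmul_mul c d f g : Bmul c f -> Bmul d g -> Bmul (c * d) (f * g).
Proof.
  intros [Hc Hf] [Hd Hg]. split; [apply Rmult_le_pos; assumption|]. intros e x Hx.
  replace (f * g * x)%S with (f * (g * x))%S by ring.
  rewrite Rmult_assoc. auto.
Qed.

Lemma Bmul_1 : Bmul 1 1.
Proof.
  split; [lra|]. intros e x Hx. rewrite Rmult_1_l.
  replace (1 * x)%S with x by ring. assumption.
Qed.

Lemma Bmul_0 c : 0 <= c -> Bmul c 0.
Proof.
  intros Hc. split; [assumption|]. intros d g Hg. replace (0 * g)%S with s0 by ring.
  apply Binf_0, Rmult_le_pos; [|eapply Binf_ge0]; eassumption.
Qed.

Lemma Bmul_w : Bmul 1 w.
Proof.
  split; [lra|]. intros d g Hg n. rewrite Rmult_1_l.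
  pose proof (Binf_ge0 _ _ Hg) as Hd.
  eapply Rle_trans; [apply smul_abs|].
  apply Rle_trans with (d * (w * W)%S n).
  - unfold smul. rewrite <- lsum_scal. apply lsum_le. intros i _.
    rewrite (Rabs_pos_eq (w i)) by apply w_ge0.
    pose proof (Rmult_le_compat_l (w i) _ _ (w_ge0 i) (Hg (n - i)%nat)). lra.
  - apply Rmult_le_compat_l; [assumption|apply wW_le].
Qed.

Lemma Bmul_spow c f k : Bmul c f -> Bmul (c ^ k) (f ^ k).
Proof. intros H. induction k as [|k IH]; [apply Bmul_1|apply Bmul_mul; assumption]. Qed.

Lemma Bmul_wpow k : Bmul 1 (w ^ k).
Proof. rewrite <- (pow1 k). apply Bmul_spow, Bmul_w. Qed.

Lemma Bmul_wmul c f : Bmul c f -> Bmul c (w * f).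
Proof. intros H. rewrite <- (Rmult_1_l c). apply Bmul_mul; [apply Bmul_w|assumption]. Qed.

Lemma Binf_wmul c f : Binf c f -> Binf c (w * f).
Proof. intros H. rewrite <- (Rmult_1_l c). apply Bmul_w. assumption. Qed.

(** By [W_shift], multiplication by [z^i] costs at most a factor [2^-i]. *)
Lemma Bmul_coef c (q : series) :
  (forall N, lsum (fun i => Rabs (q i) * (/ 2) ^ i) (seq 0 N) <= c) -> Bmul c q.
Proof.
  intros H. split; [exact (H 0%nat)|]. intros d g Hg n.
  pose proof (Binf_ge0 _ _ Hg) as Hd.
  eapply Rle_trans; [apply smul_abs|].
  apply Rle_trans with (lsum (fun i => Rabs (q i) * (/ 2) ^ i) (seq 0 (S n)) * (d * W n)).
  - unfold smul. rewrite <- lsum_scal_r. apply lsum_le. intros i Hi. apply in_seq in Hi.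
    rewrite Rmult_assoc. apply Rmult_le_compat_l; [apply Rabs_pos|].
    eapply Rle_trans; [apply Hg|].
    pose proof (Rmult_le_compat_l d _ _ Hd (W_shift n i ltac:(lia))). lra.
  - rewrite (Rmult_assoc c). apply Rmult_le_compat_r; [|apply H].
    apply Rmult_le_pos; [assumption|apply W_ge0].
Qed.

(** * Contribution of repeated subtrees *)

Lemma exp_neg_le x y : 0 <= y <= x -> x < 1 -> exp (- (y / (1 - x))) <= 1 - y.
Proof.
  intros Hy Hx. set (v := y / (1 - x)).
  assert (Ev : v * (1 - x) = y) by (unfold v; field; lra).
  assert (Hv : 0 <= v) by (apply Rmult_le_reg_r with (1 - x); lra).
  rewrite exp_Ropp. apply Rmult_le_reg_l with (exp v); [apply exp_pos|].
  rewrite Rinv_r by (pose proof (exp_pos v); lra).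
  pose proof (exp_ineq1_le v).
  assert (1 <= (1 + v) * (1 - y)) by nra. nra.
Qed.

(** The full series is the product of the [1 / (1 - x^|t|)], and [exp_neg_le] bounds each factor by
    [exp (x^|t| / (1 - x))]. *)
Lemma ms_weight_le x l N : 0 < x < 1 ->
  lsum (fun m => x ^ m * INR (length (ms l m))) (seq 0 N)
  <= exp (lsum (fun t => x ^ tsize t / (1 - x)) l).
Proof.
  intros Hx. induction l as [|t l IH].
  - simpl lsum at 2. rewrite exp_0.
    destruct N as [|N]; [simpl; lra|]. rewrite lsum_seq_0, lsum_0; [simpl; lra|].
    intros i _. simpl. ring.
  - rewrite lsum_cons. set (s := tsize t).
    set (a := lsum (fun m => x ^ m * INR (length (ms (t :: l) m))) (seq 0 N)).
    pose proof (tsize_pos t) as Hs. fold s in Hs.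
    assert (Hxs : 0 < x ^ s <= x).
    { split; [apply pow_lt; lra|]. destruct s as [|s']; [lia|]. simpl.
      assert (x ^ s' <= 1) by (rewrite <- (pow1 s'); apply pow_incr; lra). nra. }
    set (e2 := exp (lsum (fun t => x ^ tsize t / (1 - x)) l)) in *.
    (* Multisets containing [t] are arbitrary multisets plus one copy, so the partial sum bounds
       itself; solving for [a] avoids infinite sums. *)
    assert (Ha : a <= e2 + x ^ s * a).
    { eapply Rle_trans; [|apply Rplus_le_compat_r; exact IH].
      eapply Rle_trans; [|apply Rplus_le_compat_l, Rmult_le_compat_l;
        [lra|apply (lsum_shift_le _ s)]].
      - rewrite <- lsum_scal, <- lsum_plus. apply lsum_le. intros m _.
        rewrite ms_cons. fold s. rewrite length_app, plus_INR.
        destruct (Nat.leb_spec s m) as [H|H]; [rewrite length_map|simpl; lra].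
        replace (x ^ m) with (x ^ s * x ^ (m - s)) at 1 2
          by (rewrite <- pow_add; f_equal; lia). lra.
      - intros i. apply Rmult_le_pos; [apply pow_le; lra|apply pos_INR]. }
    rewrite exp_plus. fold e2.
    pose proof (exp_neg_le x (x ^ s) ltac:(lra) ltac:(lra)) as He.
    rewrite exp_Ropp in He. pose proof (exp_pos (x ^ s / (1 - x))).
    assert (0 < e2) by apply exp_pos.
    set (e1 := exp (x ^ s / (1 - x))) in *.
    assert (1 <= (1 - x ^ s) * e1).
    { apply Rmult_le_reg_l with (/ e1); [apply Rinv_0_lt_compat; assumption|].
      replace (/ e1 * ((1 - x ^ s) * e1)) with (1 - x ^ s) by (field; lra). lra. }
    assert (a * (1 - x ^ s) <= e2) by lra.
    apply Rmult_le_reg_r with (1 - x ^ s); [lra|].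
    assert (e2 * 1 <= e2 * ((1 - x ^ s) * e1)) by (apply Rmult_le_compat_l; lra). lra.
Qed.

(** The bound comes from [(16/15)^16 < 2.84]; it is sharp enough because [0.26 * 2.84 <= 0.74]. *)
Lemma exp_1_le : exp 1 <= 284 / 100.
Proof.
  assert (H : exp (/ 16) <= 16 / 15).
  { pose proof (exp_ineq1_le (- / 16)) as H. rewrite exp_Ropp in H.
    pose proof (exp_pos (/ 16)). set (e := exp (/ 16)) in *.
    apply Rmult_le_reg_r with (/ e); [apply Rinv_0_lt_compat; assumption|].
    rewrite Rinv_r by lra. lra. }
  assert (E : forall n, exp (INR n * / 16) = exp (/ 16) ^ n).
  { induction n as [|n IH]; [simpl; rewrite Rmult_0_l; apply exp_0|].
    rewrite S_INR, Rmult_plus_distr_r, Rmult_1_l, exp_plus, IH. simpl. ring. }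
  replace 1 with (INR 16 * / 16) by (simpl; lra). rewrite E.
  eapply Rle_trans; [apply pow_incr; split; [left; apply exp_pos|exact H]|]. lra.
Qed.

(* Any radius with [x e <= 1 - x] works; it must exceed [1/4], the radius at which
   the moments of the trees occurring in at least two copies are needed. *)
Lemma pool_weight N : lsum (fun t => (26 / 100) ^ tsize t) (pool N) <= 74 / 100.
Proof.
  induction N as [|N IH]; [simpl; lra|].
  set (x := 26 / 100) in *.
  assert (E : lsum (fun t => x ^ tsize t) (pool (S N))
    = x * lsum (fun m => x ^ m * INR (length (ms (pool N) m))) (seq 0 (S N))).
  { rewrite lsum_pool, lsum_seq_shift, <- lsum_scal. apply lsum_ext.
    intros m Hm. apply in_seq in Hm. rewrite ms_pool by lia.
    rewrite (lsum_ext _ (fun _ => x ^ S m)).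
    - rewrite lsum_const. unfold U. rewrite length_map. simpl. ring.
    - intros t Ht. apply U_tsize in Ht. rewrite Ht. reflexivity. }
  rewrite E.
  pose proof (ms_weight_le x (pool N) (S N) ltac:(unfold x; lra)) as H.
  unfold Rdiv in H. rewrite lsum_scal_r in H.
  (* The induction hypothesis is [S <= 1 - x] for the sum [S] over [pool N], so the exponent
     [S / (1 - x)] is at most [1]. *)
  assert (exp (lsum (fun t => x ^ tsize t) (pool N) * / (1 - x)) <= exp 1).
  { destruct (Rle_lt_or_eq_dec (lsum (fun t => x ^ tsize t) (pool N) * / (1 - x)) 1) as [L|L].
    - apply Rmult_le_reg_r with (1 - x); [unfold x; lra|].
      rewrite Rmult_assoc, Rinv_l by (unfold x; lra). unfold x in *. lra.
    - left. apply exp_increasing. assumption.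
    - rewrite L. apply Rle_refl. }
  pose proof exp_1_le. unfold x in *. lra.
Qed.

(** [b^m] is at most each of the [m] terms [b^i] with [i < m]. *)
Lemma INR_mul_pow_le b m : 0 <= b < 1 -> INR m * b ^ m <= / (1 - b).
Proof.
  intros Hb. eapply Rle_trans; [|apply (geom_sum_le b m Hb)].
  rewrite <- (length_seq m 0) at 1. rewrite <- lsum_const. apply lsum_le.
  intros i Hi. apply in_seq in Hi. replace m with (i + (m - i))%nat by lia.
  rewrite pow_add. rewrite <- (Rmult_1_r (b ^ i)) at 2.
  apply Rmult_le_compat_l; [apply pow_le; lra|].
  rewrite <- (pow1 (m - i)). apply pow_incr. lra.
Qed.

Lemma INR_pow4_geom_bounded a :
  0 <= a < 1 -> exists C, 0 <= C /\ forall m, INR m ^ 4 * a ^ m <= C.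
Proof.
  (* With the fourth root [b] of [a], the quantity is [(m b^m)^4]. *)
  intros Ha. set (b := sqrt (sqrt a)).
  assert (Hb0 : 0 <= b) by apply sqrt_pos.
  assert (Hb4 : b ^ 4 = a).
  { replace (b ^ 4) with ((b * b) * (b * b)) by ring. unfold b.
    rewrite !sqrt_sqrt; [reflexivity|lra|apply sqrt_pos]. }
  assert (Hb : b < 1).
  { destruct (Rlt_le_dec b 1) as [|H]; [assumption|]. exfalso.
    assert (1 ^ 4 <= b ^ 4) by (apply pow_incr; lra). rewrite pow1 in *. lra. }
  exists ((/ (1 - b)) ^ 4). split.
  - apply pow_le. left. apply Rinv_0_lt_compat. lra.
  - intros m. rewrite <- Hb4, <- pow_mult, Nat.mul_comm, pow_mult, <- Rpow_mult_distr.
    apply pow_incr. split; [|apply INR_mul_pow_le; lra].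
    apply Rmult_le_pos; [apply pos_INR|apply pow_le; lra].
Qed.

(** The part of [Cmom] with multiplicity [k >= 2]; [seq 2 (m - 1)] ends at [m]. *)
Definition Rem (X : tree -> R) (a : nat) : series := fun m =>
  lsum (fun k => lsum (fun d =>
    if (k * d =? m)%nat then INR k ^ a * Tmom X (S a) d else 0) (seq 1 m)) (seq 2 (m - 1)).

Lemma Cmom_split X a : Cmom X a = (Tmom X (S a) + Rem X a)%S.
Proof.
  extensionality m. unfold sadd, Cmom, Rem. destruct m as [|m]; [unfold Tmom; simpl; ring|].
  simpl seq at 2. rewrite lsum_cons. simpl (S m - 1)%nat. rewrite Nat.sub_0_r. f_equal.
  rewrite pow1. transitivity (lsum (fun d => if (S m =? d)%nat then 1 * Tmom X (S a) d else 0) (seq 1 (S m))).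
  - apply lsum_ext. intros d _. rewrite Nat.mul_1_l, Nat.eqb_sym. reflexivity.
  - rewrite (lsum_indicator (fun d => 1 * Tmom X (S a) d)).
    destruct (Nat.leb_spec 1 (S m)), (Nat.ltb_spec (S m) (1 + S m)); try lia. simpl. ring.
Qed.

(** The decay rate in the level. It has to lie strictly between [25/26 = (1/4) / (26/100)], the room
    left by [pool_weight], and [1]. *)
Definition q : R := 99 / 100.

Lemma q_pow_ge0 j : 0 <= q ^ j.
Proof. apply pow_le. unfold q. lra. Qed.

Lemma INR_pow_le4 m a : (a <= 4)%nat -> INR m ^ a <= 1 + INR m ^ 4.
Proof.
  intros Ha. destruct m as [|m].
  - destruct a as [|a]; simpl; lra.
  - assert (1 <= INR (S m)) by (rewrite S_INR; pose proof (pos_INR m); lra).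
    pose proof (Rle_pow (INR (S m)) a 4 ltac:(assumption) Ha). lra.
Qed.

(** Only trees of size [m > j] contribute. Of [(1/4)^m], the factor [(25/26/q)^m] absorbs [m^4],
    [q^m <= q^j] gives the decay, and [(26/100)^m] is summed by [pool_weight]. *)
Lemma tree_moment_bound : exists C, 0 <= C /\ forall X j a N, (a <= 4)%nat -> (1 <= a)%nat ->
  (forall t, Rabs (X t) <= INR (tsize t)) -> (forall t, (tsize t <= j)%nat -> X t = 0) ->
  lsum (fun t => (/ 4) ^ tsize t * Rabs (X t) ^ a) (pool N) <= C * q ^ j.
Proof.
  destruct (INR_pow4_geom_bounded (25 / 26 / q)) as (C & HC0 & HC); [unfold q; lra|].
  exists (C + 1). split; [lra|]. intros X j a N Ha Ha1 HX H0.
  apply Rle_trans with (lsum (fun t => (C + 1) * q ^ j * (26 / 100) ^ tsize t) (pool N)).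
  - apply lsum_le. intros t _. destruct (Nat.le_gt_cases (tsize t) j) as [H|H].
    + rewrite H0, Rabs_R0 by assumption. destruct a as [|a]; [lia|].
      rewrite pow_ne_zero, Rmult_0_r by lia.
      repeat apply Rmult_le_pos; [lra|apply q_pow_ge0|apply pow_le; lra].
    + set (m := tsize t) in *.
      assert (Hm : 1 <= INR m) by (apply (le_INR 1); lia).
      assert (Rabs (X t) ^ a <= INR m ^ 4).
      { apply Rle_trans with (INR m ^ a); [apply pow_incr; split; [apply Rabs_pos|apply HX]|].
        apply Rle_pow; assumption. }
      assert (Eq : (/ 4) ^ m = (25 / 26 / q) ^ m * (q ^ m * (26 / 100) ^ m)).
      { rewrite <- !Rpow_mult_distr. f_equal. unfold q. field. }
      assert (Hq : q ^ m <= q ^ j).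
      { replace m with (j + (m - j))%nat by lia. rewrite pow_add.
        pose proof (q_pow_ge0 j).
        assert (q ^ (m - j) <= 1) by (rewrite <- (pow1 (m - j)); apply pow_incr; unfold q; lra).
        nra. }
      apply Rle_trans with ((/ 4) ^ m * INR m ^ 4).
      { apply Rmult_le_compat_l; [apply pow_le; lra|assumption]. }
      rewrite Eq. specialize (HC m).
      assert (0 <= (26 / 100) ^ m) by (apply pow_le; lra).
      pose proof (q_pow_ge0 m).
      replace ((25 / 26 / q) ^ m * (q ^ m * (26 / 100) ^ m) * INR m ^ 4)
        with ((INR m ^ 4 * (25 / 26 / q) ^ m) * (q ^ m * (26 / 100) ^ m)) by ring.
      rewrite (Rmult_assoc (C + 1)). apply Rmult_le_compat.
      * apply Rmult_le_pos; [apply (pow_le _ 4); lra|apply pow_le; unfold q; lra].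
      * apply Rmult_le_pos; assumption.
      * lra.
      * apply Rmult_le_compat_r; assumption.
  - rewrite lsum_scal. rewrite <- (Rmult_1_r ((C + 1) * q ^ j)) at 2.
    apply Rmult_le_compat_l; [|pose proof (pool_weight N); lra].
    apply Rmult_le_pos; [lra|apply q_pow_ge0].
Qed.

Lemma copies_weight_bounded :
  exists C, 0 <= C /\ forall a N, (a <= 4)%nat ->
    lsum (fun k => INR k ^ a * (/ 2) ^ (k - 2)) (seq 2 N) <= C.
Proof.
  destruct (INR_pow4_geom_bounded (2 / 3)) as (C & HC0 & HC); [lra|].
  exists (4 * (C + 1) * / (1 - 3 / 4)). split.
  { apply Rmult_le_pos; [lra|]. lra. }
  intros a N Ha.
  apply Rle_trans with (lsum (fun k => 4 * (C + 1) * (3 / 4) ^ k) (seq 0 (2 + N))).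
  - rewrite seq_app, lsum_app.
    assert (0 <= lsum (fun k => 4 * (C + 1) * (3 / 4) ^ k) (seq 0 2)).
    { apply lsum_ge0. intros k _. apply Rmult_le_pos; [lra|apply pow_le; lra]. }
    simpl (0 + 2)%nat.
    assert (lsum (fun k => INR k ^ a * (/ 2) ^ (k - 2)) (seq 2 N)
      <= lsum (fun k => 4 * (C + 1) * (3 / 4) ^ k) (seq 2 N)); [|lra].
    apply lsum_le. intros k Hk. apply in_seq in Hk.
    (* [1/2 = 2/3 * 3/4]: the first power absorbs [k^a], the second is summed. *)
    assert (E : (/ 2) ^ (k - 2) = 4 * ((2 / 3) ^ k * (3 / 4) ^ k)).
    { rewrite <- Rpow_mult_distr. replace (2 / 3 * (3 / 4)) with (/ 2) by field.
      replace k with (2 + (k - 2))%nat at 2 by lia. rewrite pow_add. simpl. field. }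
    rewrite E. specialize (HC k). pose proof (INR_pow_le4 k a Ha) as H4.
    assert (H34 : 0 <= (3 / 4) ^ k) by (apply pow_le; lra).
    assert (H23 : 0 <= (2 / 3) ^ k <= 1).
    { split; [apply pow_le; lra|]. rewrite <- (pow1 k). apply pow_incr. lra. }
    replace (INR k ^ a * (4 * ((2 / 3) ^ k * (3 / 4) ^ k)))
      with (4 * (INR k ^ a * (2 / 3) ^ k) * (3 / 4) ^ k) by ring.
    apply Rmult_le_compat_r; [assumption|]. apply Rmult_le_compat_l; [lra|]. nra.
  - rewrite lsum_scal. apply Rmult_le_compat_l; [lra|]. apply geom_sum_le. lra.
Qed.

(** For [k >= 2] and [d >= 1] one has [k d >= (k - 2) + 2 d]. Hence the weight [2^-(k d)] splits
    into [2^-(k-2)], summed over the number of copies, and [4^-d], summed over the repeated tree. *)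
Lemma Rem_bound : exists C, 0 <= C /\ forall X j a, (a <= 3)%nat ->
  (forall t, Rabs (X t) <= INR (tsize t)) -> (forall t, (tsize t <= j)%nat -> X t = 0) ->
  Bmul (C * q ^ j) (Rem X a).
Proof.
  destruct tree_moment_bound as (C & HC0 & HC).
  destruct copies_weight_bounded as (D & HD0 & HD).
  exists (D * C). split; [apply Rmult_le_pos; assumption|].
  intros X j a Ha HX H0. apply Bmul_coef. intros N.
  set (Aa := fun d => lsum (fun t => Rabs (X t) ^ S a) (U d)).
  assert (HAa : forall d, 0 <= Aa d).
  { intros d. apply lsum_ge0. intros t _. apply pow_le, Rabs_pos. }
  set (Phi := fun k d => INR k ^ a * Aa d * (/ 2) ^ (k * d)).
  assert (HPhi : forall k d, 0 <= Phi k d).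
  { intros k d. repeat apply Rmult_le_pos; auto; apply pow_le; [apply pos_INR|lra]. }
  apply Rle_trans with (lsum (fun m => lsum (fun k => lsum (fun d =>
    if (k * d =? m)%nat then Phi k d else 0) (seq 1 N)) (seq 2 N)) (seq 0 N)).
  - apply lsum_le. intros m Hm. apply in_seq in Hm.
    apply Rle_trans with (lsum (fun k => lsum (fun d =>
      if (k * d =? m)%nat then Phi k d else 0) (seq 1 m)) (seq 2 (m - 1))).
    + unfold Rem. rewrite Rmult_comm.
      eapply Rle_trans; [apply Rmult_le_compat_l; [apply pow_le; lra|apply lsum_abs]|].
      rewrite <- lsum_scal. apply lsum_le. intros k _.
      eapply Rle_trans; [apply Rmult_le_compat_l; [apply pow_le; lra|apply lsum_abs]|].
      rewrite <- lsum_scal. apply lsum_le. intros d _.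
      destruct (Nat.eqb_spec (k * d) m) as [<-|]; [|rewrite Rabs_R0; lra].
      unfold Phi. rewrite Rmult_comm. apply Rmult_le_compat_r; [apply pow_le; lra|].
      rewrite Rabs_mult, (Rabs_pos_eq (INR k ^ a)) by (apply pow_le, pos_INR).
      apply Rmult_le_compat_l; [apply pow_le, pos_INR|].
      unfold Tmom, Aa. eapply Rle_trans; [apply lsum_abs|]. apply lsum_le. intros t _.
      rewrite RPow_abs. apply Rle_refl.
    + eapply Rle_trans; [apply lsum_seq_le_extend with (m := N); [lia|]|].
      * intros k. apply lsum_ge0. intros d _. destruct (k * d =? m)%nat; [apply HPhi|lra].
      * apply lsum_le. intros k _. apply lsum_seq_le_extend; [lia|].
        intros d. destruct (k * d =? m)%nat; [apply HPhi|lra].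
  - rewrite lsum_exch.
    apply Rle_trans with (lsum (fun k => INR k ^ a * (/ 2) ^ (k - 2) * (C * q ^ j)) (seq 2 N)).
    + apply lsum_le. intros k Hk. apply in_seq in Hk.
      rewrite lsum_exch.
      apply Rle_trans with
        (lsum (fun d => INR k ^ a * (/ 2) ^ (k - 2) * ((/ 4) ^ d * Aa d)) (seq 1 N)).
      * apply lsum_le. intros d Hd. apply in_seq in Hd.
        rewrite (lsum_indicator (fun _ => Phi k d)).
        assert (Phi k d <= INR k ^ a * (/ 2) ^ (k - 2) * ((/ 4) ^ d * Aa d)).
        { unfold Phi. replace (/ 4) with ((/ 2) ^ 2) by (simpl; lra). rewrite <- pow_mult.
          assert ((/ 2) ^ (k * d) <= (/ 2) ^ (k - 2) * (/ 2) ^ (2 * d)).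
          { rewrite <- pow_add. replace (k * d)%nat with (k - 2 + 2 * d + (k * d - (k - 2 + 2 * d)))%nat by nia.
            rewrite (pow_add _ (k - 2 + 2 * d)).
            assert (0 <= (/ 2) ^ (k - 2 + 2 * d)) by (apply pow_le; lra).
            assert ((/ 2) ^ (k * d - (k - 2 + 2 * d)) <= 1).
            { rewrite <- (pow1 (k * d - (k - 2 + 2 * d))). apply pow_incr. lra. }
            nra. }
          replace (INR k ^ a * (/ 2) ^ (k - 2) * ((/ 2) ^ (2 * d) * Aa d))
            with (INR k ^ a * Aa d * ((/ 2) ^ (k - 2) * (/ 2) ^ (2 * d))) by ring.
          apply Rmult_le_compat_l; [|assumption].
          apply Rmult_le_pos; [apply pow_le, pos_INR|apply HAa]. }
        specialize (HPhi k d). destruct (andb _ _); lra.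
      * rewrite lsum_scal. apply Rmult_le_compat_l.
        { apply Rmult_le_pos; apply pow_le; [apply pos_INR|lra]. }
        specialize (HC X j (S a) N ltac:(lia) ltac:(lia) HX H0). rewrite lsum_pool in HC.
        eapply Rle_trans; [|exact HC]. apply lsum_le. intros d _.
        unfold Aa. rewrite <- lsum_scal. apply lsum_le. intros t Ht.
        apply U_tsize in Ht. rewrite Ht. apply Rle_refl.
    + rewrite lsum_scal_r, Rmult_assoc. apply Rmult_le_compat_r.
      * apply Rmult_le_pos; [assumption|apply q_pow_ge0].
      * apply HD. lia.
Qed.

(** * Sequences of series that are nearly geometric *)

(* [f j] behaves like [T^(a j)], with errors summing up to the increase of [F]. *)
Definition geo (a : nat) (F : nat -> R) (f : nat -> series) : Prop :=
  Bmul (F 0%nat) (f 0%nat) /\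
  forall j, Bmul (F (S j) - F j) (f (S j) - w ^ a * f j)%S.

Definition geoB (a : nat) (c : R) (J : nat) (f : nat -> series) : Prop :=
  exists F, geo a F f /\ F J <= c.

Lemma geo_mono a F f i j : geo a F f -> (i <= j)%nat -> F i <= F j.
Proof.
  intros [_ H] Hij. induction Hij as [|j _ IH]; [lra|].
  specialize (H j). apply Bmul_ge0 in H. lra.
Qed.

Lemma geo_ge0 a F f j : geo a F f -> 0 <= F j.
Proof.
  intros H. apply Rle_trans with (F 0%nat).
  - destruct H as [H _]. eapply Bmul_ge0, H.
  - eapply geo_mono; [eassumption|lia].
Qed.

Lemma geo_Bmul a F f j : geo a F f -> Bmul (F j) (f j).
Proof.
  intros [H0 H]. induction j as [|j IH]; [assumption|].
  replace (f (S j)) with (w ^ a * f j + (f (S j) - w ^ a * f j))%S by ring.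
  replace (F (S j)) with (1 * F j + (F (S j) - F j)) by ring.
  apply Bmul_add; [apply Bmul_mul; [apply Bmul_wpow|assumption]|apply H].
Qed.

Lemma geoB_Bmul a c J f : geoB a c J f -> Bmul c (f J).
Proof.
  intros (F & H & Hc). eapply Bmul_le; [exact Hc|]. eapply geo_Bmul. eassumption.
Qed.

(** A discrete product rule. The error bounds add up exactly to the increment of [F * G], which is
    why errors are recorded through a primitive [F]. *)
Lemma geo_mul a b F G f g : geo a F f -> geo b G g ->
  geo (a + b) (fun j => F j * G j) (fun j => f j * g j)%S.
Proof.
  intros Hf Hg. split; [apply Bmul_mul; apply Hf || apply Hg|]. intros j.
  replace (f (S j) * g (S j) - w ^ (a + b) * (f j * g j))%S
    with (w ^ a * (f j * (g (S j) - w ^ b * g j)) + (f (S j) - w ^ a * f j) * g (S j))%S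
    by (rewrite spow_add; ring).
  replace (F (S j) * G (S j) - F j * G j)
    with (1 * (F j * (G (S j) - G j)) + (F (S j) - F j) * G (S j)) by ring.
  apply Bmul_add; repeat apply Bmul_mul.
  - apply Bmul_wpow.
  - eapply geo_Bmul. eassumption.
  - apply Hg.
  - apply Hf.
  - eapply geo_Bmul. eassumption.
Qed.

Lemma geoB_mul a b c d J f g : geoB a c J f -> geoB b d J g ->
  geoB (a + b) (c * d) J (fun j => f j * g j)%S.
Proof.
  intros (F & HF & Hc) (G & HG & Hd). eexists. split; [apply geo_mul; eassumption|].
  apply Rmult_le_compat; try assumption; eapply geo_ge0; eassumption.
Qed.

Lemma geoB_add a c d J f g : geoB a c J f -> geoB a d J g ->
  geoB a (c + d) J (fun j => f j + g j)%S.
Proof.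
  intros (F & [HF0 HF] & Hc) (G & [HG0 HG] & Hd). exists (fun j => F j + G j).
  split; [split|lra].
  - apply Bmul_add; assumption.
  - intros j. replace (f (S j) + g (S j) - w ^ a * (f j + g j))%S
      with ((f (S j) - w ^ a * f j) + (g (S j) - w ^ a * g j))%S by ring.
    replace (F (S j) + G (S j) - (F j + G j)) with ((F (S j) - F j) + (G (S j) - G j)) by ring.
    apply Bmul_add; auto.
Qed.

Lemma geoB_opp a c J f : geoB a c J f -> geoB a c J (fun j => - f j)%S.
Proof.
  intros (F & [HF0 HF] & Hc). exists F. split; [split|assumption].
  - apply Bmul_opp. assumption.
  - intros j. replace (- f (S j) - w ^ a * - f j)%S
      with (- (f (S j) - w ^ a * f j))%S by ring. apply Bmul_opp. auto.
Qed.

Lemma geoB_scal a b c J x f : Bmul b x -> geoB a c J f -> geoB a (b * c) J (fun j => x * f j)%S.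
Proof.
  intros Hx (F & [HF0 HF] & Hc). exists (fun j => b * F j). split; [split|].
  - apply Bmul_mul; assumption.
  - intros j. replace (x * f (S j) - w ^ a * (x * f j))%S
      with (x * (f (S j) - w ^ a * f j))%S by ring.
    rewrite <- Rmult_minus_distr_l. apply Bmul_mul; auto.
  - apply Rmult_le_compat_l; [eapply Bmul_ge0|]; eassumption.
Qed.

Lemma geoB_le a c d J f : c <= d -> geoB a c J f -> geoB a d J f.
Proof. intros H (F & HF & Hc). exists F. split; [assumption|lra]. Qed.

Lemma geoB_intro a c e J f :
  Bmul c (f 0%nat) -> (forall j, Bmul (e j) (f (S j) - w ^ a * f j)%S) ->
  geoB a (c + lsum e (seq 0 J)) J f.
Proof.
  intros H0 H. exists (fun j => c + lsum e (seq 0 j)). split; [split|lra].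
  - simpl. rewrite Rplus_0_r. assumption.
  - intros j. rewrite lsum_seq_S. simpl (0 + j)%nat.
    replace (c + (lsum e (seq 0 j) + e j) - (c + lsum e (seq 0 j))) with (e j) by ring. auto.
Qed.

(* [CS f r = sum_(j < r) T^(r - j) f_j]. *)
Fixpoint CS (f : nat -> series) (r : nat) : series :=
  match r with O => s0 | S r' => (w * (CS f r' + f r'))%S end.

Lemma CS_solve (x f : nat -> series) r :
  (forall j, x (S j) = w * (x j + f j))%S -> x r = (w ^ r * x 0%nat + CS f r)%S.
Proof.
  intros H. induction r as [|r IH]; simpl; [ring|]. rewrite H, IH. ring.
Qed.

Lemma CS_add f g r : CS (fun j => f j + g j)%S r = (CS f r + CS g r)%S.
Proof. induction r as [|r IH]; simpl; [|rewrite IH]; ring. Qed.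

Lemma CS_opp f r : CS (fun j => - f j)%S r = (- CS f r)%S.
Proof. induction r as [|r IH]; simpl; [|rewrite IH]; ring. Qed.

Lemma CS_scal c f r : CS (fun j => c * f j)%S r = (c * CS f r)%S.
Proof. induction r as [|r IH]; simpl; [|rewrite IH]; ring. Qed.

Lemma CS_ext f g r : (forall j, f j = g j) -> CS f r = CS g r.
Proof. intros H. induction r as [|r IH]; simpl; [|rewrite IH, H]; reflexivity. Qed.

Lemma CS_Binf f e r :
  (forall j, (j < r)%nat -> Binf (e j) (f j)) -> Binf (lsum e (seq 0 r)) (CS f r).
Proof.
  intros H. induction r as [|r IH]; [apply Binf_0; simpl; lra|].
  rewrite lsum_seq_S. simpl CS. apply Binf_wmul, Binf_add; auto.
Qed.

(* [free a s = sum_(j < s) T^(s - j) T^(a j)]; its exponents are distinct if [a >= 2]. *)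
Fixpoint free (a s : nat) : series :=
  match s with O => s0 | S s' => (w ^ s + w ^ a * free a s')%S end.

Lemma free_ge0 a s : sle s0 (free a s).
Proof.
  induction s as [|s IH]; [intros n; apply Rle_refl|].
  intros n. simpl free. unfold sadd. unfold s0 at 1.
  apply Rplus_le_le_0_compat.
  - apply (spow_ge0 w (S s) w_sge0 n).
  - apply smul_ge0; [apply spow_ge0, w_sge0|assumption].
Qed.

Lemma wV_le : sle (w * V) V.
Proof.
  intros n. replace (w * V)%S with (1 + w * V - 1)%S by ring. rewrite <- V_eq.
  unfold ssub, sadd, sopp, s1. destruct n; lra.
Qed.

Lemma wpowV_le k : sle (w ^ k * V) V.
Proof.
  induction k as [|k IH]; simpl.
  - intros n. replace (1 * V)%S with V by ring. lra.
  - intros n. replace (w * w ^ k * V)%S with (w * (w ^ k * V))%S by ring.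
    eapply Rle_trans; [|apply wV_le]. apply smul_le; [apply w_sge0|assumption].
Qed.

(** For ratio [a + 2] the sum is [T^s] times [s] distinct powers of [T^(a+1)], hence at most
    [T^s / (1 - T)]. *)
Lemma free_le a s : sle (free (S (S a)) s) (w ^ s * V).
Proof.
  induction s as [|s IH]; intros n.
  - simpl. apply smul_ge0; [intros [|m]; unfold s0; simpl; lra|apply V_ge0].
  - simpl free.
    apply Rle_trans with ((w ^ S s * (1 + w * (w ^ a * V)))%S n).
    + replace (w ^ S s * (1 + w * (w ^ a * V)))%S
        with (w ^ S s + w ^ S (S a) * (w ^ s * V))%S by (simpl; ring).
      unfold sadd. apply Rplus_le_compat_l.
      apply (smul_le (w ^ S (S a))%S); [apply spow_ge0, w_sge0|assumption].
    + revert n. apply smul_le; [apply spow_ge0, w_sge0|].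
      intros n. rewrite V_eq. rewrite <- V_eq at 1.
      unfold sadd. apply Rplus_le_compat_l.
      revert n. apply smul_le; [apply w_sge0|apply wpowV_le].
Qed.

Lemma free_Binf a s : Binf 1 (free (S (S a)) s).
Proof.
  apply Binf_sle; [apply free_ge0|]. intros n.
  eapply Rle_trans; [apply free_le|]. eapply Rle_trans; [apply wpowV_le|apply V_le_W].
Qed.

(* Letting [f] evolve without error for [s] more steps makes the induction close. *)
Lemma geo_CS_free a F f r s : geo (S (S a)) F f ->
  Binf (F r) (w ^ s * CS f r + free (S (S a)) s * f r)%S.
Proof.
  intros H. revert s. induction r as [|r IH]; intros s.
  - simpl CS. replace (w ^ s * 0 + free (S (S a)) s * f 0%nat)%S
      with (f 0%nat * free (S (S a)) s)%S by ring.
    rewrite <- (Rmult_1_r (F 0%nat)). destruct H as [[_ H] _]. apply H, free_Binf.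
  - replace (w ^ s * CS f (S r) + free (S (S a)) s * f (S r))%S
      with ((w ^ S s * CS f r + free (S (S a)) (S s) * f r) +
            (f (S r) - w ^ S (S a) * f r) * free (S (S a)) s)%S by (simpl; ring).
    replace (F (S r)) with (F r + (F (S r) - F r) * 1) by ring.
    apply Binf_add; [apply IH|]. destruct H as [_ H]. apply H, free_Binf.
Qed.

Lemma geoB_CS a c r f : geoB (S (S a)) c r f -> Binf c (CS f r).
Proof.
  intros (F & H & Hc). eapply Binf_le; [exact Hc|].
  replace (CS f r) with (w ^ 0 * CS f r + free (S (S a)) 0 * f r)%S by (simpl; ring).
  apply geo_CS_free. assumption.
Qed.

(** * Orders of magnitude, uniformly in the lag [h] *)

(** In these names [G] stands for nearly geometric of ratio [T^a], [B] for the multiplier norm, [I]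
    for the supremum norm, and [q] for additional decay in the level. The constants depend neither
    on the lag nor on the level. *)
Definition OG (D : nat -> nat -> Prop) (a p : nat) (f : nat -> nat -> series) : Prop :=
  exists C, 0 <= C /\ forall h J, (1 <= h)%nat -> D h J -> geoB a (C * INR h ^ p) J (f h).

Definition OB (D : nat -> nat -> Prop) (p : nat) (f : nat -> nat -> series) : Prop :=
  exists C, 0 <= C /\ forall h j, (1 <= h)%nat -> D h j -> Bmul (C * INR h ^ p) (f h j).

Definition OI (D : nat -> nat -> Prop) (p : nat) (f : nat -> nat -> series) : Prop :=
  exists C, 0 <= C /\ forall h j, (1 <= h)%nat -> D h j -> Binf (C * INR h ^ p) (f h j).

Definition OBq (p : nat) (f : nat -> nat -> series) : Prop :=
  exists C, 0 <= C /\ forall h j, (1 <= h)%nat -> Bmul (C * INR h ^ p * q ^ j) (f h j).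

Definition OIq (p : nat) (f : nat -> nat -> series) : Prop :=
  exists C, 0 <= C /\ forall h j, (1 <= h)%nat -> Binf (C * INR h ^ p * q ^ j) (f h j).

(* The moments of the profile itself grow with the level; they are needed up to level
   [h] only. *)
Definition upto (h j : nat) : Prop := (j <= h)%nat.
Definition always (h j : nat) : Prop := True.

Lemma INR_pow_ge1 h p : (1 <= h)%nat -> 1 <= INR h ^ p.
Proof. intros H. apply pow_R1_Rle. apply (le_INR 1). assumption. Qed.

Lemma INR_pow_mono h p p' : (1 <= h)%nat -> (p <= p')%nat -> INR h ^ p <= INR h ^ p'.
Proof. intros H Hp. apply Rle_pow; [apply (le_INR 1)|]; assumption. Qed.

Lemma OG_mul D a b p p' f g : OG D a p f -> OG D b p' g ->
  OG D (a + b) (p + p') (fun h j => f h j * g h j)%S.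
Proof.
  intros (C & HC & Hf) (C' & HC' & Hg). exists (C * C'). split; [apply Rmult_le_pos; assumption|].
  intros h J Hh HD. replace (C * C' * INR h ^ (p + p')) with (C * INR h ^ p * (C' * INR h ^ p'))
    by (rewrite pow_add; ring). apply geoB_mul; auto.
Qed.

Lemma OG_add D a p f g : OG D a p f -> OG D a p g -> OG D a p (fun h j => f h j + g h j)%S.
Proof.
  intros (C & HC & Hf) (C' & HC' & Hg). exists (C + C'). split; [lra|].
  intros h J Hh HD. rewrite Rmult_plus_distr_r. apply geoB_add; auto.
Qed.

Lemma OG_opp D a p f : OG D a p f -> OG D a p (fun h j => - f h j)%S.
Proof.
  intros (C & HC & Hf). exists C. split; [assumption|]. intros. apply geoB_opp; auto.
Qed.

Lemma OG_up D a p p' f : (p <= p')%nat -> OG D a p f -> OG D a p' f.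
Proof.
  intros Hp (C & HC & Hf). exists C. split; [assumption|]. intros h J Hh HD.
  eapply geoB_le; [|apply Hf; assumption].
  apply Rmult_le_compat_l; [assumption|apply INR_pow_mono; assumption].
Qed.

Lemma OG_OB D a p f : OG D a p f -> OB D p f.
Proof.
  intros (C & HC & Hf). exists C. split; [assumption|]. intros. eapply geoB_Bmul; eauto.
Qed.

Lemma OB_mul D p p' f g : OB D p f -> OB D p' g -> OB D (p + p') (fun h j => f h j * g h j)%S.
Proof.
  intros (C & HC & Hf) (C' & HC' & Hg). exists (C * C'). split; [apply Rmult_le_pos; assumption|].
  intros h J Hh HD. replace (C * C' * INR h ^ (p + p')) with (C * INR h ^ p * (C' * INR h ^ p'))
    by (rewrite pow_add; ring). apply Bmul_mul; auto.
Qed.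

Lemma OB_add D p f g : OB D p f -> OB D p g -> OB D p (fun h j => f h j + g h j)%S.
Proof.
  intros (C & HC & Hf) (C' & HC' & Hg). exists (C + C'). split; [lra|].
  intros h J Hh HD. rewrite Rmult_plus_distr_r. apply Bmul_add; auto.
Qed.

Lemma OB_opp D p f : OB D p f -> OB D p (fun h j => - f h j)%S.
Proof.
  intros (C & HC & Hf). exists C. split; [assumption|]. intros. apply Bmul_opp; auto.
Qed.

Lemma OB_w D p f : OB D p f -> OB D p (fun h j => w * f h j)%S.
Proof.
  intros (C & HC & Hf). exists C. split; [assumption|]. intros. apply Bmul_wmul; auto.
Qed.

Lemma OB_up D p p' f : (p <= p')%nat -> OB D p f -> OB D p' f.
Proof.
  intros Hp (C & HC & Hf). exists C. split; [assumption|]. intros h J Hh HD.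
  eapply Bmul_le; [|apply Hf; assumption].
  apply Rmult_le_compat_l; [assumption|apply INR_pow_mono; assumption].
Qed.

Lemma OB_OI D p f : OB D p f -> OI D p f.
Proof.
  intros (C & HC & Hf). exists C. split; [assumption|]. intros. apply Bmul_Binf; auto.
Qed.

Lemma OB_mul_OI D p p' f g : OB D p f -> OI D p' g -> OI D (p + p') (fun h j => f h j * g h j)%S.
Proof.
  intros (C & HC & Hf) (C' & HC' & Hg). exists (C * C'). split; [apply Rmult_le_pos; assumption|].
  intros h J Hh HD. replace (C * C' * INR h ^ (p + p')) with (C * INR h ^ p * (C' * INR h ^ p'))
    by (rewrite pow_add; ring). apply Hf; auto.
Qed.

Lemma OI_add D p f g : OI D p f -> OI D p g -> OI D p (fun h j => f h j + g h j)%S.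
Proof.
  intros (C & HC & Hf) (C' & HC' & Hg). exists (C + C'). split; [lra|].
  intros h J Hh HD. rewrite Rmult_plus_distr_r. apply Binf_add; auto.
Qed.

Lemma OI_opp D p f : OI D p f -> OI D p (fun h j => - f h j)%S.
Proof.
  intros (C & HC & Hf). exists C. split; [assumption|]. intros. apply Binf_opp; auto.
Qed.

Lemma OI_up D p p' f : (p <= p')%nat -> OI D p f -> OI D p' f.
Proof.
  intros Hp (C & HC & Hf). exists C. split; [assumption|]. intros h J Hh HD.
  eapply Binf_le; [|apply Hf; assumption].
  apply Rmult_le_compat_l; [assumption|apply INR_pow_mono; assumption].
Qed.

Lemma OBq_add p f g : OBq p f -> OBq p g -> OBq p (fun h j => f h j + g h j)%S.
Proof.
  intros (C & HC & Hf) (C' & HC' & Hg). exists (C + C'). split; [lra|].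
  intros h j Hh. rewrite !Rmult_plus_distr_r. apply Bmul_add; auto.
Qed.

Lemma OBq_opp p f : OBq p f -> OBq p (fun h j => - f h j)%S.
Proof.
  intros (C & HC & Hf). exists C. split; [assumption|]. intros. apply Bmul_opp; auto.
Qed.

Lemma OBq_up p p' f : (p <= p')%nat -> OBq p f -> OBq p' f.
Proof.
  intros Hp (C & HC & Hf). exists C. split; [assumption|]. intros h J Hh.
  eapply Bmul_le; [|apply Hf; assumption].
  apply Rmult_le_compat_r; [apply q_pow_ge0|].
  apply Rmult_le_compat_l; [assumption|apply INR_pow_mono; assumption].
Qed.

Lemma OBq_OB D p f : OBq p f -> OB D p f.
Proof.
  intros (C & HC & Hf). exists C. split; [assumption|]. intros h j Hh _.
  eapply Bmul_le; [|apply Hf; assumption].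
  rewrite <- (Rmult_1_r (C * INR h ^ p)) at 2. apply Rmult_le_compat_l.
  - apply Rmult_le_pos; [assumption|]. pose proof (INR_pow_ge1 h p Hh). lra.
  - rewrite <- (pow1 j). apply pow_incr. unfold q. lra.
Qed.

Lemma OBq_OIq p f : OBq p f -> OIq p f.
Proof.
  intros (C & HC & Hf). exists C. split; [assumption|]. intros. apply Bmul_Binf; auto.
Qed.

Lemma OB_mul_OBq p p' f g :
  OB always p f -> OBq p' g -> OBq (p + p') (fun h j => f h j * g h j)%S.
Proof.
  intros (C & HC & Hf) (C' & HC' & Hg). exists (C * C'). split; [apply Rmult_le_pos; assumption|].
  intros h j Hh. replace (C * C' * INR h ^ (p + p') * q ^ j)
    with (C * INR h ^ p * (C' * INR h ^ p' * q ^ j)) by (rewrite pow_add; ring).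
  apply Bmul_mul; auto. apply Hf; [assumption|exact I].
Qed.

Lemma OBq_mul_OI p p' f g :
  OBq p f -> OI always p' g -> OIq (p + p') (fun h j => f h j * g h j)%S.
Proof.
  intros (C & HC & Hf) (C' & HC' & Hg). exists (C * C'). split; [apply Rmult_le_pos; assumption|].
  intros h j Hh. replace (C * C' * INR h ^ (p + p') * q ^ j)
    with (C * INR h ^ p * q ^ j * (C' * INR h ^ p')) by (rewrite pow_add; ring).
  apply Hf; [assumption|]. apply Hg; [assumption|exact I].
Qed.

Lemma q_sum_le J : lsum (fun j => q ^ j) (seq 0 J) <= 100.
Proof. eapply Rle_trans; [apply (geom_sum_le q J); unfold q; lra|unfold q; lra]. Qed.

Lemma OG_CS D a p f : OG D (S (S a)) p f -> OI D p (fun h r => CS (f h) r).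
Proof.
  intros (C & HC & Hf). exists C. split; [assumption|]. intros. eapply geoB_CS; eauto.
Qed.

Lemma OIq_CS D p f : OIq p f -> OI D p (fun h r => CS (f h) r).
Proof.
  intros (C & HC & Hf). exists (C * 100). split; [lra|]. intros h r Hh _.
  eapply Binf_le; [|apply CS_Binf; intros; apply Hf; assumption].
  rewrite lsum_scal. pose proof (q_sum_le r).
  replace (C * 100 * INR h ^ p) with (C * INR h ^ p * 100) by ring.
  apply Rmult_le_compat_l; [|assumption].
  apply Rmult_le_pos; [assumption|]. pose proof (INR_pow_ge1 h p Hh). lra.
Qed.

Lemma OG_intro D a p f :
  OB always p (fun h _ => f h 0%nat) ->
  OBq p (fun h j => f h (S j) - w ^ a * f h j)%S -> OG D a p f.
Proof.
  intros (C & HC & H0) (C' & HC' & H). exists (C + C' * 100). split; [lra|].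
  intros h J Hh _. eapply geoB_le; [|apply geoB_intro; [apply (H0 h 0%nat Hh I)|intros; apply H; assumption]].
  rewrite lsum_scal. pose proof (q_sum_le J). pose proof (INR_pow_ge1 h p Hh).
  rewrite Rmult_plus_distr_r. apply Rplus_le_compat_l.
  replace (C' * 100 * INR h ^ p) with (C' * INR h ^ p * 100) by ring.
  apply Rmult_le_compat_l; [apply Rmult_le_pos; lra|assumption].
Qed.

(** At most [h] steps with errors of order [h^p] each cost one more power of [h]. *)
Lemma OG_intro_upto a p f :
  OB always p (fun h _ => f h 0%nat) ->
  (exists C, 0 <= C /\ forall h j, (1 <= h)%nat ->
     Bmul (C * (1 + INR j) ^ p) (f h (S j) - w ^ a * f h j)%S) -> OG upto a (S p) f.
Proof.
  intros (C & HC & H0) (C' & HC' & H). exists (C + C'). split; [lra|].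
  intros h J Hh HJ. unfold upto in HJ.
  eapply geoB_le; [|apply geoB_intro; [apply (H0 h 0%nat Hh I)|intros; apply H; assumption]].
  pose proof (INR_pow_mono h p (S p) Hh ltac:(lia)).
  assert (lsum (fun j => C' * (1 + INR j) ^ p) (seq 0 J) <= C' * INR h ^ S p).
  { apply Rle_trans with (lsum (fun _ => C' * INR h ^ p) (seq 0 J)).
    - apply lsum_le. intros j Hj. apply in_seq in Hj. apply Rmult_le_compat_l; [assumption|].
      apply pow_incr. split; [pose proof (pos_INR j); lra|].
      rewrite Rplus_comm, <- S_INR. apply le_INR. lia.
    - rewrite lsum_const, length_seq. apply le_INR in HJ. simpl pow.
      assert (0 <= C' * INR h ^ p).
      { apply Rmult_le_pos; [assumption|]. pose proof (INR_pow_ge1 h p Hh). lra. }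
      nra. }
  rewrite Rmult_plus_distr_r. apply Rplus_le_compat; [|assumption].
  apply Rmult_le_compat_l; assumption.
Qed.

Lemma OG_scal D a p b x f : Bmul b x -> OG D a p f -> OG D a p (fun h j => x * f h j)%S.
Proof.
  intros Hx (C & HC & Hf). pose proof (Bmul_ge0 _ _ Hx).
  exists (b * C). split; [apply Rmult_le_pos; assumption|].
  intros h J Hh HD. rewrite Rmult_assoc. apply geoB_scal; auto.
Qed.

Lemma OB_scal D p b x f : Bmul b x -> OB D p f -> OB D p (fun h j => x * f h j)%S.
Proof.
  intros Hx (C & HC & Hf). pose proof (Bmul_ge0 _ _ Hx).
  exists (b * C). split; [apply Rmult_le_pos; assumption|].
  intros h J Hh HD. rewrite Rmult_assoc. apply Bmul_mul; auto.
Qed.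

Lemma OI_scal D p b x f : Bmul b x -> OI D p f -> OI D p (fun h j => x * f h j)%S.
Proof.
  intros Hx (C & HC & Hf). pose proof (Bmul_ge0 _ _ Hx).
  exists (b * C). split; [apply Rmult_le_pos; assumption|].
  intros h J Hh HD. rewrite Rmult_assoc. apply Hx; auto.
Qed.

Lemma OB_const D p b x : Bmul b x -> OB D p (fun _ _ => x).
Proof.
  intros Hx. pose proof (Bmul_ge0 _ _ Hx). exists b. split; [assumption|].
  intros h j Hh _. eapply Bmul_le; [|exact Hx].
  pose proof (INR_pow_ge1 h p Hh). rewrite <- (Rmult_1_r b) at 1.
  apply Rmult_le_compat_l; assumption.
Qed.

Lemma OBq_S p f : OBq p f -> OBq p (fun h j => f h (S j)).
Proof.
  intros (C & HC & Hf). exists C. split; [assumption|]. intros h j Hh.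
  eapply Bmul_le; [|apply Hf; assumption].
  apply Rmult_le_compat_l.
  - apply Rmult_le_pos; [assumption|]. pose proof (INR_pow_ge1 h p Hh). lra.
  - simpl. pose proof (q_pow_ge0 j). unfold q at 1. lra.
Qed.

Lemma OB_S p f : OB always p f -> OB always p (fun h j => f h (S j)).
Proof.
  intros (C & HC & Hf). exists C. split; [assumption|]. intros. apply Hf; [assumption|exact I].
Qed.

Lemma OB_at_0 p f : OB always p f -> OB always p (fun h _ => f h 0%nat).
Proof.
  intros (C & HC & Hf). exists C. split; [assumption|]. intros. apply Hf; [assumption|exact I].
Qed.

Lemma OB_upto_diag p f : OB upto p f -> OB always p (fun h _ => f h h).
Proof.
  intros (C & HC & Hf). exists C. split; [assumption|]. intros. apply Hf; [assumption|].
  unfold upto. lia.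
Qed.

(** As [x] does not involve the lag, level [j] may be treated with lag [j + 1], which turns powers
    of the lag into powers of [1 + j]. *)
Lemma OB_upto_growth p x : OB upto p (fun _ j => x j) ->
  exists C, 0 <= C /\ forall h j : nat, (1 <= h)%nat -> Bmul (C * (1 + INR j) ^ p) (x j).
Proof.
  intros (C & HC & Hf). exists C. split; [assumption|]. intros _ j _.
  replace (1 + INR j) with (INR (S j)) by (rewrite S_INR; ring).
  apply (Hf (S j) j); [lia|]. unfold upto. lia.
Qed.

(** * Moments of the profile *)

(** What both the levels and their differences provide. Vanishing on small trees is the source of
    the decay of [Rem]. *)
Definition profile_like (X : nat -> nat -> tree -> R) : Prop :=
  forall h, (1 <= h)%nat ->
    (forall j, lifts (X h j) (X h (S j))) /\
    (forall j t, Rabs (X h j t) <= INR (tsize t)) /\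
    (forall j t, (tsize t <= j)%nat -> X h j t = 0).

Lemma Rem_OBq X a : profile_like X -> (a <= 3)%nat -> OBq 0 (fun h j => Rem (X h j) a).
Proof.
  intros HX Ha. destruct Rem_bound as (C & HC & H). exists C. split; [assumption|].
  intros h j Hh. simpl pow. rewrite Rmult_1_r.
  destruct (HX h Hh) as (_ & H1 & H2). apply H; auto.
Qed.

Lemma Cmom0_step X Y : lifts X Y -> Cmom Y 0 = (w * Cmom X 0 + Rem Y 0)%S.
Proof. intros H. rewrite (Cmom_split Y), (Tmom1_lifts X Y H). reflexivity. Qed.

Lemma Cmom1_step X Y : lifts X Y -> Cmom Y 1 = (w * (Cmom X 1 + Cmom X 0 * Cmom X 0) + Rem Y 1)%S.
Proof. intros H. rewrite (Cmom_split Y), (Tmom2_lifts X Y H). reflexivity. Qed.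

Lemma Cmom2_step X Y : lifts X Y ->
  Cmom Y 2 = (w * (Cmom X 2 + ((1 + 1 + 1) * (Cmom X 0 * Cmom X 1) + Cmom X 0 * Cmom X 0 * Cmom X 0)) + Rem Y 2)%S.
Proof. intros H. rewrite (Cmom_split Y), (Tmom3_lifts X Y H). ring. Qed.

Lemma Tmom4_step X Y : lifts X Y ->
  Tmom Y 4 = (w * (Tmom X 4 + (Rem X 3 + (1 + 1 + 1 + 1) * (Cmom X 0 * Cmom X 2)
    + (1 + 1 + 1) * (Cmom X 1 * Cmom X 1)
    + (1 + 1 + 1 + 1 + 1 + 1) * (Cmom X 0 * Cmom X 0 * Cmom X 1) + Cmom X 0 * Cmom X 0 * Cmom X 0 * Cmom X 0)))%S.
Proof. intros H. rewrite (Tmom4_lifts X Y H), (Cmom_split X 3). ring. Qed.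

Lemma Bmul_2 : Bmul 2 (1 + 1).
Proof. replace 2 with (1 + 1) by ring. apply Bmul_add; apply Bmul_1. Qed.

Lemma Bmul_3 : Bmul 3 (1 + 1 + 1).
Proof. replace 3 with (2 + 1) by ring. apply Bmul_add; [apply Bmul_2|apply Bmul_1]. Qed.

Lemma Bmul_4 : Bmul 4 (1 + 1 + 1 + 1).
Proof. replace 4 with (3 + 1) by ring. apply Bmul_add; [apply Bmul_3|apply Bmul_1]. Qed.

Lemma Bmul_6 : Bmul 6 (1 + 1 + 1 + 1 + 1 + 1).
Proof.
  replace 6 with (4 + 1 + 1) by ring. repeat (apply Bmul_add; [|apply Bmul_1]). apply Bmul_4.
Qed.

Lemma Cmom0_OG D X : profile_like X ->
  OB always 0 (fun h _ => Tmom (X h 0%nat) 1) -> OG D 1 0 (fun h j => Cmom (X h j) 0).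
Proof.
  intros HX H0. pose proof (Rem_OBq X 0 HX ltac:(lia)) as HR.
  apply OG_intro.
  - destruct (OB_add always 0 _ _ H0 (OB_at_0 _ _ (OBq_OB always _ _ HR))) as (C & HC & H).
    exists C. split; [assumption|]. intros h j Hh HD. rewrite Cmom_split. exact (H h j Hh HD).
  - destruct (OBq_S _ _ HR) as (C & HC & H). exists C. split; [assumption|].
    intros h j Hh. rewrite (Cmom0_step (X h j)) by apply HX, Hh.
    replace (w * Cmom (X h j) 0 + Rem (X h (S j)) 0 - w ^ 1 * Cmom (X h j) 0)%S
      with (Rem (X h (S j)) 0) by (simpl; ring). auto.
Qed.

Definition Lv (k : nat) (t : tree) : R := INR (level t k).

Lemma Lv_lifts k : lifts (Lv k) (Lv (S k)).
Proof.
  intros M. unfold Lv. rewrite level_Node_S.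
  induction M as [|t M IH]; [reflexivity|]. simpl. rewrite plus_INR, IH. reflexivity.
Qed.

Lemma list_sum_map_le {T} (f g : T -> nat) l :
  (forall x, In x l -> (f x <= g x)%nat) -> (list_sum (map f l) <= list_sum (map g l))%nat.
Proof.
  induction l as [|x l IH]; intros H; simpl; [lia|].
  pose proof (H x (or_introl eq_refl)). specialize (IH (fun y Hy => H y (or_intror Hy))). lia.
Qed.

Lemma list_sum_map_add {T} (f g : T -> nat) l :
  list_sum (map (fun x => f x + g x)%nat l) = (list_sum (map f l) + list_sum (map g l))%nat.
Proof. induction l as [|x l IH]; simpl; lia. Qed.

Lemma level_le t k : (level t k <= tsize t)%nat.
Proof.
  revert k. induction t as [cs IH] using tree_nested_ind. intros [|k].
  - rewrite level_0. apply tsize_pos.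
  - rewrite level_Node_S, tsize_Node. apply Nat.le_trans with (list_sum (map tsize cs)); [|lia].
    apply list_sum_map_le. auto.
Qed.

Lemma level_pair_le t k l : (k < l)%nat -> (level t k + level t l <= tsize t)%nat.
Proof.
  revert k l. induction t as [cs IH] using tree_nested_ind. intros k [|l] H; [lia|].
  rewrite tsize_Node. destruct k as [|k].
  - rewrite level_0, level_Node_S. apply le_n_S. apply list_sum_map_le.
    intros. apply level_le.
  - rewrite !level_Node_S, <- list_sum_map_add.
    apply Nat.le_trans with (list_sum (map tsize cs)); [|lia].
    apply list_sum_map_le. intros c Hc. apply IH; [assumption|lia].
Qed.

Lemma level_eq_0 t k : (tsize t <= k)%nat -> level t k = 0%nat.
Proof.
  revert k. induction t as [cs IH] using tree_nested_ind. rewrite tsize_Node.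
  intros [|k] H; [lia|]. rewrite level_Node_S.
  assert (Hc : forall c, In c cs -> level c k = 0%nat).
  { intros c Hc. apply IH; [assumption|]. apply (list_sum_In_le tsize) in Hc. lia. }
  clear - Hc. induction cs as [|c cs IHcs]; [reflexivity|].
  simpl. rewrite (Hc c (or_introl eq_refl)), IHcs; [reflexivity|].
  intros; apply Hc; right; assumption.
Qed.

Lemma Lv_profile : profile_like (fun _ j => Lv j).
Proof.
  intros h _. split; [|split].
  - intros j. apply Lv_lifts.
  - intros j t. unfold Lv. rewrite Rabs_pos_eq by apply pos_INR. apply le_INR, level_le.
  - intros j t H. unfold Lv. rewrite level_eq_0 by assumption. reflexivity.
Qed.

Definition Xd (h j : nat) (t : tree) : R := Lv j t - Lv (j + h) t.

Lemma Xd_profile : profile_like Xd.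
Proof.
  intros h Hh. split; [|split].
  - intros j M. unfold Xd. rewrite lsum_minus, <- (Lv_lifts j M), <- (Lv_lifts (j + h) M).
    reflexivity.
  - intros j t. unfold Xd, Lv. pose proof (level_pair_le t j (j + h) ltac:(lia)) as H.
    apply le_INR in H. rewrite plus_INR in H.
    pose proof (pos_INR (level t j)). pose proof (pos_INR (level t (j + h))).
    apply Rabs_le. lra.
  - intros j t H. unfold Xd, Lv. rewrite !level_eq_0 by lia. ring.
Qed.

Lemma Tmom_Lv_0 a : Tmom (Lv 0) a = w.
Proof.
  extensionality n. unfold Tmom, w, Lv. rewrite (lsum_ext _ (fun _ => 1)).
  - rewrite lsum_const. ring.
  - intros t _. rewrite level_0. apply pow1.
Qed.

Lemma Lv_K0 D : OG D 1 0 (fun _ j => Cmom (Lv j) 0).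
Proof.
  apply (Cmom0_OG D (fun _ j => Lv j)); [apply Lv_profile|].
  rewrite Tmom_Lv_0. apply OB_const with 1, Bmul_w.
Qed.

Lemma Lv_Rem a : (a <= 3)%nat -> OBq 0 (fun _ j => Rem (Lv j) a).
Proof. apply (Rem_OBq (fun _ j => Lv j) a Lv_profile). Qed.

Lemma Lv_K_0 p a : (a <= 3)%nat -> OB always p (fun _ _ => Cmom (Lv 0) a).
Proof.
  intros Ha. apply (OB_up always 0 p); [lia|].
  rewrite Cmom_split, Tmom_Lv_0.
  apply (OB_add always 0 (fun _ _ => w) (fun _ _ => Rem (Lv 0) a)).
  - apply OB_const with 1, Bmul_w.
  - apply (OB_at_0 0 (fun _ j => Rem (Lv j) a)). apply OBq_OB, Lv_Rem, Ha.
Qed.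

(** Each level adds an error [T k_1^2] plus a remainder, both of order [1], so up to level [h] the
    total is of order [h]. *)
Lemma Lv_K1 : OG upto 1 1 (fun _ j => Cmom (Lv j) 1).
Proof.
  apply OG_intro_upto; [apply Lv_K_0; lia|].
  destruct (OB_add always 0 _ _
    (OB_w always _ _ (OB_mul always 0 0 _ _ (OG_OB _ _ _ _ (Lv_K0 always)) (OG_OB _ _ _ _ (Lv_K0 always))))
    (OBq_OB always _ _ (OBq_S _ _ (Lv_Rem 1 ltac:(lia))))) as (C & HC & H).
  exists C. split; [assumption|]. intros h j Hh.
  rewrite (Cmom1_step (Lv j)) by apply Lv_lifts.
  replace (w * (Cmom (Lv j) 1 + Cmom (Lv j) 0 * Cmom (Lv j) 0) + Rem (Lv (S j)) 1 - w ^ 1 * Cmom (Lv j) 1)%S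
    with (w * (Cmom (Lv j) 0 * Cmom (Lv j) 0) + Rem (Lv (S j)) 1)%S by (simpl; ring).
  simpl pow. specialize (H h j Hh I). simpl pow in H. exact H.
Qed.

(** The errors at level [j] now contain [k_1 k_2] and are of order [1 + j], whence [h^2] up to level
    [h]. *)
Lemma Lv_K2 : OG upto 1 2 (fun _ j => Cmom (Lv j) 2).
Proof.
  apply OG_intro_upto; [apply Lv_K_0; lia|].
  pose proof (OG_OB _ _ _ _ (Lv_K0 upto)) as H0. pose proof (OG_OB _ _ _ _ Lv_K1) as H1.
  pose proof (OB_add upto 1 _ _ (OB_w upto 1 _ (OB_add upto 1 _ _
     (OB_scal upto _ _ _ _ Bmul_3 (OB_mul upto 0 1 _ _ H0 H1))
     (OB_up upto 0 1 _ ltac:(lia) (OB_mul upto 0 0 _ _ (OB_mul upto 0 0 _ _ H0 H0) H0))))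
    (OB_up upto 0 1 _ ltac:(lia) (OBq_OB upto _ _ (OBq_S _ _ (Lv_Rem 2 ltac:(lia)))))) as HE.
  cbv beta in HE. apply OB_upto_growth in HE. destruct HE as (C & HC & H).
  exists C. split; [assumption|]. intros h j Hh.
  rewrite (Cmom2_step (Lv j)) by apply Lv_lifts.
  match goal with |- Bmul _ ?x => match type of (H h j Hh) with Bmul _ ?y =>
    replace x with y by (simpl; ring) end end.
  exact (H h j Hh).
Qed.

Lemma Lv_A_OB p a : (a <= 3)%nat -> OG upto 1 p (fun _ j => Cmom (Lv j) a) ->
  OB always p (fun h _ => Tmom (Lv h) (S a)).
Proof.
  intros Ha HK.
  pose proof (OB_upto_diag p _ (OB_add upto p _ _ (OG_OB _ _ _ _ HK)
    (OB_opp upto p _ (OB_up upto 0 p _ ltac:(lia) (OBq_OB upto 0 _ (Lv_Rem a Ha)))))) as (C & HC & H).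
  exists C. split; [assumption|]. intros h j Hh HD.
  replace (Tmom (Lv h) (S a)) with (Cmom (Lv h) a + - Rem (Lv h) a)%S by (rewrite Cmom_split; ring).
  exact (H h j Hh HD).
Qed.

(** Adding sources of order [h^2] over [h] levels would give [h^3]. In the supremum norm they do not
    accumulate, because [OG_CS] applies to ratios from [T^2] on; so the order stays [h^2]. *)
Lemma Lv_A4 : OI always 2 (fun h _ => Tmom (Lv h) 4).
Proof.
  assert (HI : OI upto 2 (fun _ r => Tmom (Lv r) 4)).
  { pose proof (Lv_K0 upto) as H0. pose proof Lv_K1 as H1. pose proof Lv_K2 as H2.
    pose proof (OI_add _ _ _ _ (OI_add _ _ _ _ (OI_add _ _ _ _ (OI_add _ _ _ _
      (OI_up upto 0 2 _ ltac:(lia) (OIq_CS upto _ _ (OBq_OIq _ _ (Lv_Rem 3 ltac:(lia)))))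
      (OI_scal _ _ _ _ _ Bmul_4 (OG_CS upto 0 2 _ (OG_mul _ 1 1 0 2 _ _ H0 H2))))
      (OI_scal _ _ _ _ _ Bmul_3 (OG_CS upto 0 2 _ (OG_mul _ 1 1 1 1 _ _ H1 H1))))
      (OI_scal _ _ _ _ _ Bmul_6 (OI_up _ 1 2 _ ltac:(lia) (OG_CS upto 1 1 _ (OG_mul _ 2 1 0 1 _ _ (OG_mul _ 1 1 0 0 _ _ H0 H0) H1)))))
      (OI_up _ 0 2 _ ltac:(lia) (OG_CS upto 2 0 _ (OG_mul _ 3 1 0 0 _ _ (OG_mul _ 2 1 0 0 _ _ (OG_mul _ 1 1 0 0 _ _ H0 H0) H0) H0)))) as HS.
    pose proof (OI_up upto 0 2 _ ltac:(lia) (OB_OI upto 0 (fun _ r => w ^ r * w)%S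
      ltac:(exists 1; split; [lra|]; intros h r _ _; rewrite Rmult_1_l, <- (Rmult_1_l (INR h ^ 0));
            apply Bmul_mul; [apply Bmul_wpow|apply Bmul_w]))) as HW.
    destruct (OI_add _ _ _ _ HW HS) as (C & HC & H). exists C. split; [assumption|].
    intros h r Hh HD. specialize (H h r Hh HD).
    rewrite (CS_solve (fun r => Tmom (Lv r) 4) _ r (fun j => Tmom4_step _ _ (Lv_lifts j))).
    rewrite Tmom_Lv_0, !CS_add, !CS_scal. exact H. }
  destruct HI as (C & HC & H). exists C. split; [assumption|].
  intros h _ Hh _. apply H; [assumption|]. unfold upto. lia.
Qed.

(** * Moments of the increments of the profile *)

(** At level [0] the increment is [1 - L(h)]: the moments of the profile at level [h] are the
    initial values of the recursions in [j]. *)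
Lemma Xd_0 h t : Xd h 0 t = 1 - Lv h t.
Proof. unfold Xd, Lv. rewrite level_0. reflexivity. Qed.

Lemma Tmom_Xd_0_1 h : Tmom (Xd h 0) 1 = (w - Tmom (Lv h) 1)%S.
Proof.
  extensionality n. rewrite <- (Tmom_0 (Lv h)). unfold ssub, sadd, sopp, Tmom.
  fold (lsum (fun t => Lv h t ^ 0) (U n) - lsum (fun t => Lv h t ^ 1) (U n)).
  rewrite <- lsum_minus. apply lsum_ext. intros t _. rewrite Xd_0. ring.
Qed.

Lemma Tmom_Xd_0_2 h : Tmom (Xd h 0) 2 = (w - Tmom (Lv h) 1 - Tmom (Lv h) 1 + Tmom (Lv h) 2)%S.
Proof.
  extensionality n. rewrite <- (Tmom_0 (Lv h)). unfold ssub, sadd, sopp, Tmom.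
  rewrite (lsum_ext _ (fun t => Lv h t ^ 0 + (-2) * Lv h t ^ 1 + Lv h t ^ 2))
    by (intros t _; rewrite Xd_0; ring).
  rewrite !lsum_plus, lsum_scal. ring.
Qed.

Lemma Tmom_Xd_0_3 h :
  Tmom (Xd h 0) 3 = (w - (1 + 1 + 1) * Tmom (Lv h) 1 + (1 + 1 + 1) * Tmom (Lv h) 2 - Tmom (Lv h) 3)%S.
Proof.
  (* A numeral factor would unfold to a Cauchy product; repeated summands unfold to sums of
     reals. *)
  replace (w - (1 + 1 + 1) * Tmom (Lv h) 1 + (1 + 1 + 1) * Tmom (Lv h) 2 - Tmom (Lv h) 3)%S
    with (w - Tmom (Lv h) 1 - Tmom (Lv h) 1 - Tmom (Lv h) 1 + Tmom (Lv h) 2 + Tmom (Lv h) 2 + Tmom (Lv h) 2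
          - Tmom (Lv h) 3)%S by ring.
  extensionality n. rewrite <- (Tmom_0 (Lv h)). unfold ssub, sadd, sopp, Tmom.
  rewrite (lsum_ext _ (fun t => Lv h t ^ 0 + (-3) * Lv h t ^ 1 + 3 * Lv h t ^ 2 + (-1) * Lv h t ^ 3))
    by (intros t _; rewrite Xd_0; ring).
  rewrite !lsum_plus, !lsum_scal. ring.
Qed.

Lemma Tmom_Xd_0_4 h :
  Tmom (Xd h 0) 4 = (w - (1 + 1 + 1 + 1) * Tmom (Lv h) 1 + (1 + 1 + 1 + 1 + 1 + 1) * Tmom (Lv h) 2
                  - (1 + 1 + 1 + 1) * Tmom (Lv h) 3 + Tmom (Lv h) 4)%S.
Proof.
  replace (w - (1 + 1 + 1 + 1) * Tmom (Lv h) 1 + (1 + 1 + 1 + 1 + 1 + 1) * Tmom (Lv h) 2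
           - (1 + 1 + 1 + 1) * Tmom (Lv h) 3 + Tmom (Lv h) 4)%S
    with (w - Tmom (Lv h) 1 - Tmom (Lv h) 1 - Tmom (Lv h) 1 - Tmom (Lv h) 1
      + Tmom (Lv h) 2 + Tmom (Lv h) 2 + Tmom (Lv h) 2 + Tmom (Lv h) 2 + Tmom (Lv h) 2 + Tmom (Lv h) 2
      - Tmom (Lv h) 3 - Tmom (Lv h) 3 - Tmom (Lv h) 3 - Tmom (Lv h) 3 + Tmom (Lv h) 4)%S by ring.
  extensionality n. rewrite <- (Tmom_0 (Lv h)). unfold ssub, sadd, sopp, Tmom.
  rewrite (lsum_ext _ (fun t => Lv h t ^ 0 + (-4) * Lv h t ^ 1 + 6 * Lv h t ^ 2
                                + (-4) * Lv h t ^ 3 + Lv h t ^ 4))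
    by (intros t _; rewrite Xd_0; ring).
  rewrite !lsum_plus, !lsum_scal. ring.
Qed.

Lemma w_OB p : OB always p (fun _ _ => w).
Proof. apply OB_const with 1, Bmul_w. Qed.

Lemma Xd_A1_0 : OB always 0 (fun h _ => Tmom (Xd h 0) 1).
Proof.
  pose proof (Lv_A_OB 0 0 ltac:(lia) (Lv_K0 upto)) as H1.
  destruct (OB_add _ _ _ _ (w_OB 0) (OB_opp _ _ _ H1)) as (C & HC & H).
  exists C. split; [assumption|]. intros h j Hh HD. rewrite Tmom_Xd_0_1. exact (H h j Hh HD).
Qed.

Lemma Xd_A2_0 : OB always 1 (fun h _ => Tmom (Xd h 0) 2).
Proof.
  pose proof (OB_up _ 0 1 _ ltac:(lia) (Lv_A_OB 0 0 ltac:(lia) (Lv_K0 upto))) as H1.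
  pose proof (Lv_A_OB 1 1 ltac:(lia) Lv_K1) as H2.
  destruct (OB_add _ _ _ _ (OB_add _ _ _ _ (OB_add _ _ _ _ (w_OB 1) (OB_opp _ _ _ H1))
    (OB_opp _ _ _ H1)) H2) as (C & HC & H).
  exists C. split; [assumption|]. intros h j Hh HD. rewrite Tmom_Xd_0_2. exact (H h j Hh HD).
Qed.

Lemma Xd_A3_0 : OB always 2 (fun h _ => Tmom (Xd h 0) 3).
Proof.
  pose proof (OB_up _ 0 2 _ ltac:(lia) (Lv_A_OB 0 0 ltac:(lia) (Lv_K0 upto))) as H1.
  pose proof (OB_up _ 1 2 _ ltac:(lia) (Lv_A_OB 1 1 ltac:(lia) Lv_K1)) as H2.
  pose proof (Lv_A_OB 2 2 ltac:(lia) Lv_K2) as H3.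
  destruct (OB_add _ _ _ _ (OB_add _ _ _ _ (OB_add _ _ _ _ (w_OB 2)
    (OB_opp _ _ _ (OB_scal _ _ _ _ _ Bmul_3 H1))) (OB_scal _ _ _ _ _ Bmul_3 H2))
    (OB_opp _ _ _ H3)) as (C & HC & H).
  exists C. split; [assumption|]. intros h j Hh HD. rewrite Tmom_Xd_0_3. exact (H h j Hh HD).
Qed.

Lemma Xd_A4_0 : OI always 2 (fun h _ => Tmom (Xd h 0) 4).
Proof.
  pose proof (OB_up _ 0 2 _ ltac:(lia) (Lv_A_OB 0 0 ltac:(lia) (Lv_K0 upto))) as H1.
  pose proof (OB_up _ 1 2 _ ltac:(lia) (Lv_A_OB 1 1 ltac:(lia) Lv_K1)) as H2.
  pose proof (Lv_A_OB 2 2 ltac:(lia) Lv_K2) as H3.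
  destruct (OI_add _ _ _ _ (OB_OI _ _ _ (OB_add _ _ _ _ (OB_add _ _ _ _ (OB_add _ _ _ _ (w_OB 2)
    (OB_opp _ _ _ (OB_scal _ _ _ _ _ Bmul_4 H1))) (OB_scal _ _ _ _ _ Bmul_6 H2))
    (OB_opp _ _ _ (OB_scal _ _ _ _ _ Bmul_4 H3)))) Lv_A4) as (C & HC & H).
  exists C. split; [assumption|]. intros h j Hh HD. rewrite Tmom_Xd_0_4. exact (H h j Hh HD).
Qed.

(** * Correctors that make the lower moments of the increments nearly geometric *)

Definition k1 (h j : nat) : series := Cmom (Xd h j) 0.
Definition k2 (h j : nat) : series := Cmom (Xd h j) 1.
Definition k3 (h j : nat) : series := Cmom (Xd h j) 2.

Lemma Xd_lifts h j : (1 <= h)%nat -> lifts (Xd h j) (Xd h (S j)).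
Proof. intros H. apply (Xd_profile h H). Qed.

Lemma Xd_Rem a : (a <= 3)%nat -> OBq 0 (fun h j => Rem (Xd h j) a).
Proof. apply Rem_OBq, Xd_profile. Qed.

Lemma Xd_K_0 p a : (a <= 3)%nat -> OB always p (fun h _ => Tmom (Xd h 0) (S a)) ->
  OB always p (fun h _ => Cmom (Xd h 0) a).
Proof.
  intros Ha HA.
  destruct (OB_add _ _ _ _ HA (OB_up always 0 p _ ltac:(lia)
    (OB_at_0 0 _ (OBq_OB always 0 _ (Xd_Rem a Ha))))) as (C & HC & H).
  exists C. split; [assumption|]. intros h j Hh HD. rewrite Cmom_split. exact (H h j Hh HD).
Qed.

Lemma k1_OG : OG always 1 0 k1.
Proof. apply Cmom0_OG; [apply Xd_profile|apply Xd_A1_0]. Qed.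

Lemma k1_err : OBq 0 (fun h j => k1 h (S j) - w ^ 1 * k1 h j)%S.
Proof.
  destruct (OBq_S _ _ (Xd_Rem 0 ltac:(lia))) as (C & HC & H).
  exists C. split; [assumption|]. intros h j Hh. unfold k1.
  rewrite (Cmom0_step (Xd h j)) by (apply Xd_lifts, Hh).
  replace (w * Cmom (Xd h j) 0 + Rem (Xd h (S j)) 0 - w ^ 1 * Cmom (Xd h j) 0)%S
    with (Rem (Xd h (S j)) 0) by (simpl; ring). auto.
Qed.

(** The quotient [(1 - T^h) / (1 - T)]. Its multiplier norm, at most [h], is where powers of [h]
    enter [u1]. *)
Fixpoint brk (h : nat) : series :=
  match h with O => s0 | S h' => (brk h' + w ^ h')%S end.

Lemma brk_eq h : ((1 - w) * brk h = 1 - w ^ h)%S.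
Proof.
  induction h as [|h IH]; simpl; [ring|].
  replace ((1 - w) * (brk h + w ^ h))%S with ((1 - w) * brk h + (1 - w) * w ^ h)%S by ring.
  rewrite IH. ring.
Qed.

Lemma brk_Bmul h : Bmul (INR h) (brk h).
Proof.
  induction h as [|h IH]; [apply Bmul_0; simpl; lra|].
  rewrite S_INR. simpl brk. apply Bmul_add; [assumption|apply Bmul_wpow].
Qed.

(* [k1 = (1 - T) u1 - d1]: the factor [1 - T] carries the cancellation between the
   levels [j] and [j + h], the rest being negligible. *)
Definition u1 (h j : nat) : series := (brk h * Cmom (Lv j) 0)%S.
Definition d1 (h j : nat) : series := (Cmom (Lv (j + h)) 0 - w ^ h * Cmom (Lv j) 0)%S.

Lemma Cmom0_sub X Y : Cmom (fun t => X t - Y t) 0 = (Cmom X 0 - Cmom Y 0)%S.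
Proof.
  extensionality m. unfold Cmom, ssub, sadd, sopp.
  change (?a + - ?b) with (a - b). rewrite <- lsum_minus. apply lsum_ext. intros k _.
  rewrite <- lsum_minus. apply lsum_ext. intros d _.
  destruct (k * d =? m)%nat; [|ring]. rewrite <- Rmult_minus_distr_l. f_equal.
  unfold Tmom. rewrite <- lsum_minus. apply lsum_ext. intros t _. ring.
Qed.

Lemma k1_eq h j : k1 h j = ((1 - w) * u1 h j - d1 h j)%S.
Proof.
  unfold k1, u1, d1. change (Xd h j) with (fun t => Lv j t - Lv (j + h) t).
  rewrite Cmom0_sub.
  replace ((1 - w) * (brk h * Cmom (Lv j) 0))%S with ((1 - w) * brk h * Cmom (Lv j) 0)%S by ring.
  rewrite brk_eq. ring.
Qed.

(** [d1] collects the remainders between levels [j] and [j + h]; bounded by [C q^(j+i)], they sum to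
    at most [100 C q^j] for every [h]. *)
Lemma d1_OBq : OBq 0 d1.
Proof.
  destruct (Lv_Rem 0 ltac:(lia)) as (C & HC & H).
  assert (Hd : forall h j, Bmul (C * lsum (fun i => q ^ (j + i)) (seq 0 h)) (d1 h j)).
  { induction h as [|h IH]; intros j; unfold d1.
    - replace (Cmom (Lv (j + 0)) 0 - w ^ 0 * Cmom (Lv j) 0)%S with s0
        by (rewrite Nat.add_0_r; simpl; ring).
      apply Bmul_0. simpl. lra.
    - rewrite Nat.add_succ_r, (Cmom0_step (Lv (j + h))) by apply Lv_lifts.
      replace (w * Cmom (Lv (j + h)) 0 + Rem (Lv (S (j + h))) 0 - w ^ S h * Cmom (Lv j) 0)%S
        with (w * d1 h j + Rem (Lv (S (j + h))) 0)%S by (unfold d1; simpl; ring).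
      rewrite lsum_seq_S, Rmult_plus_distr_l. apply Bmul_add; [apply Bmul_wmul, IH|].
      eapply Bmul_le; [|apply (H 1%nat (S (j + h))); lia]. simpl (INR 1 ^ 0).
      rewrite Rmult_1_r. apply Rmult_le_compat_l; [assumption|].
      simpl. pose proof (q_pow_ge0 (j + h)). unfold q at 1. lra. }
  exists (C * 100). split; [lra|]. intros h j Hh. simpl pow at 1. rewrite Rmult_1_r.
  eapply Bmul_le; [|apply Hd].
  rewrite (lsum_ext _ (fun i => q ^ j * q ^ i)) by (intros; apply pow_add).
  rewrite lsum_scal, Rmult_assoc, (Rmult_comm 100).
  apply Rmult_le_compat_l; [assumption|].
  apply Rmult_le_compat_l; [apply q_pow_ge0|apply q_sum_le].
Qed.

Lemma u1_err : OBq 1 (fun h j => u1 h (S j) - w ^ 1 * u1 h j)%S.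
Proof.
  destruct (OBq_S _ _ (Lv_Rem 0 ltac:(lia))) as (C & HC & H).
  exists C. split; [assumption|]. intros h j Hh. unfold u1.
  rewrite (Cmom0_step (Lv j)) by apply Lv_lifts.
  replace (brk h * (w * Cmom (Lv j) 0 + Rem (Lv (S j)) 0) - w ^ 1 * (brk h * Cmom (Lv j) 0))%S
    with (brk h * Rem (Lv (S j)) 0)%S by (simpl; ring).
  replace (C * INR h ^ 1 * q ^ j) with (INR h * (C * INR h ^ 0 * q ^ j)) by (simpl; ring).
  apply Bmul_mul; [apply brk_Bmul|apply H, Hh].
Qed.

Lemma u1_OG : OG always 1 1 u1.
Proof.
  apply OG_intro; [|apply u1_err].
  destruct (Lv_K_0 0 0 ltac:(lia)) as (C & HC & H).
  exists C. split; [assumption|]. intros h j Hh HD. unfold u1.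
  replace (C * INR h ^ 1) with (INR h * (C * INR h ^ 0)) by (simpl; ring).
  apply Bmul_mul; [apply brk_Bmul|exact (H h j Hh HD)].
Qed.

Definition g2 (h j : nat) : series := (k1 h j * u1 h j)%S.

Lemma g2_OG : OG always 2 1 g2.
Proof. exact (OG_mul _ 1 1 0 1 _ _ k1_OG u1_OG). Qed.

Lemma g2_err : OBq 1 (fun h j => g2 h (S j) - w ^ 2 * g2 h j)%S.
Proof.
  pose proof (OG_OB _ _ _ _ k1_OG) as Hk. pose proof (OG_OB _ _ _ _ u1_OG) as Hu.
  destruct (OBq_add _ _ _ (OB_mul_OBq _ _ _ _ (OB_w _ _ _ Hk) u1_err)
    (OB_mul_OBq 1 0 _ _ (OB_S _ _ Hu) k1_err)) as (C & HC & H).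
  exists C. split; [assumption|]. intros h j Hh.
  match type of (H h j Hh) with Bmul _ ?y =>
    replace (g2 h (S j) - w ^ 2 * g2 h j)%S with y by (unfold g2; simpl; ring) end.
  exact (H h j Hh).
Qed.

(** The recursion of [k2] has the source [T k1^2], where [k1^2 = (1 - T) g2 - k1 d1]. As
    [g2 h (S j)] is nearly [T^2 g2 h j], this source is nearly [T g2 h j - g2 h (S j)], so adding
    [g2] absorbs it and leaves ratio [T]. *)
Definition p2 (h j : nat) : series := (k2 h j + g2 h j)%S.

Lemma p2_OG : OG always 1 1 p2.
Proof.
  apply OG_intro.
  - exact (OB_add _ _ _ _ (Xd_K_0 1 1 ltac:(lia) Xd_A2_0)
      (OB_at_0 _ _ (OG_OB _ _ _ _ g2_OG))).
  - destruct (OBq_add _ _ _ (OBq_add _ _ _ g2_err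
      (OBq_up 0 1 _ ltac:(lia) (OBq_opp _ _ (OB_mul_OBq 0 0 _ _
        (OB_w _ _ _ (OG_OB _ _ _ _ k1_OG)) d1_OBq))))
      (OBq_up 0 1 _ ltac:(lia) (OBq_S _ _ (Xd_Rem 1 ltac:(lia))))) as (C & HC & H).
    exists C. split; [assumption|]. intros h j Hh. specialize (H h j Hh).
    match type of H with Bmul _ ?y =>
      replace (p2 h (S j) - w ^ 1 * p2 h j)%S with y; [exact H|] end.
    unfold p2 at 1, k2. rewrite (Cmom1_step (Xd h j)) by (apply Xd_lifts, Hh).
    fold (k1 h j). fold (k2 h j). unfold p2.
    replace (k1 h j * k1 h j)%S with ((1 - w) * g2 h j - k1 h j * d1 h j)%S
      by (unfold g2; rewrite (k1_eq h j) at 3; ring).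
    simpl. ring.
Qed.

Definition g3 (h j : nat) : series :=
  ((1 + 1 + 1) * (k1 h j * k2 h j) + k1 h j * k1 h j * k1 h j)%S.

(** Substituting [k2 = p2 - g2] separates the source of [k3] into parts of ratio [T^2] and [T^3]. *)
Definition g3a (h j : nat) : series := ((1 + 1 + 1) * (k1 h j * p2 h j))%S.
Definition g3b (h j : nat) : series :=
  (k1 h j * k1 h j * k1 h j - (1 + 1 + 1) * (k1 h j * g2 h j))%S.

Lemma g3_eq h j : g3 h j = (g3a h j + g3b h j)%S.
Proof. unfold g3, g3a, g3b, p2. ring. Qed.

Lemma g3a_OG : OG always 2 1 g3a.
Proof. exact (OG_scal _ _ _ _ _ _ Bmul_3 (OG_mul _ 1 1 0 1 _ _ k1_OG p2_OG)). Qed.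

Lemma g3b_OG : OG always 3 1 g3b.
Proof.
  exact (OG_add _ _ _ _ _
    (OG_up _ _ 0 1 _ ltac:(lia) (OG_mul _ 2 1 0 0 _ _ (OG_mul _ 1 1 0 0 _ _ k1_OG k1_OG) k1_OG))
    (OG_opp _ _ _ _ (OG_scal _ _ _ _ _ _ Bmul_3 (OG_mul _ 1 2 0 1 _ _ k1_OG g2_OG)))).
Qed.

(** The solution of [x (S j) = T (x j + g3 j)] starting from [0]. It is bounded in the supremum norm
    only, so [k1 * x3] is out of reach of [geo_mul]. *)
Definition x3 (h r : nat) : series := CS (g3 h) r.

Lemma x3_OI : OI always 1 x3.
Proof.
  destruct (OI_add _ _ _ _ (OG_CS _ 0 1 _ g3a_OG) (OG_CS _ 1 1 _ g3b_OG)) as (C & HC & H).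
  exists C. split; [assumption|]. intros h r Hh HD. unfold x3.
  rewrite (CS_ext _ _ _ (g3_eq h)), CS_add. exact (H h r Hh HD).
Qed.

(** With the source carried by [x3], the recursion of the difference has [Rem] as its only error. *)
Definition p3 (h j : nat) : series := (k3 h j - x3 h j)%S.

Lemma p3_OG : OG always 1 2 p3.
Proof.
  apply OG_intro.
  - destruct (Xd_K_0 2 2 ltac:(lia) Xd_A3_0) as (C & HC & H).
    exists C. split; [assumption|]. intros h j Hh HD. unfold p3, x3. simpl CS.
    replace (k3 h 0 - 0)%S with (Cmom (Xd h 0) 2) by (unfold k3; ring). exact (H h j Hh HD).
  - destruct (OBq_up 0 2 _ ltac:(lia) (OBq_S _ _ (Xd_Rem 2 ltac:(lia)))) as (C & HC & H).
    exists C. split; [assumption|]. intros h j Hh. specialize (H h j Hh).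
    replace (p3 h (S j) - w ^ 1 * p3 h j)%S with (Rem (Xd h (S j)) 2); [exact H|].
    unfold p3 at 1, k3. rewrite (Cmom2_step (Xd h j)) by (apply Xd_lifts, Hh).
    fold (k1 h j). fold (k2 h j). fold (k3 h j). fold (g3 h j). unfold p3, x3. simpl. ring.
Qed.

(* Summation by parts: [(1 - T) u1 x3] is telescoped up to terms that are geometric
   of ratio [T^3] and [T^4]. *)
Lemma u1_x3_parts h r :
  CS (fun j => (1 - w) * (u1 h j * x3 h j))%S r =
  (- (u1 h r * x3 h r) + w * CS (fun j => u1 h j * g3 h j) r
   + CS (fun j => (u1 h (S j) - w ^ 1 * u1 h j) * (x3 h j + g3 h j)) r)%S.
Proof.
  induction r as [|r IH]; [unfold x3; simpl; ring|].
  simpl CS. rewrite IH. unfold x3 at 4. simpl CS. fold (x3 h r). simpl. ring.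
Qed.

Lemma u1_x3_OI : OI always 2 (fun h r => CS (fun j => (1 - w) * (u1 h j * x3 h j))%S r).
Proof.
  pose proof (OI_add _ _ _ _ (OG_CS _ 1 2 _ (OG_mul _ 1 2 1 1 _ _ u1_OG g3a_OG))
    (OG_CS _ 2 2 _ (OG_mul _ 1 3 1 1 _ _ u1_OG g3b_OG))) as H1.
  assert (Hg : OI always 1 g3).
  { destruct (OI_add _ _ _ _ (OB_OI _ _ _ (OG_OB _ _ _ _ g3a_OG))
      (OB_OI _ _ _ (OG_OB _ _ _ _ g3b_OG))) as (C & HC & H).
    exists C. split; [assumption|]. intros h j Hh HD. rewrite g3_eq. exact (H h j Hh HD). }
  pose proof (OIq_CS always _ _ (OBq_mul_OI _ _ _ _ u1_err (OI_add _ _ _ _ x3_OI Hg))) as H2.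
  pose proof (OB_mul_OI _ 1 1 _ _ (OG_OB _ _ _ _ u1_OG) x3_OI) as H3.
  destruct (OI_add _ _ _ _ (OI_add _ _ _ _ (OI_opp _ _ _ H3)
    (OI_scal _ _ _ _ _ Bmul_w H1)) H2) as (C & HC & H).
  exists C. split; [assumption|]. intros h r Hh HD. specialize (H h r Hh HD).
  rewrite u1_x3_parts.
  rewrite (CS_ext (fun j => u1 h j * g3 h j)%S (fun j => u1 h j * g3a h j + u1 h j * g3b h j)%S)
    by (intros j; rewrite g3_eq; ring).
  rewrite CS_add. exact H.
Qed.

(** After [k2 = p2 - g2], all sources of [m_4] except [k1 k3] and the remainder are sums of nearly
    geometric terms of ratio at least [T^2], of order at most [h^2]. *)
Lemma Xd_A4 : OI always 2 (fun h r => Tmom (Xd h r) 4).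
Proof.
  pose proof k1_OG as H1. pose proof p2_OG as H2. pose proof g2_OG as Hg. pose proof p3_OG as H3.
  pose proof (OG_mul _ 1 1 0 0 _ _ H1 H1) as H11.
  assert (Hd : OI always 2 (fun h r => CS (fun j => d1 h j * x3 h j)%S r)).
  { apply (OI_up _ 1); [lia|].
    exact (OIq_CS always _ _ (OBq_mul_OI 0 1 _ _ d1_OBq x3_OI)). }
  (* Here [k3 = p3 + x3], and [k1] is expanded as [(1 - T) u1 - d1] only in front of [x3]. *)
  assert (H13 : OI always 2 (fun h r => CS (fun j => k1 h j * k3 h j)%S r)).
  { destruct (OI_add _ _ _ _ (OI_add _ _ _ _ (OG_CS _ 0 2 _ (OG_mul _ 1 1 0 2 _ _ H1 H3))
      u1_x3_OI) (OI_opp _ _ _ Hd)) as (C & HC & H).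
    exists C. split; [assumption|]. intros h r Hh HD. specialize (H h r Hh HD).
    rewrite (CS_ext _ (fun j => k1 h j * p3 h j + (1 - w) * (u1 h j * x3 h j)
                                + - (d1 h j * x3 h j))%S).
    - rewrite !CS_add, CS_opp. exact H.
    - intros j. unfold p3. rewrite (k1_eq h j). ring. }
  assert (H22 : OI always 2 (fun h r => CS (fun j => k2 h j * k2 h j)%S r)).
  { destruct (OI_add _ _ _ _ (OI_add _ _ _ _ (OG_CS _ 0 2 _ (OG_mul _ 1 1 1 1 _ _ H2 H2))
      (OI_opp _ _ _ (OI_scal _ _ _ _ _ Bmul_2 (OG_CS _ 1 2 _ (OG_mul _ 1 2 1 1 _ _ H2 Hg)))))
      (OG_CS _ 2 2 _ (OG_mul _ 2 2 1 1 _ _ Hg Hg))) as (C & HC & H).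
    exists C. split; [assumption|]. intros h r Hh HD. specialize (H h r Hh HD).
    rewrite (CS_ext _ (fun j => p2 h j * p2 h j + - ((1 + 1) * (p2 h j * g2 h j))
                                + g2 h j * g2 h j)%S).
    - rewrite !CS_add, CS_opp, CS_scal. exact H.
    - intros j. unfold p2. ring. }
  assert (H112 : OI always 2 (fun h r => CS (fun j => k1 h j * k1 h j * k2 h j)%S r)).
  { apply (OI_up _ 1); [lia|].
    destruct (OI_add _ _ _ _ (OG_CS _ 1 1 _ (OG_mul _ 2 1 0 1 _ _ H11 H2))
      (OI_opp _ _ _ (OG_CS _ 2 1 _ (OG_mul _ 2 2 0 1 _ _ H11 Hg)))) as (C & HC & H).
    exists C. split; [assumption|]. intros h r Hh HD. specialize (H h r Hh HD).
    rewrite (CS_ext _ (fun j => k1 h j * k1 h j * p2 h j + - (k1 h j * k1 h j * g2 h j))%S).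
    - rewrite CS_add, CS_opp. exact H.
    - intros j. unfold p2. ring. }
  pose proof (OI_up _ 0 2 _ ltac:(lia) (OG_CS _ 2 0 _ (OG_mul _ 3 1 0 0 _ _
    (OG_mul _ 2 1 0 0 _ _ H11 H1) H1))) as H1111.
  pose proof (OI_up always 0 2 _ ltac:(lia)
    (OIq_CS always _ _ (OBq_OIq _ _ (Xd_Rem 3 ltac:(lia))))) as HR.
  assert (HW : OI always 2 (fun h r => w ^ r * Tmom (Xd h 0) 4)%S).
  { refine (OB_mul_OI _ 0 2 (fun h r => w ^ r)%S (fun h _ => Tmom (Xd h 0) 4) _ Xd_A4_0).
    exists 1. split; [lra|]. intros. simpl. rewrite Rmult_1_r. apply Bmul_wpow. }
  destruct (OI_add _ _ _ _ HW (OI_add _ _ _ _ (OI_add _ _ _ _ (OI_add _ _ _ _ (OI_add _ _ _ _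
    HR (OI_scal _ _ _ _ _ Bmul_4 H13)) (OI_scal _ _ _ _ _ Bmul_3 H22))
    (OI_scal _ _ _ _ _ Bmul_6 H112)) H1111)) as (C & HC & H).
  exists C. split; [assumption|]. intros h r Hh HD. specialize (H h r Hh HD).
  rewrite (CS_solve (fun r => Tmom (Xd h r) 4) _ r (fun j => Tmom4_step _ _ (Xd_lifts h j Hh))).
  rewrite !CS_add, !CS_scal. exact H.
Qed.

Lemma fourth_moment_U : exists C, 0 < C /\ forall n r h, (1 <= n)%nat ->
  lsum (fun t => (INR (level t r) - INR (level t (r + h))) ^ 4) (U n)
    <= C * INR h ^ 2 * INR n * INR (length (U n)).
Proof.
  (* The factor [2] comes from [W_le]; adding [1] makes the constant positive. *)
  destruct Xd_A4 as (C & HC & H). exists (2 * C + 1). split; [lra|].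
  intros n r [|h] Hn.
  - rewrite lsum_0; [simpl; rewrite Rmult_0_l, !Rmult_0_r, !Rmult_0_l; lra|].
    intros t _. rewrite Nat.add_0_r. ring.
  - specialize (H (S h) r ltac:(lia) I n).
    pose proof (W_le n Hn) as HW. pose proof (Rle_abs (Tmom (Xd (S h) r) 4 n)) as Ha.
    pose proof (INR_pow_ge1 (S h) 2 ltac:(lia)) as Hp.
    change (lsum (fun t => (INR (level t r) - INR (level t (r + S h))) ^ 4) (U n))
      with (Tmom (Xd (S h) r) 4 n).
    fold (w n). assert (0 <= INR n * w n) by (apply Rmult_le_pos; [apply pos_INR|apply w_ge0]).
    assert (C * INR (S h) ^ 2 * W n <= C * INR (S h) ^ 2 * (2 * (INR n * w n))).
    { apply Rmult_le_compat_l; [|assumption]. apply Rmult_le_pos; lra. }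
    assert (0 <= INR (S h) ^ 2 * (INR n * w n)) by (apply Rmult_le_pos; lra).
    lra.
Qed.

Lemma avg_lsum s F : avg s F = lsum F s / INR (length s).
Proof. reflexivity. Qed.

Lemma fourth_moment_bound :
  exists C : R, 0 < C /\
     forall (n r h : nat) (s : list tree), (1 <= n)%nat -> rep_system n s ->
       avg s (fun t => (INR (level t r) - INR (level t (r + h))) ^ 4)
         <= C * INR h ^ 2 * INR n.
Proof.
  destruct fourth_moment_U as (C & HC & H). exists C. split; [assumption|].
  intros n r h s Hn Hs. rewrite avg_lsum, (rep_system_length n s Hs).
  rewrite (rep_system_lsum n s); [| |assumption].
  2:{ intros t u E. rewrite !(iso_level t u) by assumption. reflexivity. }
  assert (0 < INR (length (U n))) by (pose proof (w_pos n Hn); unfold w in *; lra).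
  apply Rmult_le_reg_r with (INR (length (U n))); [assumption|].
  unfold Rdiv. rewrite Rmult_assoc, Rinv_l, Rmult_1_r by lra. apply H. assumption.
Qed.

(** * Increments of the interpolated profile *)

Definition fl (x : R) : nat := Z.to_nat (Int_part x).

Lemma fl_spec x : 0 <= x -> INR (fl x) <= x < INR (fl x) + 1.
Proof.
  intros Hx. destruct (base_Int_part x) as [H1 H2]. unfold fl.
  assert (0 <= Int_part x)%Z.
  { apply le_IZR. assert (-1 < IZR (Int_part x)) by lra.
    apply (lt_IZR (-1)) in H. apply IZR_le. lia. }
  rewrite INR_IZR_INZ, Z2Nat.id by assumption. lra.
Qed.

Lemma fl_mono x y : 0 <= x <= y -> (fl x <= fl y)%nat.
Proof.
  intros H. pose proof (fl_spec x ltac:(lra)). pose proof (fl_spec y ltac:(lra)).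
  apply Nat.lt_succ_r, INR_lt. rewrite S_INR. lra.
Qed.

Lemma Linterp_same_cell t x y : fl x = fl y ->
  Linterp t y - Linterp t x
  = (y - x) * (INR (level t (fl x + 1)) - INR (level t (fl x))).
Proof.
  intros E. unfold Linterp. fold (fl x). fold (fl y). rewrite <- E, Nat.add_1_r. ring.
Qed.

(** Split at the first integer after [x] and the last one up to [y]: two partial cells and one
    increment between integer levels. *)
Lemma Linterp_cells t x y d : fl y = (fl x + 1 + d)%nat ->
  Linterp t y - Linterp t x
  = (INR (fl x) + 1 - x) * (INR (level t (fl x + 1)) - INR (level t (fl x)))
    + (INR (level t (fl x + 1 + d)) - INR (level t (fl x + 1)))
    + (y - INR (fl y)) * (INR (level t (fl y + 1)) - INR (level t (fl y))).
Proof.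
  intros E. unfold Linterp. fold (fl x). fold (fl y). rewrite <- E, !Nat.add_1_r. ring.
Qed.

Lemma avg_le s F G : (forall t, In t s -> F t <= G t) -> avg s F <= avg s G.
Proof.
  intros H. rewrite !avg_lsum. destruct s as [|t s]; [apply Rle_refl|].
  apply Rmult_le_compat_r; [|apply lsum_le; assumption].
  left. apply Rinv_0_lt_compat, lt_0_INR. simpl. lia.
Qed.

Lemma avg_plus s F G : avg s (fun t => F t + G t) = avg s F + avg s G.
Proof. rewrite !avg_lsum, lsum_plus. unfold Rdiv. ring. Qed.

Lemma avg_scal s c F : avg s (fun t => c * F t) = c * avg s F.
Proof. rewrite !avg_lsum, lsum_scal. unfold Rdiv. ring. Qed.

Lemma avg_lsum_exch {T} s (F : T -> tree -> R) l :
  avg s (fun t => lsum (fun i => F i t) l) = lsum (fun i => avg s (F i)) l.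
Proof.
  induction l as [|i l IH].
  - rewrite avg_lsum, (lsum_0 _ s); [unfold Rdiv; simpl; ring|reflexivity].
  - rewrite lsum_cons, <- IH, <- avg_plus. reflexivity.
Qed.

(** The quadratic mean inequality applied twice, whence [27 = 3^2 * 3]. *)
Lemma pow4_add3 a b c : (a + b + c) ^ 4 <= 27 * (a ^ 4 + b ^ 4 + c ^ 4).
Proof.
  assert (H3 : forall p r s, (p + r + s) ^ 2 <= 3 * (p ^ 2 + r ^ 2 + s ^ 2)).
  { intros p r s. pose proof (pow2_ge_0 (p - r)). pose proof (pow2_ge_0 (r - s)).
    pose proof (pow2_ge_0 (p - s)). lra. }
  assert (H0 : 0 <= (a + b + c) ^ 2) by apply pow2_ge_0.
  replace ((a + b + c) ^ 4) with ((a + b + c) ^ 2 * (a + b + c) ^ 2) by ring.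
  apply Rle_trans with ((3 * (a ^ 2 + b ^ 2 + c ^ 2)) * (3 * (a ^ 2 + b ^ 2 + c ^ 2))).
  - apply Rmult_le_compat; auto.
  - pose proof (H3 (a ^ 2) (b ^ 2) (c ^ 2)). lra.
Qed.

(** [81 = 27 * 3]: each of the three pieces is bounded by the full distance. A partial cell of
    length [a <= 1] contributes [a^4 <= a^2], so the quadratic bound survives below the lattice
    spacing. *)
Lemma Linterp_moment n s C x y : 0 < C -> (1 <= n)%nat ->
  (forall r h, avg s (fun t => (INR (level t r) - INR (level t (r + h))) ^ 4)
               <= C * INR h ^ 2 * INR n) ->
  0 <= x <= y ->
  avg s (fun t => (Linterp t y - Linterp t x) ^ 4) <= 81 * C * (y - x) ^ 2 * INR n.
Proof.
  intros HC Hn H Hxy.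
  assert (Hn0 : 0 <= C * INR n) by (apply Rmult_le_pos; [lra|apply pos_INR]).
  assert (Hinc : forall r h, avg s (fun t => (INR (level t (r + h)) - INR (level t r)) ^ 4)
               <= C * INR n * INR h ^ 2).
  { intros r h. specialize (H r h).
    eapply Rle_trans; [apply avg_le|eapply Rle_trans; [exact H|lra]].
    intros t _. right. ring. }
  assert (H1 : forall a z r, 0 <= a <= 1 -> a <= z ->
    avg s (fun t => (a * (INR (level t (r + 1)) - INR (level t r))) ^ 4) <= C * INR n * z ^ 2).
  { intros a z r Ha Hz.
    eapply Rle_trans; [apply avg_le with (G := fun t => a ^ 4 * (INR (level t (r + 1)) - INR (level t r)) ^ 4)|].
    - intros t _. right. ring.
    - rewrite avg_scal. apply Rle_trans with (a ^ 4 * (C * INR n * INR 1 ^ 2)).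
      + apply Rmult_le_compat_l; [apply pow_le; lra|apply Hinc].
      + simpl (INR 1 ^ 2). rewrite !Rmult_1_r, Rmult_comm. apply Rmult_le_compat_l; [assumption|].
        apply Rle_trans with (a ^ 2); [|apply pow_incr; lra].
        replace (a ^ 4) with (a ^ 2 * a ^ 2) by ring. assert (0 <= a ^ 2 <= 1) by nra. nra. }
  pose proof (fl_spec x ltac:(lra)) as Fx. pose proof (fl_spec y ltac:(lra)) as Fy.
  pose proof (fl_mono x y Hxy) as Fxy.
  assert (Hz : 0 <= C * INR n * (y - x) ^ 2) by (apply Rmult_le_pos; [assumption|nra]).
  destruct (Nat.eq_dec (fl x) (fl y)) as [E|E].
  - eapply Rle_trans; [apply avg_le with (G := fun t => ((y - x) * (INR (level t (fl x + 1)) - INR (level t (fl x)))) ^ 4)|].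
    + intros t _. rewrite (Linterp_same_cell t x y E). apply Rle_refl.
    + eapply Rle_trans; [apply (H1 (y - x) (y - x)); [rewrite E in *; lra|lra]|]. lra.
  - assert (Ed : fl y = (fl x + 1 + (fl y - fl x - 1))%nat) by lia.
    set (d := (fl y - fl x - 1)%nat) in *.
    assert (Hd : INR (fl y) = INR (fl x) + 1 + INR d) by (rewrite Ed, !plus_INR; reflexivity).
    pose proof (pos_INR d).
    eapply Rle_trans; [apply avg_le with (G := fun t =>
       27 * (((INR (fl x) + 1 - x) * (INR (level t (fl x + 1)) - INR (level t (fl x)))) ^ 4
       + (INR (level t (fl x + 1 + d)) - INR (level t (fl x + 1))) ^ 4
       + ((y - INR (fl y)) * (INR (level t (fl y + 1)) - INR (level t (fl y)))) ^ 4))|].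
    + intros t _. rewrite (Linterp_cells t x y d Ed). apply pow4_add3.
    + rewrite avg_scal, !avg_plus.
      pose proof (H1 (INR (fl x) + 1 - x) (y - x) (fl x) ltac:(lra) ltac:(lra)) as B1.
      pose proof (Hinc (fl x + 1)%nat d) as B2.
      pose proof (H1 (y - INR (fl y)) (y - x) (fl y) ltac:(lra) ltac:(lra)) as B3.
      assert (C * INR n * INR d ^ 2 <= C * INR n * (y - x) ^ 2).
      { apply Rmult_le_compat_l; [assumption|]. apply pow_incr. lra. }
      lra.
Qed.

Lemma level_diff_le t a d :
  Rabs (INR (level t (a + d)) - INR (level t a)) <= INR (tsize t) * INR d.
Proof.
  destruct d as [|d].
  - rewrite Nat.add_0_r, Rminus_diag, Rabs_R0. simpl. lra.
  - pose proof (level_le t a) as H1. pose proof (level_le t (a + S d)) as H2.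
    apply le_INR in H1. apply le_INR in H2.
    pose proof (pos_INR (level t a)). pose proof (pos_INR (level t (a + S d))).
    apply Rle_trans with (INR (tsize t)); [apply Rabs_le; lra|].
    rewrite <- (Rmult_1_r (INR (tsize t))) at 1.
    apply Rmult_le_compat_l; [apply pos_INR|apply (le_INR 1); lia].
Qed.

(** A constant depending on the tree is enough, as it serves only the continuity of each single
    path. *)
Lemma Linterp_lipschitz t x y : 0 <= x <= y ->
  Rabs (Linterp t y - Linterp t x) <= INR (tsize t) * (y - x).
Proof.
  intros Hxy.
  pose proof (fl_spec x ltac:(lra)) as Fx. pose proof (fl_spec y ltac:(lra)) as Fy.
  pose proof (fl_mono x y Hxy) as Fxy. pose proof (pos_INR (tsize t)) as Ht.
  assert (H1 : forall a r, 0 <= a ->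
    Rabs (a * (INR (level t (r + 1)) - INR (level t r))) <= INR (tsize t) * a).
  { intros a r Ha. rewrite Rabs_mult, (Rabs_pos_eq a Ha), Rmult_comm.
    apply Rmult_le_compat_r; [assumption|].
    pose proof (level_diff_le t r 1) as H. simpl (INR 1) in H. lra. }
  destruct (Nat.eq_dec (fl x) (fl y)) as [E|E].
  - rewrite (Linterp_same_cell t x y E). apply H1. lra.
  - assert (Ed : fl y = (fl x + 1 + (fl y - fl x - 1))%nat) by lia.
    set (d := (fl y - fl x - 1)%nat) in *.
    assert (Hd : INR (fl y) = INR (fl x) + 1 + INR d) by (rewrite Ed, !plus_INR; reflexivity).
    rewrite (Linterp_cells t x y d Ed).
    eapply Rle_trans; [apply Rabs_triang|].
    eapply Rle_trans; [apply Rplus_le_compat_r, Rabs_triang|].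
    pose proof (H1 (INR (fl x) + 1 - x) (fl x) ltac:(lra)).
    pose proof (level_diff_le t (fl x + 1) d).
    pose proof (H1 (y - INR (fl y)) (fl y) ltac:(lra)).
    replace (INR (tsize t) * (y - x)) with (INR (tsize t) * (INR (fl x) + 1 - x)
      + INR (tsize t) * INR d + INR (tsize t) * (y - INR (fl y))) by (rewrite Hd; ring).
    lra.
Qed.

Lemma sqrt_INR_ge1 n : (1 <= n)%nat -> 1 <= sqrt (INR n).
Proof. intros H. rewrite <- sqrt_1. apply sqrt_le_1_alt, (le_INR 1). assumption. Qed.

Lemma lproc_cont n t : (1 <= n)%nat -> cont_on_nonneg (lproc n t).
Proof.
  intros Hn x Hx e He. pose proof (sqrt_INR_ge1 n Hn) as Hs. set (r := sqrt (INR n)) in *.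
  pose proof (pos_INR (tsize t)) as Ht.
  assert (HL : forall a b, 0 <= a <= b ->
    Rabs (lproc n t b - lproc n t a) <= INR (tsize t) * (b - a)).
  { intros a b Hab. unfold lproc. fold r. rewrite <- Rmult_minus_distr_l, Rabs_mult.
    rewrite Rabs_pos_eq by (left; apply Rinv_0_lt_compat; lra).
    apply Rle_trans with (/ r * (INR (tsize t) * (b * r - a * r))).
    - apply Rmult_le_compat_l; [left; apply Rinv_0_lt_compat; lra|].
      apply Linterp_lipschitz. nra.
    - right. field. lra. }
  exists (e / (INR (tsize t) + 1)). split; [apply Rdiv_lt_0_compat; lra|].
  intros y Hy Hd.
  assert (Hb : Rabs (lproc n t y - lproc n t x) <= INR (tsize t) * Rabs (y - x)).
  { destruct (Rle_dec x y).
    - rewrite (Rabs_pos_eq (y - x)) by lra. apply HL. lra.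
    - rewrite Rabs_minus_sym, (Rabs_minus_sym y x), (Rabs_pos_eq (x - y)) by lra. apply HL. lra. }
  assert ((INR (tsize t) + 1) * Rabs (y - x) < e).
  { apply Rmult_lt_reg_l with (/ (INR (tsize t) + 1)); [apply Rinv_0_lt_compat; lra|].
    rewrite <- Rmult_assoc, Rinv_l, Rmult_1_l by lra. rewrite Rmult_comm. exact Hd. }
  pose proof (Rabs_pos (y - x)). lra.
Qed.

Lemma lproc_0 n t : (1 <= n)%nat -> Rabs (lproc n t 0) <= 1.
Proof.
  intros Hn. pose proof (sqrt_INR_ge1 n Hn) as Hs. unfold lproc, Linterp.
  rewrite Rmult_0_l. fold (fl 0).
  assert (E : fl 0 = 0%nat).
  { pose proof (fl_spec 0 ltac:(lra)) as H. destruct (fl 0) as [|k]; [reflexivity|].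
    rewrite S_INR in H. pose proof (pos_INR k). lra. }
  rewrite E, level_0. simpl INR. rewrite !Rminus_0_r, Rmult_0_l, Rplus_0_l, Rplus_0_r, !Rmult_1_r.
  rewrite Rabs_pos_eq by (left; apply Rinv_0_lt_compat; lra).
  rewrite <- Rinv_1. apply Rinv_le_contravar; lra.
Qed.

(** One factor [n] from rescaling time in [(y - x)^2] and one from the moment bound cancel the
    [n^-2] of the fourth power of the space scaling. *)
Lemma lproc_moment : exists C, 0 < C /\ forall n s x y, (1 <= n)%nat -> rep_system n s ->
  0 <= x <= y -> avg s (fun t => (lproc n t y - lproc n t x) ^ 4) <= C * (y - x) ^ 2.
Proof.
  destruct fourth_moment_bound as (C & HC & H). exists (81 * C). split; [lra|].
  intros n s x y Hn Hs Hxy. pose proof (sqrt_INR_ge1 n Hn) as Hr.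
  set (r := sqrt (INR n)) in *.
  assert (Er : r * r = INR n) by apply sqrt_sqrt, pos_INR.
  pose proof (Linterp_moment n s C (x * r) (y * r) HC Hn
    (fun a h => H n a h s Hn Hs) ltac:(nra)) as HL.
  eapply Rle_trans; [apply avg_le with (G := fun t => (/ r) ^ 4 * (Linterp t (y * r) - Linterp t (x * r)) ^ 4)|].
  - intros t _. unfold lproc. fold r. right. ring.
  - rewrite avg_scal.
    apply Rle_trans with ((/ r) ^ 4 * (81 * C * (y * r - x * r) ^ 2 * INR n)).
    + apply Rmult_le_compat_l; [apply pow_le; left; apply Rinv_0_lt_compat; lra|exact HL].
    + rewrite <- Er. right. field. lra.
Qed.

(** * A compact subset of [C[0,oo)] *)

(** The rate for increments over [2^-m]. It is below [1] for the chaining, and [2 rr^4 > 1] makes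
    the union bound with fourth moments converge. *)
Definition rr : R := 9 / 10.

Lemma rr_pow_pos m : 0 < rr ^ m.
Proof. apply pow_lt. unfold rr. lra. Qed.

Definition dy (m k : nat) : R := INR k / 2 ^ m.

Lemma dy_ge0 m k : 0 <= dy m k.
Proof.
  unfold dy. apply Rmult_le_pos; [apply pos_INR|]. left. apply Rinv_0_lt_compat, pow_lt. lra.
Qed.

Lemma dy_0 m : dy m 0 = 0.
Proof. unfold dy. simpl. unfold Rdiv. ring. Qed.

Lemma dy_double m k : dy (S m) (2 * k) = dy m k.
Proof.
  unfold dy. rewrite mult_INR. simpl. field. apply pow_nonzero. lra.
Qed.

(* At scale [2^-m] the increments are controlled on [[0, m]] only, so that a single
   sequence of conditions takes care of all compact intervals. *)
Definition Kset (B : R) (g : R -> R) : Prop :=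
  cont_on_nonneg g /\ Rabs (g 0) <= 1 /\
  forall m k, (k < m * 2 ^ m)%nat -> Rabs (g (dy m (S k)) - g (dy m k)) <= B * rr ^ m.

Lemma INR_pow2 m : INR (2 ^ m) = 2 ^ m.
Proof. rewrite pow_INR. reflexivity. Qed.

Lemma fl_dy m x : 0 <= x -> dy m (fl (x * 2 ^ m)) <= x < dy m (fl (x * 2 ^ m)) + / 2 ^ m.
Proof.
  intros Hx. assert (H2 : 0 < 2 ^ m) by (apply pow_lt; lra).
  pose proof (fl_spec (x * 2 ^ m) ltac:(apply Rmult_le_pos; lra)) as H.
  unfold dy. set (k := INR (fl (x * 2 ^ m))) in *. split.
  - apply Rmult_le_reg_r with (2 ^ m); [assumption|].
    unfold Rdiv. rewrite Rmult_assoc, Rinv_l by lra. lra.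
  - apply Rmult_lt_reg_r with (2 ^ m); [assumption|].
    rewrite Rmult_plus_distr_r. unfold Rdiv. rewrite Rmult_assoc, Rinv_l by lra. lra.
Qed.

Lemma fl_range m T x : (T < m)%nat -> 0 <= x <= INR T -> (fl (x * 2 ^ m) < m * 2 ^ m)%nat.
Proof.
  intros HT Hx. assert (H2 : 0 < 2 ^ m) by (apply pow_lt; lra).
  pose proof (fl_spec (x * 2 ^ m) ltac:(apply Rmult_le_pos; lra)) as H.
  apply INR_lt. rewrite mult_INR, INR_pow2.
  apply lt_INR in HT. nra.
Qed.

Lemma fl_double m x : 0 <= x ->
  fl (x * 2 ^ S m) = (2 * fl (x * 2 ^ m))%nat \/ fl (x * 2 ^ S m) = S (2 * fl (x * 2 ^ m)).
Proof.
  intros Hx. assert (H2 : 0 < 2 ^ m) by (apply pow_lt; lra).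
  pose proof (fl_spec (x * 2 ^ m) ltac:(apply Rmult_le_pos; lra)) as H.
  assert (E : x * 2 ^ S m = 2 * (x * 2 ^ m)) by (simpl; ring). rewrite E.
  pose proof (fl_spec (2 * (x * 2 ^ m)) ltac:(apply Rmult_le_pos; [lra|apply Rmult_le_pos; lra])) as H'.
  set (k := fl (x * 2 ^ m)) in *. set (l := fl (2 * (x * 2 ^ m))) in *.
  assert (2 * k < S l)%nat by (apply INR_lt; rewrite S_INR, mult_INR; simpl; lra).
  assert (l < 2 * k + 2)%nat by (apply INR_lt; rewrite plus_INR, mult_INR; simpl; lra).
  lia.
Qed.

(** Refining the scale moves the dyadic point below [x] by at most one step, and [9 = rr / (1 - rr)]
    sums the geometric tail. *)
Lemma Kset_chain B g m T x j : Kset B g -> (T < m)%nat -> 0 <= x <= INR T ->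
  Rabs (g (dy (m + j) (fl (x * 2 ^ (m + j)))) - g (dy m (fl (x * 2 ^ m))))
  <= B * (9 * (rr ^ m - rr ^ (m + j))).
Proof.
  intros HK HT Hx.
  assert (HB : 0 <= B).
  { destruct HK as (_ & _ & H). specialize (H 1%nat 0%nat ltac:(simpl; lia)).
    pose proof (Rabs_pos (g (dy 1 1) - g (dy 1 0))). simpl in H. unfold rr in H. lra. }
  induction j as [|j IH].
  - rewrite Nat.add_0_r, !Rminus_diag, Rabs_R0. lra.
  - rewrite Nat.add_succ_r. set (i := (m + j)%nat) in *.
    replace (g (dy (S i) (fl (x * 2 ^ S i))) - g (dy m (fl (x * 2 ^ m))))
      with ((g (dy (S i) (fl (x * 2 ^ S i))) - g (dy i (fl (x * 2 ^ i))))
            + (g (dy i (fl (x * 2 ^ i))) - g (dy m (fl (x * 2 ^ m))))) by ring.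
    eapply Rle_trans; [apply Rabs_triang|].
    assert (Hstep : Rabs (g (dy (S i) (fl (x * 2 ^ S i))) - g (dy i (fl (x * 2 ^ i))))
                    <= B * rr ^ S i).
    { rewrite <- (dy_double i).
      pose proof (fl_range (S i) T x ltac:(lia) Hx) as HR.
      destruct (fl_double i x ltac:(lra)) as [E|E]; rewrite E in *.
      - rewrite Rminus_diag, Rabs_R0. apply Rmult_le_pos; [assumption|].
        left. apply rr_pow_pos.
      - apply HK. lia. }
    assert (E : B * (9 * (rr ^ m - rr ^ S i)) = B * rr ^ S i + B * (9 * (rr ^ m - rr ^ i)))
      by (simpl; unfold rr at 2 4; field).
    lra.
Qed.

Lemma pow_small c e : 0 <= c < 1 -> 0 < e -> exists N, forall n, (N <= n)%nat -> c ^ n < e.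
Proof.
  intros Hc He. destruct (pow_lt_1_zero c) with (y := e) as (N & HN).
  - rewrite Rabs_pos_eq; lra.
  - assumption.
  - exists N. intros n Hn. specialize (HN n Hn). rewrite Rabs_pos_eq in HN; [assumption|].
    apply pow_le. lra.
Qed.

(** Chaining reaches dyadic points only; continuity of [g] carries the bound to [x]. *)
Lemma Kset_dyadic_approx B g m T x : Kset B g -> (T < m)%nat -> 0 <= x <= INR T ->
  Rabs (g x - g (dy m (fl (x * 2 ^ m)))) <= 9 * B * rr ^ m.
Proof.
  intros HK HT Hx. apply le_epsilon. intros e He.
  destruct (proj1 HK x ltac:(lra) e He) as (d & Hd & Hc).
  destruct (pow_small (/ 2) d ltac:(lra) Hd) as (N & HN).
  pose proof (Kset_chain B g m T x N HK HT Hx) as Hch.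
  set (i := (m + N)%nat) in *.
  pose proof (fl_dy i x ltac:(lra)) as Hf.
  assert (Hi : / 2 ^ i < d) by (rewrite <- pow_inv; apply HN; lia).
  assert (H1 : Rabs (g (dy i (fl (x * 2 ^ i))) - g x) < e).
  { apply Hc; [apply dy_ge0|]. apply Rabs_def1; lra. }
  replace (g x - g (dy m (fl (x * 2 ^ m))))
    with (- (g (dy i (fl (x * 2 ^ i))) - g x)
          + (g (dy i (fl (x * 2 ^ i))) - g (dy m (fl (x * 2 ^ m))))) by ring.
  eapply Rle_trans; [apply Rabs_triang|]. rewrite Rabs_Ropp.
  assert (0 <= B * rr ^ i).
  { destruct HK as (_ & _ & H). specialize (H i 0%nat).
    eapply Rle_trans; [apply Rabs_pos|apply H].
    pose proof (Nat.pow_nonzero 2 i). nia. }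
  lra.
Qed.

Lemma Kset_dyadic_bound B g m k : Kset B g -> (k <= m * 2 ^ m)%nat ->
  Rabs (g (dy m k)) <= 1 + INR k * (B * rr ^ m).
Proof.
  intros HK. induction k as [|k IH]; intros Hk.
  - rewrite dy_0. destruct HK as (_ & H & _). simpl. lra.
  - specialize (IH ltac:(lia)). destruct HK as (_ & _ & H). specialize (H m k ltac:(lia)).
    replace (g (dy m (S k))) with ((g (dy m (S k)) - g (dy m k)) + g (dy m k)) by ring.
    eapply Rle_trans; [apply Rabs_triang|]. rewrite S_INR. lra.
Qed.

(** An infinite set of indices. Subsequences are kept as such sets, which can be thinned repeatedly,
    until one diagonal choice at the end. *)
Definition frequent (Q : nat -> Prop) : Prop := forall N, exists n, (N <= n)%nat /\ Q n.

(** Pigeonhole: of [N] cells of width [e], one is visited infinitely often. *)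
Lemma frequent_cell f e a N Q : 0 < e -> frequent Q ->
  (forall n, Q n -> a <= f n <= a + INR N * e) ->
  exists Q', frequent Q' /\ (forall n, Q' n -> Q n) /\
    (forall n n', Q' n -> Q' n' -> Rabs (f n - f n') <= e).
Proof.
  intros He. revert a Q. induction N as [|N IH]; intros a Q HQ Hf.
  - exists Q. split; [assumption|split; [auto|]]. intros n n' Hn Hn'.
    pose proof (Hf n Hn). pose proof (Hf n' Hn'). simpl in *. apply Rabs_le. lra.
  - destruct (classic (frequent (fun n => Q n /\ f n <= a + e))) as [H|H].
    + exists (fun n => Q n /\ f n <= a + e). split; [assumption|split; [tauto|]].
      intros n n' [Hn Ln] [Hn' Ln']. pose proof (Hf n Hn). pose proof (Hf n' Hn').
      apply Rabs_le. lra.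
    + apply not_all_ex_not in H. destruct H as (N0 & H).
      destruct (IH (a + e) (fun n => Q n /\ a + e <= f n)) as (Q' & H1 & H2 & H3).
      * intros M. destruct (HQ (Nat.max M N0)) as (n & Hn & Qn). exists n.
        split; [lia|]. split; [assumption|].
        destruct (Rle_dec (a + e) (f n)); [assumption|]. exfalso. apply H.
        exists n. split; [lia|]. split; [assumption|lra].
      * intros n [Hn Ln]. pose proof (Hf n Hn). rewrite S_INR in *. lra.
      * exists Q'. split; [assumption|split; [|assumption]]. intros n Hn. apply H2 in Hn. tauto.
Qed.

Lemma frequent_close f b e Q : 0 < e -> frequent Q -> (forall n, Q n -> Rabs (f n) <= b) ->
  exists Q', frequent Q' /\ (forall n, Q' n -> Q n) /\
    (forall n n', Q' n -> Q' n' -> Rabs (f n - f n') <= e).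
Proof.
  intros He HQ Hf.
  destruct (INR_archimed e (2 * b) He) as (N & HN).
  apply (frequent_cell f e (- b) N Q He HQ).
  intros n Hn. specialize (Hf n Hn). pose proof (Rle_abs (f n)).
  pose proof (Rle_abs (- f n)) as Hm. rewrite Rabs_Ropp in Hm. lra.
Qed.

Lemma frequent_close_all (f : nat -> nat -> R) b e L Q : 0 < e -> frequent Q ->
  (forall n k, Q n -> (k < L)%nat -> Rabs (f n k) <= b) ->
  exists Q', frequent Q' /\ (forall n, Q' n -> Q n) /\
    (forall n n' k, Q' n -> Q' n' -> (k < L)%nat -> Rabs (f n k - f n' k) <= e).
Proof.
  intros He. revert Q. induction L as [|L IH]; intros Q HQ Hf.
  - exists Q. split; [assumption|split; [auto|]]. intros; lia.
  - destruct (IH Q HQ) as (Q1 & F1 & S1 & C1); [intros; apply Hf; [assumption|lia]|].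
    destruct (frequent_close (fun n => f n L) b e Q1 He F1) as (Q2 & F2 & S2 & C2).
    { intros n Hn. apply Hf; [auto|lia]. }
    exists Q2. split; [assumption|split; [auto|]]. intros n n' k Hn Hn' Hk.
    destruct (Nat.eq_dec k L) as [->|]; [auto|]. apply C1; auto. lia.
Qed.

Lemma Kset_extraction B (u : nat -> R -> R) : (forall m, Kset B (u m)) ->
  exists phi : nat -> nat, (forall m, (phi m < phi (S m))%nat) /\
    forall i j j' k, (i <= j)%nat -> (i <= j')%nat -> (k <= i * 2 ^ i)%nat ->
      Rabs (u (phi j) (dy i k) - u (phi j') (dy i k)) <= rr ^ i.
Proof.
  intros Hu.
  (* The premise [frequent Q] sits under the existential so that choice yields a thinning step
     defined on all predicates. *)
  assert (Hst : forall i Q, exists Q', frequent Q ->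
    frequent Q' /\ (forall n, Q' n -> Q n) /\
    (forall n n' k, Q' n -> Q' n' -> (k < S (i * 2 ^ i))%nat ->
       Rabs (u n (dy i k) - u n' (dy i k)) <= rr ^ i)).
  { intros i Q. destruct (classic (frequent Q)) as [HQ|HQ]; [|exists Q; tauto].
    destruct (frequent_close_all (fun n k => u n (dy i k)) (1 + INR (i * 2 ^ i) * Rabs (B * rr ^ i))
      (rr ^ i) (S (i * 2 ^ i)) Q (rr_pow_pos i) HQ) as (Q' & H).
    - intros n k _ Hk. eapply Rle_trans; [apply (Kset_dyadic_bound B); [apply Hu|lia]|].
      apply Rplus_le_compat_l.
      apply Rle_trans with (INR k * Rabs (B * rr ^ i)).
      + apply Rmult_le_compat_l; [apply pos_INR|apply Rle_abs].
      + apply Rmult_le_compat_r; [apply Rabs_pos|apply le_INR; lia].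
    - exists Q'. auto. }
  set (st := fun i Q => proj1_sig (constructive_indefinite_description _ (Hst i Q))).
  assert (Hst' : forall i Q, frequent Q -> frequent (st i Q) /\ (forall n, st i Q n -> Q n) /\
    (forall n n' k, st i Q n -> st i Q n' -> (k < S (i * 2 ^ i))%nat ->
       Rabs (u n (dy i k) - u n' (dy i k)) <= rr ^ i)).
  { intros i Q. unfold st.
    exact (proj2_sig (constructive_indefinite_description _ (Hst i Q))). }
  set (Qs := fix Qs i := match i with O => st 0%nat (fun _ => True) | S i' => st (S i') (Qs i') end).
  assert (HF : forall i, frequent (Qs i)).
  { induction i as [|i IH]; simpl.
    - apply Hst'. intros N. exists N. auto.
    - apply Hst'. assumption. }
  assert (HC : forall i n n' k, Qs i n -> Qs i n' -> (k < S (i * 2 ^ i))%nat ->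
       Rabs (u n (dy i k) - u n' (dy i k)) <= rr ^ i).
  { intros [|i]; [apply (Hst' 0%nat)|apply (Hst' (S i)); apply HF].
    intros N. exists N. auto. }
  assert (HS : forall i j n, (i <= j)%nat -> Qs j n -> Qs i n).
  { intros i j n Hij. induction Hij as [|j _ IH]; [auto|].
    intros H. apply IH. apply (Hst' (S j) (Qs j) (HF j)). exact H. }
  set (pick := fun i N => proj1_sig (constructive_indefinite_description _ (HF i N))).
  assert (Hpick : forall i N, (N <= pick i N)%nat /\ Qs i (pick i N)).
  { intros i N. unfold pick.
    exact (proj2_sig (constructive_indefinite_description _ (HF i N))). }
  set (phi := fix phi i := match i with O => pick 0%nat 0%nat | S i' => pick (S i') (S (phi i')) end).
  assert (Hphi : forall i, Qs i (phi i)) by (intros [|i]; apply Hpick).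
  exists phi. split.
  - intros m. simpl. apply (Hpick (S m) (S (phi m))).
  - intros i j j' k Hj Hj' Hk. apply HC; [| |lia].
    + eapply HS; [exact Hj|apply Hphi].
    + eapply HS; [exact Hj'|apply Hphi].
Qed.

Lemma Un_cv_abs_le a l c N :
  Un_cv a l -> (forall n, (N <= n)%nat -> Rabs (a n) <= c) -> Rabs l <= c.
Proof.
  intros Hl Ha. apply le_epsilon. intros e He.
  destruct (Hl e He) as (M & HM). specialize (HM (Nat.max N M) ltac:(lia)).
  specialize (Ha (Nat.max N M) ltac:(lia)). unfold Rdist in HM.
  rewrite Rabs_minus_sym in HM.
  replace l with ((l - a (Nat.max N M)) + a (Nat.max N M)) by ring.
  eapply Rle_trans; [apply Rabs_triang|]. lra.
Qed.

Lemma INR_exceeds x : exists n, x <= INR n.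
Proof.
  destruct (INR_archimed 1 x ltac:(lra)) as (n & Hn). exists n. lra.
Qed.

Lemma Kset_compact B : compactC (Kset B).
Proof.
  split; [intros g Hg; apply Hg|]. intros u Hu.
  destruct (Kset_extraction B u Hu) as (phi & Hphi & Hosc). exists phi. split; [assumption|].
  (* Twice [9 |B|] for replacing [x] by a dyadic point in two functions, and [1] for their
     difference at that point. *)
  set (D := 18 * Rabs B + 1).
  assert (HD : 1 <= D) by (unfold D; pose proof (Rabs_pos B); lra).
  assert (Hcau : forall T i j j' x, (T < i)%nat -> (i <= j)%nat -> (i <= j')%nat ->
     0 <= x <= INR T -> Rabs (u (phi j) x - u (phi j') x) <= D * rr ^ i).
  { intros T i j j' x HT Hj Hj' Hx.
    pose proof (Kset_dyadic_approx B _ i T x (Hu (phi j)) HT Hx) as H1.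
    pose proof (Kset_dyadic_approx B _ i T x (Hu (phi j')) HT Hx) as H2.
    pose proof (fl_range i T x HT Hx) as Hr.
    set (y := fl (x * 2 ^ i)) in *.
    pose proof (Hosc i j j' y Hj Hj' ltac:(lia)) as H3.
    assert (H4 : B * rr ^ i <= Rabs B * rr ^ i).
    { apply Rmult_le_compat_r; [left; apply rr_pow_pos|apply Rle_abs]. }
    rewrite Rabs_minus_sym in H2.
    replace (u (phi j) x - u (phi j') x) with ((u (phi j) x - u (phi j) (dy i y))
      + (u (phi j) (dy i y) - u (phi j') (dy i y)) + (u (phi j') (dy i y) - u (phi j') x)) by ring.
    eapply Rle_trans; [apply Rabs_triang|].
    eapply Rle_trans; [apply Rplus_le_compat_r, Rabs_triang|]. unfold D. lra. }
  assert (Hsmall : forall T e, 0 < e -> exists i, (T < i)%nat /\ D * rr ^ i < e).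
  { intros T e He. destruct (pow_small rr (e / D)) as (N & HN).
    - unfold rr. lra.
    - apply Rdiv_lt_0_compat; lra.
    - exists (S (Nat.max T N)). split; [lia|]. specialize (HN (S (Nat.max T N)) ltac:(lia)).
      apply Rmult_lt_reg_r with (/ D); [apply Rinv_0_lt_compat; lra|].
      rewrite (Rmult_comm D), Rmult_assoc, Rinv_r, Rmult_1_r by lra. exact HN. }
  (* The premise [0 <= x] under the existential makes the limit a total function; negative arguments
     get the default [0]. *)
  assert (Hlim : forall x, exists l, 0 <= x -> Un_cv (fun j => u (phi j) x) l).
  { intros x. destruct (Rle_dec 0 x) as [Hx|]; [|exists 0; lra].
    destruct (INR_exceeds x) as (T & HT).
    assert (HC : Cauchy_crit (fun j => u (phi j) x)).
    { intros e He. destruct (Hsmall T e He) as (i & Hi & Hie). exists i.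
      intros j j' Hj Hj'. unfold Rdist.
      eapply Rle_lt_trans; [apply (Hcau T i); [assumption|lia|lia|lra]|assumption]. }
    destruct (R_complete _ HC) as (l & Hl). exists l. auto. }
  set (g := fun x => proj1_sig (constructive_indefinite_description _ (Hlim x))).
  assert (Hg : forall x, 0 <= x -> Un_cv (fun j => u (phi j) x) (g x)).
  { intros x. unfold g. exact (proj2_sig (constructive_indefinite_description _ (Hlim x))). }
  assert (Hunif : forall T i j x, (T < i)%nat -> (i <= j)%nat -> 0 <= x <= INR T ->
     Rabs (u (phi j) x - g x) <= D * rr ^ i).
  { intros T i j x HT Hj Hx.
    apply (Un_cv_abs_le (fun j' => u (phi j) x - u (phi j') x) _ _ i).
    - apply (CV_minus (fun _ => u (phi j) x)); [|apply Hg; lra].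
      intros e He. exists 0%nat. intros. unfold Rdist. rewrite Rminus_diag, Rabs_R0. assumption.
    - intros j' Hj'. apply (Hcau T i); assumption. }
  exists g. split; [split; [|split]|].
  - intros x Hx e He. destruct (INR_exceeds (x + 1)) as (T & HT).
    destruct (Hsmall T (e / 3) ltac:(lra)) as (i & Hi & Hie).
    destruct (proj1 (Hu (phi i)) x Hx (e / 3) ltac:(lra)) as (d & Hd & Hc).
    exists (Rmin d 1). split; [apply Rmin_glb_lt; lra|]. intros y Hy Hyx.
    assert (Rabs (y - x) < d) by (eapply Rlt_le_trans; [exact Hyx|apply Rmin_l]).
    assert (Hy1 : Rabs (y - x) < 1) by (eapply Rlt_le_trans; [exact Hyx|apply Rmin_r]).
    apply Rabs_def2 in Hy1.
    pose proof (Hunif T i i x Hi (Nat.le_refl i) ltac:(lra)) as H1.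
    pose proof (Hunif T i i y Hi (Nat.le_refl i) ltac:(lra)) as H2.
    specialize (Hc y Hy ltac:(assumption)).
    rewrite Rabs_minus_sym in H2.
    replace (g y - g x) with ((g y - u (phi i) y) + (u (phi i) y - u (phi i) x)
      + (u (phi i) x - g x)) by ring.
    eapply Rle_lt_trans; [apply Rabs_triang|].
    eapply Rle_lt_trans; [apply Rplus_le_compat_r, Rabs_triang|]. lra.
  - apply (Un_cv_abs_le _ _ _ 0%nat (Hg 0 ltac:(lra))). intros j _. apply (Hu (phi j)).
  - intros m k Hk.
    apply (Un_cv_abs_le (fun j => u (phi j) (dy m (S k)) - u (phi j) (dy m k)) _ _ 0%nat).
    + apply CV_minus; apply Hg, dy_ge0.
    + intros j _. apply (Hu (phi j)). assumption.
  - intros T e He. destruct (INR_exceeds T) as (T' & HT).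
    destruct (Hsmall T' e He) as (i & Hi & Hie). exists i. intros m Hm x Hx.
    eapply Rle_lt_trans; [apply (Hunif T' i); [assumption|assumption|lra]|assumption].
Qed.

(** * Tightness *)

(** The union bound: [m 2^m] increments at scale [2^-m], each violating its bound with probability
    at most a constant times [4^-m / rr^(4 m)]. *)
Lemma dyadic_weight_bounded : exists D, 0 <= D /\ forall M,
  lsum (fun m => INR (m * 2 ^ m) * ((/ 2 ^ m) ^ 2 / (rr ^ m) ^ 4)) (seq 0 M) <= D.
Proof.
  (* The ratio [1 / (2 rr^4)], about [0.76], is split as [b * (9/10)]: the powers of [b] absorb the
     factor [m], those of [9/10] are summed. *)
  set (b := / 2 / rr ^ 4 / (9 / 10)).
  assert (Hb : 0 <= b < 1) by (unfold b, rr; lra).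
  exists (/ (1 - b) * / (1 - 9 / 10)). split.
  { apply Rmult_le_pos; [left; apply Rinv_0_lt_compat; lra|lra]. }
  intros M. eapply Rle_trans with (lsum (fun m => / (1 - b) * (9 / 10) ^ m) (seq 0 M)).
  - apply lsum_le. intros m _.
    replace (INR (m * 2 ^ m) * ((/ 2 ^ m) ^ 2 / (rr ^ m) ^ 4))
      with (INR m * b ^ m * (9 / 10) ^ m).
    + apply Rmult_le_compat_r; [apply pow_le; lra|]. apply INR_mul_pow_le. assumption.
    + assert (Hc : 9 / 10 <> 0) by lra. unfold b. clear b Hb.
      generalize (9 / 10) Hc. intros c Hc'. clear Hc.
      pose proof (pow_nonzero 2 m ltac:(lra)) as H2.
      pose proof (pow_nonzero c m Hc') as Hcm. pose proof (rr_pow_pos m) as Hr.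
      assert (E : (rr ^ 4) ^ m = (rr ^ m) ^ 4) by (rewrite <- !pow_mult; f_equal; lia).
      unfold Rdiv. rewrite mult_INR, INR_pow2, !Rpow_mult_distr, !pow_inv, E.
      field. repeat split; try assumption; lra.
  - rewrite lsum_scal. apply Rmult_le_compat_l; [left; apply Rinv_0_lt_compat; lra|].
    apply geom_sum_le. lra.
Qed.

(** For finitely many trees a violation, if there is one, already occurs below a common scale; the
    union bound becomes a finite sum. *)
Lemma finite_witness_bound {T} (Q : T -> nat -> Prop) (s : list T) :
  exists M, forall t, In t s -> (exists m, Q t m) -> exists m, (m < M)%nat /\ Q t m.
Proof.
  induction s as [|t s (M & HM)]; [exists 0%nat; contradiction|].
  destruct (classic (exists m, Q t m)) as [(m & Hm)|H].
  - exists (Nat.max M (S m)). intros t' [<-|Ht] He.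
    + exists m. split; [lia|assumption].
    + destruct (HM t' Ht He) as (m' & Hm' & HQ). exists m'. split; [lia|assumption].
  - exists M. intros t' [<-|Ht] He; [contradiction|auto].
Qed.

Lemma lproc_tight reps :
  (forall n, (1 <= n)%nat -> rep_system n (reps n)) -> tightC reps.
Proof.
  intros Hreps eps Heps.
  destruct lproc_moment as (C & HC & Hmom).
  destruct dyadic_weight_bounded as (D & HD & Hsum).
  (* The total probability is at most [C * D / B^4], which is below [eps] since [B <= B^4] and
     [C * D <= eps * B]. *)
  set (B := 1 + C * D / eps).
  assert (HCD : 0 <= C * D / eps).
  { apply Rmult_le_pos; [apply Rmult_le_pos; lra|]. left. apply Rinv_0_lt_compat. assumption. }
  assert (HB : 1 <= B) by (unfold B; lra).
  exists (Kset B). split; [apply Kset_compact|]. intros n Hn. set (s := reps n).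
  pose (bad := fun t m => exists k, (k < m * 2 ^ m)%nat /\
    B * rr ^ m < Rabs (lproc n t (dy m (S k)) - lproc n t (dy m k))).
  destruct (finite_witness_bound bad s) as (M & HM).
  (* Markov's inequality with fourth powers: [c m k t >= 1] whenever increment [k] at scale [m]
     violates the condition of [Kset B]. *)
  pose (c := fun m k t => (lproc n t (dy m (S k)) - lproc n t (dy m k)) ^ 4 / (B * rr ^ m) ^ 4).
  assert (Hc0 : forall m k t, 0 <= c m k t).
  { intros m k t. unfold c. apply Rmult_le_pos.
    - replace ((lproc n t (dy m (S k)) - lproc n t (dy m k)) ^ 4)
        with (((lproc n t (dy m (S k)) - lproc n t (dy m k)) ^ 2) ^ 2) by ring.
      apply pow2_ge_0.
    - left. apply Rinv_0_lt_compat, pow_lt, Rmult_lt_0_compat; [lra|apply rr_pow_pos]. }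
  unfold prob.
  apply Rle_trans with
    (avg s (fun t => lsum (fun m => lsum (fun k => c m k t) (seq 0 (m * 2 ^ m))) (seq 0 M))).
  - apply avg_le. intros t Ht.
    assert (Hs0 : 0 <= lsum (fun m => lsum (fun k => c m k t) (seq 0 (m * 2 ^ m))) (seq 0 M)).
    { apply lsum_ge0. intros m _. apply lsum_ge0. auto. }
    match goal with |- (if ?d then _ else _) <= _ => destruct d as [Hbad|] end; [|assumption].
    destruct (classic (exists m, bad t m)) as [Hex|Hno].
    + destruct (HM t Ht Hex) as (m & Hm & k & Hk & Hgt).
      apply Rle_trans with (c m k t).
      * unfold c. assert (Hp : 0 < B * rr ^ m) by (apply Rmult_lt_0_compat; [lra|apply rr_pow_pos]).
        rewrite <- (Rabs_pos_eq ((lproc n t (dy m (S k)) - lproc n t (dy m k)) ^ 4)).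
        2:{ replace ((lproc n t (dy m (S k)) - lproc n t (dy m k)) ^ 4)
              with (((lproc n t (dy m (S k)) - lproc n t (dy m k)) ^ 2) ^ 2) by ring.
            apply pow2_ge_0. }
        rewrite <- RPow_abs.
        apply Rmult_le_reg_r with ((B * rr ^ m) ^ 4); [apply pow_lt; assumption|].
        unfold Rdiv. rewrite Rmult_assoc, Rinv_l, Rmult_1_l, Rmult_1_r
          by (apply pow_nonzero; lra).
        apply pow_incr. lra.
      * eapply Rle_trans; [|apply (lsum_In_le _ _ m); [|apply in_seq; lia]].
        -- apply (lsum_In_le (fun k => c m k t) _ k); [auto|]. apply in_seq. lia.
        -- intros m' _. apply lsum_ge0. auto.
    + exfalso. apply Hbad. exists (lproc n t). split; [|reflexivity].
      split; [apply lproc_cont; assumption|split; [apply lproc_0; assumption|]].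
      intros m k Hk. apply Rnot_lt_le. intros Hgt. apply Hno. exists m, k. auto.
  - rewrite avg_lsum_exch.
    apply Rle_trans with (lsum (fun m => C / B ^ 4 *
      (INR (m * 2 ^ m) * ((/ 2 ^ m) ^ 2 / (rr ^ m) ^ 4))) (seq 0 M)).
    + apply lsum_le. intros m _. rewrite avg_lsum_exch.
      apply Rle_trans with (lsum (fun _ => C / B ^ 4 * ((/ 2 ^ m) ^ 2 / (rr ^ m) ^ 4))
                                 (seq 0 (m * 2 ^ m))).
      * apply lsum_le. intros k _. unfold c, Rdiv.
        pose proof (rr_pow_pos m) as Hr.
        assert (H2 : 0 < 2 ^ m) by (apply pow_lt; lra).
        assert (Hk : dy m (S k) - dy m k = / 2 ^ m) by (unfold dy; rewrite S_INR; field; lra).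
        pose proof (Rinv_0_lt_compat _ H2) as Hi2.
        pose proof (Hmom n s (dy m k) (dy m (S k)) Hn (Hreps n Hn)
          ltac:(pose proof (dy_ge0 m k); lra)) as Hm. rewrite Hk in Hm.
        eapply Rle_trans; [apply avg_le with (G := fun t => / (B * rr ^ m) ^ 4 *
          (lproc n t (dy m (S k)) - lproc n t (dy m k)) ^ 4); intros; lra|].
        rewrite avg_scal.
        eapply Rle_trans; [apply Rmult_le_compat_l; [|exact Hm]|].
        -- left. apply Rinv_0_lt_compat, pow_lt, Rmult_lt_0_compat; lra.
        -- right. field. lra.
      * rewrite lsum_const, length_seq. right. ring.
    + rewrite lsum_scal.
      assert (HB4 : B <= B ^ 4).
      { rewrite <- (pow_1 B) at 1. apply Rle_pow; [assumption|lia]. }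
      assert (0 < B ^ 4) by lra.
      apply Rle_trans with (C / B ^ 4 * D).
      { apply Rmult_le_compat_l; [|apply Hsum].
        apply Rmult_le_pos; [lra|left; apply Rinv_0_lt_compat; lra]. }
      apply Rmult_le_reg_r with (B ^ 4); [assumption|].
      replace (C / B ^ 4 * D * B ^ 4) with (C * D) by (field; lra).
      apply Rle_trans with (eps * B); [|apply Rmult_le_compat_l; lra].
      unfold B. replace (eps * (1 + C * D / eps)) with (eps + C * D) by (field; lra). lra.
Qed.

Theorem mainTheorem5 :
  (exists C : R, 0 < C /\
     forall (n r h : nat) (s : list tree), (1 <= n)%nat -> rep_system n s ->
       avg s (fun t => (INR (level t r) - INR (level t (r + h))) ^ 4)
         <= C * INR h ^ 2 * INR n) /\
  (forall reps : nat -> list tree,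
     (forall n, (1 <= n)%nat -> rep_system n (reps n)) -> tightC reps).
Proof. split; [apply fourth_moment_bound|apply lproc_tight]. Qed.
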